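(* Let $\varepsilon>0$ be a constant. Given a set $P$ of $n$ weighted points in the plane, a $(4+\varepsilon)$-approximation to the maximum-weight independent set of the unit disk graph of $P$ (an independent set $I^*\subseteq P$ with $(4+\varepsilon)\,w(I^* )\ge w(\mathit{OPT})$, $\mathit{OPT}$ a maximum-weight independent set) can be computed in $O(n)$ time on the real-RAM with constant-time hashing and the floor function. Without these operations, it can be computed in $O(n\log n)$ time.
   Context: The unit disk graph of a point set $P\subset\mathbb{R}^2$ has vertex set $P$, with two points adjacent iff their Euclidean distance is at most $2$. A set of points is independent if all pairwise distances are strictly greater than $2$. Each point $p$ has a real weight $w(p)$ and $w(S)=\sum_{p\in S}w(p)$. The model of computation is the real-RAM; the first bound additionally assumes the floor function and constant-time hashing are available. *)

(* Defs.v *)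
From HB Require Import structures.
From mathcomp Require Import all_boot all_order all_algebra finmap.
From mathcomp Require Import all_classical all_reals all_analysis.

Set Implicit Arguments.
Unset Strict Implicit.
Unset Printing Implicit Defensive.

Import Order.TTheory GRing.Theory Num.Theory.
Import numFieldNormedType.Exports.

Local Open Scope ring_scope.

Section UnitDiskGraph.
Variable R : realType.

Definition point : Type := (R * R)%type.

Definition dist (p q : point) : R :=
  Num.sqrt ((p.1 - q.1) ^+ 2 + (p.2 - q.2) ^+ 2).

Definition udg_adj : rel point := fun p q => (p != q) && (dist p q <= 2).

Definition independent (S : {fset point}) : Prop :=
  forall p q, p \in S -> q \in S -> p != q -> 2 < dist p q.

Lemma independent_udg (S : {fset point}) :
  independent S <-> forall p q, p \in S -> q \in S -> ~~ udg_adj p q.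
Proof.
split=> hS p q pS qS; first by rewrite negb_and -ltNge -implybE; apply/implyP/hS.
by move=> npq; have := hS p q pS qS; rewrite /udg_adj npq -ltNge.
Qed.

Definition weight (w : point -> R) (S : {fset point}) : R :=
  \sum_(p <- S) w p.

Definition max_weight_indep (P : {fset point}) (w : point -> R)
    (S : {fset point}) : Prop :=
  [/\ (S `<=` P)%fset, independent S &
      forall S' : {fset point},
        (S' `<=` P)%fset -> independent S' -> weight w S' <= weight w S].

Definition approx_mwis (rho : R) (P : {fset point}) (w : point -> R)
    (S : {fset point}) : Prop :=
  [/\ (S `<=` P)%fset, independent S &
      forall OPT : {fset point},
        max_weight_indep P w OPT -> weight w OPT <= rho * weight w S].

End UnitDiskGraph.

(* The real-RAM.  Memory has two sorts, integers and reals.  Each sort has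
   registers, named by a literal natural number, and arrays: [IGet a i] and
   [RGet a i] read cell [i], computed at run time, of the array with literal
   name [a].  As a program mentions only finitely many names, this is ordinary
   indirect addressing into one memory, up to interleaving the arrays.

   Integers support only addition and subtraction, reals the four arithmetic
   operations; literals are integers in both sorts.  Both sorts have exact
   comparisons.  Two further primitives can be switched off by [plain] below:
   [IFloor], the only way to turn a real into an integer, and hash tables
   ([IFind], [Insert]), which associate integers to pairs of integers. *)
Inductive iexp : Type :=
| IConst of int
| IVar of nat
| IGet of nat & iexp
| IAdd of iexp & iexp
| ISub of iexp & iexp
| IFloor of rexp
| IFind of nat & iexp & iexp
with rexp : Type :=
| RConst of int
| RVar of nat
| RGet of nat & iexp
| ROfInt of iexp
| RAdd of rexp & rexp
| RSub of rexp & rexp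
| RMul of rexp & rexp
| RDiv of rexp & rexp.

Inductive test : Type :=
| ILe of iexp & iexp
| RLe of rexp & rexp
| TNot of test
| TAnd of test & test.

Inductive cmd : Type :=
| Skip
| ISet of nat & iexp
| RSet of nat & rexp
| IPut of nat & iexp & iexp
| RPut of nat & iexp & rexp
| Insert of nat & iexp & iexp & iexp
| Seq of cmd & cmd
| If of test & cmd & cmd
| While of test & cmd.

Fixpoint plain_i (e : iexp) : bool :=
  match e with
  | IConst _ | IVar _ => true
  | IGet _ e1 => plain_i e1
  | IAdd e1 e2 | ISub e1 e2 => plain_i e1 && plain_i e2
  | IFloor _ | IFind _ _ _ => false
  end.

Fixpoint plain_r (e : rexp) : bool :=
  match e with
  | RConst _ | RVar _ => true
  | RGet _ e1 | ROfInt e1 => plain_i e1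
  | RAdd e1 e2 | RSub e1 e2 | RMul e1 e2 | RDiv e1 e2 =>
      plain_r e1 && plain_r e2
  end.

Fixpoint plain_t (b : test) : bool :=
  match b with
  | ILe e1 e2 => plain_i e1 && plain_i e2
  | RLe e1 e2 => plain_r e1 && plain_r e2
  | TNot b1 => plain_t b1
  | TAnd b1 b2 => plain_t b1 && plain_t b2
  end.

(* Programs using neither the floor function nor hashing. *)
Fixpoint plain (c : cmd) : bool :=
  match c with
  | Skip => true
  | ISet _ e => plain_i e
  | RSet _ e => plain_r e
  | IPut _ e1 e2 => plain_i e1 && plain_i e2
  | RPut _ e1 e2 => plain_i e1 && plain_r e2
  | Insert _ _ _ _ => false
  | Seq c1 c2 => plain c1 && plain c2
  | If b c1 c2 => [&& plain_t b, plain c1 & plain c2]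
  | While b c1 => plain_t b && plain c1
  end.

(* Running times: one unit per node of an expression, per test and per
   command. *)
Fixpoint cost_i (e : iexp) : nat :=
  match e with
  | IConst _ | IVar _ => 1%N
  | IGet _ e1 => (cost_i e1).+1
  | IAdd e1 e2 | ISub e1 e2 | IFind _ e1 e2 => (cost_i e1 + cost_i e2).+1%N
  | IFloor e1 => (cost_r e1).+1
  end
with cost_r (e : rexp) : nat :=
  match e with
  | RConst _ | RVar _ => 1%N
  | RGet _ e1 | ROfInt e1 => (cost_i e1).+1
  | RAdd e1 e2 | RSub e1 e2 | RMul e1 e2 | RDiv e1 e2 =>
      (cost_r e1 + cost_r e2).+1%N
  end.

Fixpoint cost_t (b : test) : nat :=
  match b with
  | ILe e1 e2 => (cost_i e1 + cost_i e2).+1%N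
  | RLe e1 e2 => (cost_r e1 + cost_r e2).+1%N
  | TNot b1 => (cost_t b1).+1
  | TAnd b1 b2 => (cost_t b1 + cost_t b2).+1%N
  end.

Section Semantics.
Variable R : realType.

(* [iarr (a, i)] is cell [i] of array [a]; [hash (h, i, j)] is the value bound
   to the key (i, j) in table [h], and 0 if there is none. *)
Record state := State {
  ireg : nat -> int;
  rreg : nat -> R;
  iarr : nat * int -> int;
  rarr : nat * int -> R;
  hash : nat * int * int -> int
}.

(* Division by zero returns 0. *)
Fixpoint eval_i (s : state) (e : iexp) : int :=
  match e with
  | IConst z => z
  | IVar x => ireg s x
  | IGet a e1 => iarr s (a, eval_i s e1)
  | IAdd e1 e2 => eval_i s e1 + eval_i s e2
  | ISub e1 e2 => eval_i s e1 - eval_i s e2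
  | IFloor e1 => Num.floor (eval_r s e1)
  | IFind h e1 e2 => hash s (h, eval_i s e1, eval_i s e2)
  end
with eval_r (s : state) (e : rexp) : R :=
  match e with
  | RConst z => z%:~R
  | RVar x => rreg s x
  | RGet a e1 => rarr s (a, eval_i s e1)
  | ROfInt e1 => (eval_i s e1)%:~R
  | RAdd e1 e2 => eval_r s e1 + eval_r s e2
  | RSub e1 e2 => eval_r s e1 - eval_r s e2
  | RMul e1 e2 => eval_r s e1 * eval_r s e2
  | RDiv e1 e2 => eval_r s e1 / eval_r s e2
  end.

Fixpoint eval_t (s : state) (b : test) : bool :=
  match b with
  | ILe e1 e2 => eval_i s e1 <= eval_i s e2
  | RLe e1 e2 => eval_r s e1 <= eval_r s e2
  | TNot b1 => ~~ eval_t s b1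
  | TAnd b1 b2 => eval_t s b1 && eval_t s b2
  end.

Definition set_ireg s x v :=
  State [eta ireg s with x |-> v] (rreg s) (iarr s) (rarr s) (hash s).
Definition set_rreg s x v :=
  State (ireg s) [eta rreg s with x |-> v] (iarr s) (rarr s) (hash s).
Definition set_iarr s k v :=
  State (ireg s) (rreg s) [eta iarr s with k |-> v] (rarr s) (hash s).
Definition set_rarr s k v :=
  State (ireg s) (rreg s) (iarr s) [eta rarr s with k |-> v] (hash s).
Definition set_hash s k v :=
  State (ireg s) (rreg s) (iarr s) (rarr s) [eta hash s with k |-> v].

(* [exec c s t s']: started in [s], the program [c] halts after [t] units of
   time in [s']. *)
Inductive exec : cmd -> state -> nat -> state -> Prop :=
| ExecSkip s : exec Skip s 1 s
| ExecISet s x e :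
    exec (ISet x e) s (cost_i e).+1 (set_ireg s x (eval_i s e))
| ExecRSet s x e :
    exec (RSet x e) s (cost_r e).+1 (set_rreg s x (eval_r s e))
| ExecIPut s a e1 e2 :
    exec (IPut a e1 e2) s (cost_i e1 + cost_i e2).+1%N
         (set_iarr s (a, eval_i s e1) (eval_i s e2))
| ExecRPut s a e1 e2 :
    exec (RPut a e1 e2) s (cost_i e1 + cost_r e2).+1%N
         (set_rarr s (a, eval_i s e1) (eval_r s e2))
| ExecInsert s h e1 e2 e3 :
    exec (Insert h e1 e2 e3) s (cost_i e1 + cost_i e2 + cost_i e3).+1%N
         (set_hash s (h, eval_i s e1, eval_i s e2) (eval_i s e3))
| ExecSeq c1 c2 s1 s2 s3 t1 t2 :
    exec c1 s1 t1 s2 -> exec c2 s2 t2 s3 -> exec (Seq c1 c2) s1 (t1 + t2)%N s3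
| ExecIf b c1 c2 s s' t :
    exec (if eval_t s b then c1 else c2) s t s' ->
    exec (If b c1 c2) s (cost_t b + t).+1%N s'
| ExecWhileEnd b c s :
    ~~ eval_t s b -> exec (While b c) s (cost_t b).+1 s
| ExecWhileLoop b c s1 s2 s3 t1 t2 :
    eval_t s1 b -> exec c s1 t1 s2 -> exec (While b c) s2 t2 s3 ->
    exec (While b c) s1 (cost_t b + t1 + t2).+1%N s3.

(* The point set is given as an array in arbitrary order: integer register 0
   holds the number of points; real arrays 0, 1 and 2 hold the abscissas, the
   ordinates and the weights.  All other memory is 0. *)
Definition input (ps : seq (point R)) (w : point R -> R) : state :=
  State
    [eta fun=> 0 with 0%N |-> (size ps)%:Z]
    (fun=> 0)
    (fun=> 0)
    (fun k => if k is (a, Posz i) then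
                if (i < size ps)%N then
                  let p := nth (0, 0) ps i in
                  match a with
                  | 0%N => p.1 | 1%N => p.2 | 2%N => w p | _ => 0
                  end
                else 0
              else 0)
    (fun=> 0).

(* Integer register 0 holds the number of output points, real arrays 3 and 4
   their coordinates. *)
Definition outputs (s : state) (qs : seq (point R)) : Prop :=
  ireg s 0 = (size qs)%:Z /\
  forall i, (i < size qs)%N ->
    (rarr s (3%N, i%:Z), rarr s (4%N, i%:Z)) = nth (0, 0) qs i.

(* On every set of n weighted points, given in any order, [c] halts within
   [T n] units of time and lists, without repetition, a [rho]-approximate
   maximum-weight independent set. *)
Definition approximates_mwis (rho : R) (c : cmd) (T : nat -> nat) : Prop :=
  forall (ps : seq (point R)) (w : point R -> R), uniq ps ->
    exists (t : nat) (s : state) (qs : seq (point R)),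
      [/\ exec c (input ps w) t s, (t <= T (size ps))%N, outputs s qs,
          uniq qs &
          approx_mwis rho [fset p in ps]%fset w [fset q in qs]%fset].

Local Open Scope classical_set_scope.

Definition bigO_time (T : nat -> nat) (f : nat -> R) : Prop :=
  (fun n => (T n)%:R : R^o) =O_\oo (f : nat -> R^o).

End Semantics.

(* Main.v *)
(* Shifting coresets.  The plane is cut into large cells of side 2K.  In the
   a-th of K grids, moved by 2a in both coordinates, the points within 2 of the
   left or lower side of their cell are dropped, so that the remaining points of
   different cells are independent; as a point is dropped by at most two of the K
   grids, some grid retains a fraction (K - 2) / K of the optimum.  In each cell
   only a heaviest point of every slot of side 1/M is kept, and the best
   independent set among these boundedly many representatives is found by
   exhaustive search.  The representatives of an independent set have pairwise
   distances close to 2 at least, so their unit disk graph is 4-colorable, like a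
   penny graph, and its heaviest color class has a quarter of the weight.

   Cells are identified by the floor function and a hash table.  Without these,
   the coordinates are sorted and cut into intervals from left to right,
   starting a new grid after each large gap, and cells are identified by sorting
   the pairs of interval numbers. *)
Require Import Defs.
From mathcomp Require Import all_boot all_order all_algebra finmap.
From mathcomp Require Import all_classical all_reals all_analysis.
From mathcomp Require Import zify ring lra.

Set Implicit Arguments.
Unset Strict Implicit.
Unset Printing Implicit Defensive.

Import Order.TTheory GRing.Theory Num.Theory.
Local Open Scope ring_scope.

(** * Near-penny graphs *)

(** A penny graph is 4-colorable because a point of largest norm has at most three neighbours: they
    are seen from it under an angle less than pi, and two of them under an angle less than pi / 3
    would be too close. Rounding to representatives spoils exact distances, so a quantitative
    version is needed. The missing angle tends to 0 as the cell grows, but a cell of fixed size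
    admits a threshold [m < 4] for squared distances. This dictates the order of the constants: [K]
    from [eps], the side [L = 2 * K], then [m] from [L], then [M] from [m] and [L].

    Whatever depends on [eps] only (shifts, slots, sets of slots) is unrolled in the program text,
    so [work] is a constant. Loops at run time range over the [n] points, the [2 * n + 1] possible
    cell numbers, the selected points or the merging passes. The two machine models differ only in
    how coordinates are cut and cells are numbered; everything else is parametric in these two
    subprograms. *)

Section Geometry.
Variable R : realType.
Implicit Types (p q : R * R).

Definition norm2 p : R := p.1 ^+ 2 + p.2 ^+ 2.
Definition dist2 p q : R := (p.1 - q.1) ^+ 2 + (p.2 - q.2) ^+ 2.

(* In coordinates along the boundary rays (1, lo) and (1, hi) of a cone, dot
   and cross products of two vectors of the cone are bilinear with nonnegative
   coefficients, so the extreme angle is the one between the two rays. *)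
Lemma cone_cross (lo hi k s t s' t' : R) :
  lo < hi -> 0 < 1 + lo * hi -> hi - lo <= k * (1 + lo * hi) ->
  lo * s <= t <= hi * s -> lo * s' <= t' <= hi * s' ->
  (s * t' - t * s') ^+ 2 <= k ^+ 2 * (s * s' + t * t') ^+ 2 /\
  0 <= s * s' + t * t'.
Proof.
move=> lohi pos hk /andP[a1 a2] /andP[b1 b2].
(* These are coordinates along the two rays: [(hi - lo) * (s, t) = P * (1, lo) + Q * (1, hi)]. *)
pose P := hi * s - t; pose Q := t - lo * s.
pose P' := hi * s' - t'; pose Q' := t' - lo * s'.
have P0 : 0 <= P by rewrite subr_ge0.
have Q0 : 0 <= Q by rewrite subr_ge0.
have P0' : 0 <= P' by rewrite subr_ge0.
have Q0' : 0 <= Q' by rewrite subr_ge0.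
set d := hi - lo in hk *; have d0 : 0 < d by rewrite subr_gt0.
set c := s * t' - t * s'; set e := s * s' + t * t'.
set h := 1 + lo * hi in pos hk *.
have dc : d * c = P * Q' - Q * P' by rewrite /d /c /P /Q /P' /Q'; ring.
have de : d ^+ 2 * e = P * P' * (1 + lo ^+ 2) + Q * Q' * (1 + hi ^+ 2)
    + (P * Q' + Q * P') * h by rewrite /d /e /h /P /Q /P' /Q'; ring.
have PQ0 : 0 <= P * Q' by rewrite mulr_ge0.
have QP0 : 0 <= Q * P' by rewrite mulr_ge0.
have PP0 : 0 <= P * P' * (1 + lo ^+ 2).
  by rewrite !mulr_ge0// addr_ge0// sqr_ge0.
have QQ0 : 0 <= Q * Q' * (1 + hi ^+ 2).
  by rewrite !mulr_ge0// addr_ge0// sqr_ge0.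
have le1 : (P * Q' + Q * P') * h <= d ^+ 2 * e by rewrite de lerDr addr_ge0.
have e0 : 0 <= e.
  rewrite -(pmulr_rge0 _ (exprn_gt0 2 d0)); apply: le_trans le1.
  by apply: mulr_ge0; [exact: addr_ge0|exact: ltW].
split=> //.
have k0 : 0 <= k by rewrite -(pmulr_lge0 _ pos); apply: le_trans hk; exact: ltW.
have cabs : `|c| <= k * e.
  have : d * `|c| <= P * Q' + Q * P'.
    rewrite -{1}(gtr0_norm d0) -normrM dc ler_norml; apply/andP; split; lra.
  move=> h1.
  have : d ^+ 2 * (`|c|) <= d ^+ 2 * (k * e).
    rewrite expr2 -mulrA; apply: le_trans (_ : d * (P * Q' + Q * P') <= _).
      by rewrite ler_pM2l.
    apply: le_trans (_ : (k * h) * (P * Q' + Q * P') <= _).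
      by rewrite ler_wpM2r // addr_ge0.
    rewrite mulrCA -mulrA ler_wpM2l // mulrC.
    by rewrite -expr2.
  by rewrite ler_pM2l ?exprn_gt0.
rewrite -exprMn -(real_normK (num_real c)) ler_sqr ?nnegrE //.
by rewrite mulr_ge0.
Qed.

(** The slopes [-T], [-t], [t], [T] bound three cones, and [k] bounds the tangents of their angles;
    [k ^+ 2 < 3] means less than pi / 3. For infinite [T] one would take
    [t = tan (pi / 6) = 1 / sqrt 3]. The factor [1 - T^-1] shrinks the middle cone just enough for
    the outer ones to stay below pi / 3. *)
Lemma sector_constants (T : R) : 1 < T ->
  exists t k : R, [/\ 0 < t < 1, t < T, k ^+ 2 < 3, 2 * t <= k * (1 - t ^+ 2) &
    T - t <= k * (1 + t * T)].
Proof.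
move=> T1; have T0 : 0 < T by lra.
pose r : R := Num.sqrt 3; have r2 : r ^+ 2 = 3 by rewrite sqr_sqrtr.
have r0 : 0 < r by rewrite sqrtr_gt0.
have r1 : 1 < r by rewrite -(ltr_sqr (ltW ltr01)) // ?nnegrE ?r2 ?(ltW r0) //; lra.
pose t := (1 - T^-1) / r.
have Ti : 0 < T^-1 < 1 by rewrite invr_gt0 T0 invf_lt1.
have t0 : 0 < t by rewrite divr_gt0 //; lra.
have rt : r * t = 1 - T^-1 by rewrite mulrC divfK // gt_eqF.
have rt1 : r * t < 1 by lra.
have t1 : t < 1.
  have : t * 1 < t * r by rewrite ltr_pM2l. by rewrite mulrC in rt1 *; lra.
have t2 : 3 * t ^+ 2 < 1.
  have : (r * t) ^+ 2 < 1 by rewrite expr_lt1// mulr_ge0 // ltW.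
  by rewrite exprMn r2.
have p1 : 0 < 1 - t ^+ 2 by lra.
have p2 : 0 < 1 + t * T by rewrite addr_gt0 // mulr_gt0.
have k1 : 2 * t / (1 - t ^+ 2) < r.
  rewrite ltr_pdivrMr // -(ltr_pM2l r0).
  have -> : r * (2 * t) = 2 * (r * t) by ring.
  have -> : r * (r * (1 - t ^+ 2)) = r ^+ 2 * (1 - t ^+ 2) by ring.
  by rewrite r2; lra.
have k2 : (T - t) / (1 + t * T) < r.
  rewrite ltr_pdivrMr // mulrDr mulr1 mulrA rt mulrBl mul1r mulVf ?gt_eqF //.
  by lra.
exists t, (Num.max (2 * t / (1 - t ^+ 2)) ((T - t) / (1 + t * T))); split=> //.
- by rewrite t0.
- lra.
- rewrite -r2 ltr_sqr ?nnegrE ?(ltW r0) //; first by rewrite gt_max k1 k2.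
  by rewrite le_max divr_ge0 //; [apply: mulr_ge0; lra|lra].
- by rewrite -ler_pdivrMr // le_max lexx.
- by rewrite -ler_pdivrMr // le_max lexx orbT.
Qed.

(* The disc around the origin through [p] sees [p] under an angle smaller than
   pi, by a margin depending on [D] only.  It is covered by three cones with
   apex [p] and angle less than pi / 3. *)
Lemma three_sectors (D : R) : 0 <= D ->
  exists m : R, [/\ 2 <= m, m < 4 &
    forall p, norm2 p <= D ->
    exists c : R * R -> 'I_3, forall q q',
      norm2 q <= norm2 p -> norm2 q' <= norm2 p ->
      m <= dist2 p q <= 4 -> m <= dist2 p q' <= 4 ->
      c q = c q' -> dist2 q q' < m].
Proof.
move=> D0; pose T := 2 * (D + 1).
have T1 : 1 < T by rewrite /T; lra.
have [t [k [/andP[t0 t1] tT k3 kmid kside]]] := sector_constants T1.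
(* This is the inverse cosine factor of the angle with tangent [k]; it is below 2 as the angle is
   below pi / 3. *)
pose r := Num.sqrt (1 + k ^+ 2).
have k20 := sqr_ge0 k.
have r2 : r ^+ 2 = 1 + k ^+ 2 by rewrite sqr_sqrtr //; lra.
have r1 : 1 <= r by rewrite -[1]sqrtr1 ler_wsqrtr //; lra.
have r4 : r < 2.
  rewrite -(ltr_sqr (x := r)) ?nnegrE ?r2 //; lra.
(* Two points of one cone have [r * dt' >= m], where [dt'] is their dot product seen from [p]. Hence
   [r * dist2 q q' <= 8 * r - 2 * m], which is below [r * m] iff [8 * r < m * (r + 2)]. The midpoint
   satisfies this and stays below 4. *)
pose m := (8 * r / (r + 2) + 4) / 2.
have rp : 0 < r + 2 by lra.
have m0 : 8 * r / (r + 2) < 4 by rewrite ltr_pdivrMr //; lra.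
have m1 : 2 <= 8 * r / (r + 2) by rewrite ler_pdivlMr //; lra.
have m3 : 8 * r < m * (r + 2) by rewrite -ltr_pdivrMr // /m; lra.
have m2 : 2 <= m by rewrite /m; lra.
have m4 : m < 4 by rewrite /m; lra.
exists m; split=> // p pD.
(* Up to the factor [|p|], [s] and [u] are the coordinates of [q - p] along and across the direction
   from [p] to the origin. As [2 * s q = norm2 p - norm2 q + dist2 p q], points of the disc at
   squared distance at least [m >= 2] have [s >= 1]. *)
pose s q := - p.1 * (q.1 - p.1) - p.2 * (q.2 - p.2).
pose u q := - p.1 * (q.2 - p.2) + p.2 * (q.1 - p.1).
exists (fun q => if u q < - t * s q then inord 0 else
              if u q <= t * s q then inord 1 else inord 2).
move=> q q' hq hq' /andP[a1 a2] /andP[b1 b2].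
have su q0 : norm2 q0 <= norm2 p -> m <= dist2 p q0 -> dist2 p q0 <= 4 ->
    1 <= s q0 /\ - T * s q0 <= u q0 <= T * s q0.
  move=> h1 h2 h3.
  have s1 : 1 <= s q0.
    have : norm2 p - norm2 q0 = 2 * s q0 - dist2 p q0.
      by rewrite /norm2 /dist2 /s; ring.
    by move: h1 h2 m2; lra.
  split=> //.
  have su2 : s q0 ^+ 2 + u q0 ^+ 2 = norm2 p * dist2 p q0.
    by rewrite /norm2 /dist2 /s /u; ring.
  have uT : `|u q0| <= T.
    rewrite -ler_sqr ?nnegrE ?normr_ge0 //; last by lra.
    rewrite real_normK ?num_real //; have := sqr_ge0 (s q0).
    have : norm2 p * dist2 p q0 <= D * 4.
      by apply: ler_pM => //; rewrite addr_ge0 // sqr_ge0.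
    rewrite {1}/T; nra.
  have : T <= T * s q0 by rewrite ler_peMr //; lra.
  move: uT; rewrite ler_norml => /andP[]; lra.
have [s1 /andP[u1 u2]] := su _ hq a1 a2.
have [s2 /andP[v1 v2]] := su _ hq' b1 b2.
have fin lo hi : lo < hi -> 0 < 1 + lo * hi -> hi - lo <= k * (1 + lo * hi) ->
    lo * s q <= u q <= hi * s q -> lo * s q' <= u q' <= hi * s q' ->
    dist2 q q' < m.
  move=> h1 h2 h3 h4 h5.
  have [cr dt] := cone_cross h1 h2 h3 h4 h5.
  have p0 : 0 < norm2 p.
    rewrite lt_neqAle addr_ge0 ?sqr_ge0 // andbT eq_sym.
    apply/negP => /eqP e0.
    have : s q ^+ 2 + u q ^+ 2 = norm2 p * dist2 p q.
      by rewrite /norm2 /dist2 /s /u; ring.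
    rewrite e0 mul0r; have := sqr_ge0 (u q); nra.
  pose dt' := (q.1 - p.1) * (q'.1 - p.1) + (q.2 - p.2) * (q'.2 - p.2).
  have dtE : s q * s q' + u q * u q' = norm2 p * dt'.
    by rewrite /s /u /norm2 /dt'; ring.
  have dt0 : 0 <= dt' by move: dt; rewrite dtE pmulr_rge0.
  have AB : dist2 p q * dist2 p q' <= (r * dt') ^+ 2.
    rewrite -(ler_pM2l (exprn_gt0 2 p0)) exprMn r2.
    have -> : norm2 p ^+ 2 * (dist2 p q * dist2 p q') =
        (s q * s q' + u q * u q') ^+ 2 + (s q * u q' - u q * s q') ^+ 2.
      by rewrite /s /u /norm2 /dist2; ring.
    have -> : norm2 p ^+ 2 * ((1 + k ^+ 2) * dt' ^+ 2) =
       (1 + k ^+ 2) * (s q * s q' + u q * u q') ^+ 2 by rewrite dtE; ring.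
    by rewrite [leRHS]mulrDl mul1r lerD2l.
  have mm : m ^+ 2 <= dist2 p q * dist2 p q' by rewrite expr2 ler_pM //; lra.
  have mr : m <= r * dt'.
    rewrite -ler_sqr ?nnegrE; first exact: le_trans AB.
      lra.
    by rewrite mulr_ge0 //; lra.
  have -> : dist2 q q' = dist2 p q + dist2 p q' - 2 * dt'.
    by rewrite /dist2 /dt'; ring.
  rewrite -(ltr_pM2l (_ : 0 < r)); last by lra.
  nra.
have neq (i j : nat) : (inord i : 'I_3) = inord j -> (i < 3)%N -> (j < 3)%N -> i = j.
  by move=> + hi hj => /(congr1 val); rewrite /= !inordK.
case: (ltP (u q)) => c1; [|case: (leP (u q)) => c2];
  (case: (ltP (u q')) => c3; [|case: (leP (u q')) => c4]);
  move=> /neq cc; move: (cc isT isT) => // {cc} _.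
- apply: (fin (- T) (- t)); [lra|nra|nra| |]; apply/andP; split; lra.
- apply: (fin (- t) t); [lra|nra|nra| |]; apply/andP; split; lra.
- apply: (fin t T); [lra|nra|nra| |]; apply/andP; split; lra.
Qed.

End Geometry.

Lemma seq_argmax (R : realType) (T : eqType) (f : T -> R) (s : seq T) :
  s != [::] -> exists2 x, x \in s & forall y, y \in s -> f y <= f x.
Proof.
elim: s => // a [|b s] IH _.
  by exists a => [|y]; rewrite ?mem_head // inE => /eqP ->.
have [x xs xmax] := IH isT; have [fax|/ltW fxa] := leP (f a) (f x).
  exists x => [|y]; first by rewrite inE xs orbT.
  by rewrite inE => /orP[/eqP ->//|/xmax].
exists a => [|y]; rewrite ?mem_head // inE => /orP[/eqP ->//|/xmax fy].
exact: le_trans fxa.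
Qed.

Section Coloring.
Variables (R : realType) (m : R) (T : eqType) (P : T -> R * R).

(* The point of largest norm has at most one neighbour in each of the sectors
   of [three_sectors], hence at most three neighbours. *)
Lemma four_coloring (D : R) (A : seq T) :
  (forall p : R * R, norm2 p <= D ->
    exists c : R * R -> 'I_3, forall q q',
      norm2 q <= norm2 p -> norm2 q' <= norm2 p ->
      m <= dist2 p q <= 4 -> m <= dist2 p q' <= 4 ->
      c q = c q' -> dist2 q q' < m) ->
  uniq A -> (forall s, s \in A -> norm2 (P s) <= D) ->
  {in A &, forall s t, s != t -> m <= dist2 (P s) (P t)} ->
  exists col : T -> 'I_4,
    {in A &, forall s t, s != t -> dist2 (P s) (P t) <= 4 -> col s != col t}.
Proof.
move=> sec; have [k] := ubnP (size A); elim: k A => // k IH A.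
have [->|An0] := eqVneq A [::]; first by exists (fun=> ord0).
move=> szA uA bA mA; have [p pA pmax] := seq_argmax (fun s => norm2 (P s)) An0.
have [||||col colP] := IH (rem p A).
- by rewrite size_rem //; case: (A) An0 szA.
- exact: rem_uniq.
- by move=> s /mem_rem; apply: bA.
- by move=> s t /mem_rem sA /mem_rem tA; apply: mA.
have [c cP] := sec _ (bA _ pA).
pose N := [seq t <- rem p A | dist2 (P p) (P t) <= 4].
have NP t : t \in N -> [/\ t \in A, t != p & dist2 (P p) (P t) <= 4].
  by rewrite mem_filter mem_rem_uniq // inE => /and3P[].
have szN : (size N <= 3)%N.
  have uc : uniq (map (c \o P) N).
    rewrite map_inj_in_uniq ?filter_uniq ?rem_uniq // => s t sN tN /= cst.
    have [sA sp s4] := NP _ sN; have [tA tp t4] := NP _ tN.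
    apply: contra_eq cst => st; apply/negP => /eqP cst.
    have := cP (P s) (P t) (pmax _ sA) (pmax _ tA).
    rewrite s4 t4 !mA //; [|by rewrite eq_sym..].
    by move=> /(_ isT isT cst); apply/negP; rewrite -leNgt mA.
  rewrite -(size_map (c \o P)); apply: leq_trans (_ : (#|'I_3| <= 3)%N).
    by rewrite cardE; apply: uniq_leq_size => // i _; rewrite mem_enum.
  by rewrite card_ord.
have [f fN] : exists f : 'I_4, f \notin map col N.
  apply/existsP; rewrite -negb_forall; apply/negP => /forallP h.
  have : (#|'I_4| <= size (map col N))%N.
    rewrite cardE; apply: uniq_leq_size; first exact: enum_uniq.
    by move=> i _; apply: h.
  by rewrite card_ord size_map => h4; have := leq_trans h4 szN.
exists (fun t => if t == p then f else col t) => s t sA tA st d4.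
have dC q q' : dist2 q q' = dist2 q' q :> R by rewrite /dist2; ring.
have inr q : q \in A -> q != p -> q \in rem p A.
  by move=> qA qp; rewrite mem_rem_uniq // inE qp.
have [sp|sp] := eqVneq s p; have [tp|tp] := eqVneq t p.
- by move: st; rewrite sp tp eqxx.
- apply: contra fN => /eqP ->; apply: map_f.
  by rewrite mem_filter -sp d4 sp; apply: inr.
- rewrite eq_sym; apply: contra fN => /eqP ->; apply: map_f.
  by rewrite mem_filter dC -tp d4 tp; apply: inr.
- by apply: colP => //; apply: inr.
Qed.

Lemma heavy_color_class (A : seq T) (w : T -> R) (col : T -> 'I_4) :
  exists c, \sum_(s <- A) w s <= 4 * \sum_(s <- A | col s == c) w s.
Proof.
apply/existsP; rewrite -[X in is_true X]negbK negb_exists; apply/negP => /forallP h.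
have : \sum_(c : 'I_4) (4 * \sum_(s <- A | col s == c) w s) <
       \sum_(c : 'I_4) \sum_(s <- A) w s.
  apply: ltr_sum; first by apply/hasP; exists ord0; rewrite ?mem_index_enum.
  by move=> c _; rewrite ltNge.
rewrite -mulr_sumr sumr_const card_ord.
rewrite (exchange_big_dep xpredT) //=.
under eq_bigr => s _ do rewrite (big_pred1 (col s)) //.
by rewrite mulr_natl ltxx.
Qed.

End Coloring.

(** * Slots of a cell and the loss of a factor 4 by their representatives *)

Fixpoint sublists (T : Type) (l : seq T) : seq (seq T) :=
  if l is x :: l' then sublists l' ++ map (cons x) (sublists l') else [:: [::]].

Lemma filter_sublists (T : eqType) (p : pred T) (l : seq T) :
  [seq a <- l | p a] \in sublists l.
Proof.
elim: l => //= x l IH; case: ifP => _; rewrite mem_cat.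
  by rewrite map_f ?orbT.
by rewrite IH.
Qed.

Lemma sublists_subseq (T : eqType) (l s : seq T) :
  s \in sublists l -> subseq s l.
Proof.
elim: l s => [|x l IH] s /=; first by rewrite inE => /eqP ->.
rewrite mem_cat => /orP[/IH sl|/mapP[s' /IH sl ->]].
  exact: subseq_trans sl (subseq_cons _ _).
by rewrite /= eqxx.
Qed.

Lemma sublists_nil (T : Type) (l : seq T) :
  exists l', sublists l = [::] :: l'.
Proof. by elim: l => [|x l [l' /= ->]]; eexists. Qed.

(* A large cell of side [L] is cut into slots of side [1 / M], indexed by pairs
   of naturals. *)
Definition slot : Type := (nat * nat)%type.

Definition slots (L M : nat) : seq slot :=
  allpairs pair (iota 0 (M * L)) (iota 0 (M * L)).

Definition pairs_of (s : seq slot) : seq (slot * slot) :=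
  [seq st <- allpairs pair s s | st.1 != st.2].

Section Cell.
Variables (R : realType) (x y w : nat -> R).

Definition pt (i : nat) : R * R := (x i, y i).

(** [sl] maps a slot to the index of its representative; a negative value marks an empty slot. *)
Definition valid (sl : slot -> int) (s : seq slot) : bool :=
  all (fun a => 0 <= sl a) s &&
  all (fun ab => 4 < dist2 (pt `|sl ab.1|) (pt `|sl ab.2|)) (pairs_of s).

Definition value (sl : slot -> int) (s : seq slot) : R :=
  \sum_(a <- s) w `|sl a|%N.

Definition in_slot (M : nat) (u v : R) (a : slot) : bool :=
  [&& a.1%:R <= M%:R * u, M%:R * u < a.1%:R + 1,
      a.2%:R <= M%:R * v & M%:R * v < a.2%:R + 1].

Lemma in_slot_ex (L M : nat) (u v : R) : (0 < M)%N ->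
  0 <= u < L%:R -> 0 <= v < L%:R ->
  exists2 a, a \in slots L M & in_slot M u v a.
Proof.
move=> M0.
have M0' : 0 < M%:R :> R by rewrite ltr0n.
have tr (z : R) : 0 <= z < L%:R -> exists p : nat,
    [/\ (p < M * L)%N, p%:R <= M%:R * z & M%:R * z < p%:R + 1].
  move=> /andP[z0 zL]; exists (Num.truncn (M%:R * z)).
  have Mz0 : 0 <= M%:R * z by rewrite mulr_ge0 // ltW.
  have /andP[h1 h2] := truncn_itv Mz0.
  split=> //; last by rewrite natr1.
  by rewrite -(ltr_nat R) natrM (le_lt_trans h1) // ltr_pM2l.
move=> /tr[p [p1 p2 p3]] /tr[q [q1 q2 q3]]; exists (p, q).
  by apply/allpairsP; exists (p, q); rewrite !mem_iota /= !add0n.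
by apply/and4P.
Qed.

Lemma slots_uniq (L M : nat) : uniq (slots L M).
Proof. by apply: allpairs_uniq; rewrite ?iota_uniq // => -[? ?] [? ?]. Qed.

(* Replacing the points of an independent set by the representatives of their
   slots brings them closer by an arbitrarily small amount, which
   [four_coloring] tolerates. *)
Lemma cell_approx (m : R) (L M : nat) (cx cy : R) (u v : nat -> R)
    (sl : slot -> int) (O : seq nat) :
  (forall p : R * R, norm2 p <= 2 * L%:R ^+ 2 ->
    exists c : R * R -> 'I_3, forall q q',
      norm2 q <= norm2 p -> norm2 q' <= norm2 p ->
      m <= dist2 p q <= 4 -> m <= dist2 p q' <= 4 ->
      c q = c q' -> dist2 q q' < m) ->
  2 <= m -> (0 < M)%N -> 8 * L%:R <= (4 - m) * M%:R ->
  uniq O ->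
  (forall i, i \in O -> [/\ x i = cx + u i, y i = cy + v i,
      0 <= u i < L%:R & 0 <= v i < L%:R]) ->
  {in O &, forall i j, i != j -> 4 < dist2 (pt i) (pt j)} ->
  (forall a, a \in slots L M -> 0 <= sl a ->
    [/\ x `|sl a|%N = cx + u `|sl a|%N, y `|sl a|%N = cy + v `|sl a|%N,
        0 <= u `|sl a|%N < L%:R, 0 <= v `|sl a|%N < L%:R &
        in_slot M (u `|sl a|%N) (v `|sl a|%N) a]) ->
  (forall i a, i \in O -> a \in slots L M -> in_slot M (u i) (v i) a ->
    0 <= sl a /\ w i <= w `|sl a|%N) ->
  exists s, [/\ s \in sublists (slots L M), valid sl s &
    \sum_(i <- O) w i <= 4 * value sl s].
Proof.
move=> sec m2 M0 LM uO Op Oi slP Osl.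
have M0' : 0 < M%:R :> R by rewrite ltr0n.
have /choice[f fP] : forall i, exists a, i \in O ->
    a \in slots L M /\ in_slot M (u i) (v i) a.
  move=> i; have [iO|] := boolP (i \in O); last by exists (0%N, 0%N).
  have [_ _ hu hv] := Op i iO.
  by have [a a1 a2] := in_slot_ex M0 hu hv; exists a.
have close i j a : in_slot M (u i) (v i) a -> in_slot M (u j) (v j) a ->
    [/\ M%:R * (u i - u j) <= 1, -1 <= M%:R * (u i - u j),
        M%:R * (v i - v j) <= 1 & -1 <= M%:R * (v i - v j)].
  move=> /and4P[? ? ? ?] /and4P[? ? ? ?]; rewrite !mulrBr.
  by split; lra.
have dE i j : i \in O -> j \in O -> dist2 (pt i) (pt j) =
    (u i - u j) ^+ 2 + (v i - v j) ^+ 2.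
  move=> iO jO; have [xi yi _ _] := Op _ iO; have [xj yj _ _] := Op _ jO.
  by rewrite /dist2 /= xi xj yi yj; ring.
(* A slot has side at most 1, hence diameter below 2, and holds at most one point of [O]. *)
have inj : {in O &, injective f}.
  move=> i j iO jO fij; apply/eqP; apply: contraT => ij.
  have [_ fi] := fP _ iO; have [_] := fP _ jO; rewrite -fij => fj.
  have [h1 h2 h3 h4] := close _ _ _ fi fj.
  have := Oi _ _ iO jO ij; rewrite dE //.
  have M1 : 1 <= M%:R :> R by rewrite (ler_nat R 1).
  have sq (z : R) : M%:R * z <= 1 -> -1 <= M%:R * z -> z ^+ 2 <= 1.
    move=> z1 z2; suff : `|z| <= 1.
      by move=> z3; rewrite -(real_normK (num_real z)) expr_le1.
    have : M%:R * `|z| <= 1.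
      by rewrite -{1}(gtr0_norm M0') -normrM ler_norml z1 z2.
    by apply: le_trans; rewrite ler_peMl.
  have := sq _ h1 h2; have := sq _ h3 h4; lra.
have repP i : i \in O -> [/\ f i \in slots L M, 0 <= sl (f i),
    w i <= w `|sl (f i)|%N & in_slot M (u i) (v i) (f i)].
  move=> iO; have [f1 f2] := fP _ iO.
  by have [s1 s2] := Osl _ _ iO f1 f2; split.
pose P (a : slot) : R * R := (u `|sl a|%N, v `|sl a|%N).
have far i j : i \in O -> j \in O -> i != j ->
    m <= dist2 (P (f i)) (P (f j)).
  move=> iO jO ij; have := Oi _ _ iO jO ij; rewrite dE //.
  have [_ _ /andP[? ?] /andP[? ?]] := Op _ iO.
  have [_ _ /andP[? ?] /andP[? ?]] := Op _ jO.
  have [fi1 fi2 _ fi3] := repP _ iO; have [fj1 fj2 _ fj3] := repP _ jO.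
  have [_ _ _ _ fi4] := slP _ fi1 fi2; have [_ _ _ _ fj4] := slP _ fj1 fj2.
  have [a1 a2 a3 a4] := close _ _ _ fi3 fi4.
  have [b1 b2 b3 b4] := close _ _ _ fj3 fj4.
  (* Each point moves by at most [1 / M] per coordinate, so a coordinate difference moves by at most
     [2 / M] and its square drops by at most [4 * L / M]. Both coordinates lose at most
     [8 * L / M <= 4 - m]. *)
  have sq (z z' : R) : - L%:R <= z <= L%:R -> -2 <= M%:R * (z' - z) <= 2 ->
      M%:R * z ^+ 2 - 4 * L%:R <= M%:R * z' ^+ 2.
    move=> zL zM.
    have : `|z * (M%:R * (z' - z))| <= L%:R * 2.
      by rewrite normrM ler_pM // ler_norml.
    rewrite ler_norml => /andP[h _].
    have h2 : 0 <= M%:R * (z' - z) ^+ 2 by rewrite mulr_ge0 // sqr_ge0.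
    have -> : M%:R * z' ^+ 2 = M%:R * z ^+ 2 + 2 * (z * (M%:R * (z' - z))) +
      M%:R * (z' - z) ^+ 2 by ring.
    by lra.
  have hu : M%:R * (u i - u j) ^+ 2 - 4 * L%:R <=
      M%:R * (u `|sl (f i)|%N - u `|sl (f j)|%N) ^+ 2.
    by apply: sq; apply/andP; split; lra.
  have hv : M%:R * (v i - v j) ^+ 2 - 4 * L%:R <=
      M%:R * (v `|sl (f i)|%N - v `|sl (f j)|%N) ^+ 2.
    by apply: sq; apply/andP; split; lra.
  move=> d4; rewrite -(ler_pM2l M0') /dist2 /=.
  have : M%:R * 4 < M%:R * ((u i - u j) ^+ 2 + (v i - v j) ^+ 2).
    by rewrite ltr_pM2l.
  by lra.
pose A := map f O.
have uA : uniq A by rewrite map_inj_in_uniq.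
have [||col colP] := four_coloring (P := P) (A := A) sec uA.
- move=> _ /mapP[i iO ->]; have [f1 f2 _ _] := repP _ iO.
  have [_ _ /andP[h1 h2] /andP[h3 h4] _] := slP _ f1 f2.
  have sq (z : R) : 0 <= z -> z < L%:R -> z ^+ 2 <= L%:R ^+ 2.
    by move=> z0 zL; rewrite ler_sqr ?nnegrE // ltW.
  by have := sq _ h1 h2; have := sq _ h3 h4; rewrite /norm2 /=; lra.
- move=> _ _ /mapP[i iO ->] /mapP[j jO ->] ij; apply: far => //.
  by apply: contraNneq ij => ->.
have [c hc] := heavy_color_class A (fun a => w `|sl a|%N) col.
pose B := [seq a <- A | col a == c].
have BO a : a \in B -> exists2 i, i \in O & a = f i.
  by rewrite mem_filter => /andP[_ /mapP].
(* Listing [B] in the order of [slots] makes it literally a member of [sublists]. *)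
exists [seq a <- slots L M | a \in B]; split; first exact: filter_sublists.
- apply/andP; split; apply/allP.
    move=> a; rewrite mem_filter => /andP[/BO[i iO ->] _].
    by have [] := repP _ iO.
  move=> _ /[!mem_filter] /andP[/=] /[swap] /allpairsP[[a b] /= [+ + ->]] /= ab.
  rewrite !mem_filter => /andP[/andP[/eqP ca aA] _] /andP[/andP[/eqP cb bA] _].
  rewrite ltNge; apply/negP => h.
  have : col a != col b.
    apply: colP => //; apply: le_trans h; move/mapP: aA => [i iO ->].
    move/mapP: bA => [j jO ->].
    have [i1 i2 _ _] := repP _ iO; have [j1 j2 _ _] := repP _ jO.
    have [xi yi _ _ _] := slP _ i1 i2; have [xj yj _ _ _] := slP _ j1 j2.
    by rewrite /dist2 /= xi xj yi yj le_eqVlt; apply/orP; left; apply/eqP; ring.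
  by rewrite ca cb eqxx.
- apply: le_trans (_ : \sum_(a <- A) w `|sl a|%N <= _).
    rewrite big_map !big_seq; apply: ler_sum => i iO.
    by have [] := repP _ iO.
  apply: le_trans hc _; rewrite ler_pM2l // /value -big_filter.
  rewrite -/B [leRHS](perm_big B) //=.
  apply: uniq_perm; rewrite ?filter_uniq ?slots_uniq // => a.
  rewrite mem_filter; have [/BO[i iO ->]|//] := boolP (a \in B).
  by have [] := repP _ iO.
Qed.

End Cell.

(** * Execution *)

Fixpoint loopfree (c : cmd) : bool :=
  match c with
  | Seq c1 c2 | If _ c1 c2 => loopfree c1 && loopfree c2
  | While _ _ => false
  | _ => true
  end.

(* With [F] time units available per unit of [work], [work c * F] bounds the
   running time of [c] as soon as each loop nest of [c] runs at most [2 * F]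
   times. *)
Fixpoint work (c : cmd) : nat :=
  match c with
  | Skip => 1
  | ISet _ e => (cost_i e).+1
  | RSet _ e => (cost_r e).+1
  | IPut _ e1 e2 => (cost_i e1 + cost_i e2).+1
  | RPut _ e1 e2 => (cost_i e1 + cost_r e2).+1
  | Insert _ e1 e2 e3 => (cost_i e1 + cost_i e2 + cost_i e3).+1
  | Seq c1 c2 => work c1 + work c2
  | If b c1 c2 => (cost_t b + (work c1 + work c2)).+1
  | While b c1 => 2 * (cost_t b + work c1).+1
  end%N.

(** The names that a program may write are read off its text; what lies outside them is preserved
    without any reasoning about the execution. *)
Fixpoint wireg (c : cmd) : seq nat :=
  match c with
  | ISet x _ => [:: x]
  | Seq c1 c2 | If _ c1 c2 => wireg c1 ++ wireg c2
  | While _ c1 => wireg c1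
  | _ => [::]
  end.

Fixpoint wrreg (c : cmd) : seq nat :=
  match c with
  | RSet x _ => [:: x]
  | Seq c1 c2 | If _ c1 c2 => wrreg c1 ++ wrreg c2
  | While _ c1 => wrreg c1
  | _ => [::]
  end.

Fixpoint wiarr (c : cmd) : seq nat :=
  match c with
  | IPut a _ _ => [:: a]
  | Seq c1 c2 | If _ c1 c2 => wiarr c1 ++ wiarr c2
  | While _ c1 => wiarr c1
  | _ => [::]
  end.

Fixpoint wrarr (c : cmd) : seq nat :=
  match c with
  | RPut a _ _ => [:: a]
  | Seq c1 c2 | If _ c1 c2 => wrarr c1 ++ wrarr c2
  | While _ c1 => wrarr c1
  | _ => [::]
  end.

Fixpoint seqs (cs : seq cmd) : cmd :=
  if cs is c :: cs' then Seq c (seqs cs') else Skip.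

Definition For (k lim : nat) (body : cmd) : cmd :=
  Seq (ISet k (IConst 0))
    (While (TNot (ILe (IVar lim) (IVar k)))
       (Seq body (ISet k (IAdd (IVar k) (IConst 1))))).

Section Machine.
Variable R : realType.
Implicit Types (s : state R) (c : cmd).

(** Meaningful for loop-free programs only; loops get a dummy value. *)
Fixpoint run c s : state R :=
  match c with
  | ISet x e => set_ireg s x (eval_i s e)
  | RSet x e => set_rreg s x (eval_r s e)
  | IPut a e1 e2 => set_iarr s (a, eval_i s e1) (eval_i s e2)
  | RPut a e1 e2 => set_rarr s (a, eval_i s e1) (eval_r s e2)
  | Insert h e1 e2 e3 => set_hash s (h, eval_i s e1, eval_i s e2) (eval_i s e3)
  | Seq c1 c2 => run c2 (run c1 s)
  | If b c1 c2 => if eval_t s b then run c1 s else run c2 s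
  | Skip | While _ _ => s
  end.

Definition exec_within (F : nat) c s s' : Prop :=
  exists2 t, (t <= work c * F)%N & exec c s t s'.

Lemma run_within F c s :
  (0 < F)%N -> loopfree c -> exec_within F c s (run c s).
Proof.
move=> F0; have F1 k : (k <= k * F)%N by rewrite leq_pmulr.
elim: c s => /=; try by move=> *; eexists; [exact: F1|constructor].
- move=> c1 IH1 c2 IH2 s /andP[/(IH1 s)[t1 h1 e1] /(IH2 (run c1 s))[t2 h2 e2]].
  by exists (t1 + t2)%N; [rewrite mulnDl leq_add|econstructor; eauto].
- move=> b c1 IH1 c2 IH2 s /andP[/(IH1 s)[t1 h1 e1] /(IH2 s)[t2 h2 e2]].
  case: ifP => hb.
    exists (cost_t b + t1).+1; last by constructor; rewrite hb.
    apply: leq_trans (leq_add (F1 (cost_t b).+1) h1) _.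
    by rewrite -mulnDl leq_mul2r; apply/orP; right => /=; lia.
  exists (cost_t b + t2).+1; last by constructor; rewrite hb.
  apply: leq_trans (leq_add (F1 (cost_t b).+1) h2) _.
    by rewrite -mulnDl leq_mul2r; apply/orP; right => /=; lia.
- by [].
Qed.

Lemma within_seq F c1 c2 s1 s2 s3 :
  exec_within F c1 s1 s2 -> exec_within F c2 s2 s3 ->
  exec_within F (Seq c1 c2) s1 s3.
Proof.
move=> [t1 h1 e1] [t2 h2 e2]; exists (t1 + t2)%N; last by econstructor; eauto.
by rewrite /= mulnDl leq_add.
Qed.

Lemma within_if F b c1 c2 s s' : (0 < F)%N ->
  exec_within F (if eval_t s b then c1 else c2) s s' ->
  exec_within F (If b c1 c2) s s'.
Proof.
move=> F0 [t h e]; exists (cost_t b + t).+1; last by constructor.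
have F1 k : (k <= k * F)%N by rewrite leq_pmulr.
case: ifP h => _ /= h; apply: leq_trans (leq_add (F1 (cost_t b).+1) h) _.
    by rewrite -mulnDl leq_mul2r; apply/orP; right => /=; lia.
by rewrite -mulnDl leq_mul2r; apply/orP; right => /=; lia.
Qed.

(** Hash tables are left unconstrained: [hash_ids] resets the keys it is about to use. *)
Definition frame c s s' : Prop :=
  [/\ forall x, x \notin wireg c -> ireg s' x = ireg s x,
      forall x, x \notin wrreg c -> rreg s' x = rreg s x,
      forall a, a \notin wiarr c -> forall i, iarr s' (a, i) = iarr s (a, i) &
      forall a, a \notin wrarr c -> forall i, rarr s' (a, i) = rarr s (a, i)].

Lemma frame_trans c s1 s2 s3 : frame c s1 s2 -> frame c s2 s3 -> frame c s1 s3.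
Proof.
move=> [a1 a2 a3 a4] [b1 b2 b3 b4]; split=> x hx.
- by rewrite b1 ?a1.
- by rewrite b2 ?a2.
- by move=> i; rewrite b3 ?a3.
- by move=> i; rewrite b4 ?a4.
Qed.

Lemma frame_sub c c' s s' :
  {subset wireg c <= wireg c'} -> {subset wrreg c <= wrreg c'} ->
  {subset wiarr c <= wiarr c'} -> {subset wrarr c <= wrarr c'} ->
  frame c s s' -> frame c' s s'.
Proof.
move=> h1 h2 h3 h4 [a1 a2 a3 a4]; split=> x hx.
- by apply: a1; apply: contra hx => /h1.
- by apply: a2; apply: contra hx => /h2.
- by apply: a3; apply: contra hx => /h3.
- by apply: a4; apply: contra hx => /h4.
Qed.

Lemma exec_frame c s t s' : exec c s t s' -> frame c s s'.
Proof.
elim=> {c s t s'}; try by [].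
- by move=> s x e; split=> // y; rewrite inE /= => /negPf ->.
- by move=> s x e; split=> // y; rewrite inE /= => /negPf ->.
- by move=> s a e1 e2; split=> // y; rewrite inE => /negPf ya i /=; rewrite ?xpair_eqE ya.
- by move=> s a e1 e2; split=> // y; rewrite inE => /negPf ya i /=; rewrite ?xpair_eqE ya.
- move=> c1 c2 s1 s2 s3 t1 t2 _ f1 _ f2; apply: (@frame_trans _ _ s2).
    by apply: frame_sub f1 => x /=; rewrite mem_cat => ->.
  by apply: frame_sub f2 => x /=; rewrite mem_cat => ->; rewrite orbT.
- move=> b c1 c2 s s' t _; case: ifP => _; apply: frame_sub => x;
    by rewrite /= mem_cat => ->; rewrite ?orbT.
- move=> b c s1 s2 s3 t1 t2 _ _ f1 _ f2; exact: frame_trans f2.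
Qed.

Lemma within_frame F c s s' : exec_within F c s s' -> frame c s s'.
Proof. by move=> [t _ /exec_frame]. Qed.

Lemma run_frame c s : loopfree c -> frame c s (run c s).
Proof. by move=> /(run_within s (ltn0Sn 0))/within_frame. Qed.

(** [G] is the allowance of one iteration: 1 for loop-free bodies, [n.+1] for merging passes; [m.+1]
    counts the final test. The factor 2 lets a loop over [2 * n + 1] cell numbers fit as soon as
    [F >= n.+1]. *)
Lemma while_rule (I : nat -> state R -> Prop) (F G m : nat) b c s :
  (0 < G)%N -> (m.+1 * G <= 2 * F)%N ->
  (forall i s', (i <= m)%N -> I i s' -> eval_t s' b = (i < m)%N) ->
  (forall i s', (i < m)%N -> I i s' ->
     exists2 s'', exec_within G c s' s'' & I i.+1 s'') ->
  I 0%N s -> exists2 s', exec_within F (While b c) s s' & I m s'.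
Proof.
move=> G0 mF hb hc; suff H k i s1 : (i + k = m)%N -> I i s1 -> exists s' t,
    [/\ (t <= k.+1 * G * (cost_t b + work c).+1)%N, exec (While b c) s1 t s' &
        I m s'].
  move=> /(H m 0%N s erefl) [s' [t [ht e Im]]]; exists s' => //; exists t => //.
  apply: leq_trans ht _; by rewrite /= [leqRHS]mulnAC leq_mul2r mF orbT.
elim: k i s1 => [|k IH] i s1 ik Ii.
  have im : i = m by lia.
  exists s1, (cost_t b).+1; split; [nia| |by rewrite -im].
  by constructor; rewrite (hb i) ?im ?ltnn // -im.
have im : (i < m)%N by lia.
have [s2 [t1 h1 e1] I2] := hc _ _ im Ii.
have [|s3 [t2 [h2 e2 I3]]] := IH _ _ _ I2; first by lia.
exists s3, (cost_t b + t1 + t2).+1; split=> //; first by nia.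
by econstructor; eauto; rewrite (hb i) // ltnW.
Qed.

(** The step receives the frame of the loop so far, so [I] need only describe the memory that the
    body changes. *)
Lemma for_rule (I : nat -> state R -> Prop) (F m k lim : nat) body s :
  (m.+1 <= 2 * F)%N -> loopfree body ->
  k != lim -> k \notin wireg body -> lim \notin wireg body ->
  ireg s lim = m%:Z -> I 0%N (set_ireg s k 0) ->
  (forall i s', (i < m)%N -> ireg s' k = i%:Z -> frame (For k lim body) s s' ->
     I i s' -> I i.+1 (set_ireg (run body s') k (i.+1)%:Z)) ->
  exists s', [/\ exec_within F (For k lim body) s s',
                 frame (For k lim body) s s' & I m s'].
Proof.
move=> mF lf kl kb lb slim I0 IS; set c := For k lim body.
pose J i s' := [/\ I i s', ireg s' k = i%:Z & frame c s s'].
have F0 : (0 < F)%N by lia.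
have fk v s' : frame c s s' -> frame c s (set_ireg s' k v).
  move=> f; apply: frame_trans f _; split=> // x; rewrite /= inE negb_or.
  by case/andP=> /negPf ->.
have limE i s' : J i s' -> ireg s' lim = m%:Z.
  move=> [_ _ [f _ _ _]]; rewrite f //= inE negb_or eq_sym kl /= mem_cat negb_or.
  by rewrite lb inE eq_sym kl.
have [||||s' w' [Im _ f]] := @while_rule J F 1 m (TNot (ILe (IVar lim) (IVar k)))
    (Seq body (ISet k (IAdd (IVar k) (IConst 1)))) (set_ireg s k 0) isT.
- by rewrite muln1.
- move=> i s' im Ji; have [_ hk _] := Ji.
  by rewrite /= (limE _ _ Ji) hk lez_nat -ltnNge.
- move=> i s' im [Ii hk f]; exists (set_ireg (run body s') k (i.+1)%:Z).
    have := @run_within 1 (Seq body (ISet k (IAdd (IVar k) (IConst 1)))) s' isT.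
    rewrite /= lf => /(_ isT).
    have [-> // _ _ _] := run_frame s' lf; rewrite hk.
    by rewrite -(PoszD i 1) addn1.
  split; [exact: IS|by rewrite /= eqxx|apply: fk; apply: frame_trans f _].
  apply: frame_sub (run_frame s' lf) => x /=; rewrite ?inE ?mem_cat => ->;
    by rewrite ?orbT.
- by split=> //=; rewrite ?eqxx //; apply: fk.
exists s'; split=> //; apply: within_seq w'.
exact: (@run_within F (ISet k (IConst 0))).
Qed.

(** The rule for unrolled loops; the invariant is indexed by the prefix already executed. *)
Lemma within_seqs (T : Type) (I : seq T -> state R -> Prop) (F : nat)
    (f : T -> cmd) (l : seq T) s : (0 < F)%N ->
  (forall l1 a l2 s', l = l1 ++ a :: l2 -> I l1 s' ->
     exists2 s'', exec_within F (f a) s' s'' & I (rcons l1 a) s'') ->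
  I [::] s -> exists2 s', exec_within F (seqs (map f l)) s s' & I l s'.
Proof.
move=> F0 step; suff H l1 l2 s1 : l = l1 ++ l2 -> I l1 s1 ->
    exists2 s', exec_within F (seqs (map f l2)) s1 s' & I l s' by apply: H.
elim: l2 l1 s1 => [|a l2 IH] l1 s1 le I1.
  exists s1; first exact: (@run_within F Skip).
  by rewrite le cats0.
have [s2 w2 I2] := step _ _ _ _ le I1.
have [|s3 w3 I3] := IH (rcons l1 a) s2 _ I2; first by rewrite cat_rcons.
by exists s3 => //; apply: within_seq w2 w3.
Qed.

End Machine.

(** * Merge sort *)

Section Merge.
Variables (R : realType) (key : nat -> R) (n : nat).
Implicit Types (a b : nat -> nat).

Definition run_sorted (w : nat) a : Prop :=
  forall t, (t.+1 < n)%N -> ~~ (w %| t.+1)%N -> key (a t) <= key (a t.+1).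

(* [b] holds the first [k] outputs of a merging pass over the runs of length
   [w] of [a].  The current pair of runs starts at [c]; their unread parts are
   [i, ie[ and [j, je[. *)
Definition merging (w k : nat) a b (i ie j je : nat) : Prop :=
  exists c,
  [/\ [/\ (c <= i)%N, (i <= ie)%N, (ie <= j)%N & (j <= je <= n)%N],
      [/\ (2 * w %| c)%N, k = (i + (j - ie))%N & (je == n) || (2 * w %| je)%N],
      perm_eq (mkseq b k) (map a (iota 0 i ++ iota ie (j - ie))),
      [/\ forall t, (i <= t)%N -> (t.+1 < ie)%N -> key (a t) <= key (a t.+1),
          forall t, (j <= t)%N -> (t.+1 < je)%N -> key (a t) <= key (a t.+1) &
          forall t, (t.+1 < k)%N -> ~~ (2 * w %| t.+1)%N ->
            key (b t) <= key (b t.+1)] &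
      (c < k)%N -> ((i < ie)%N -> key (b k.-1) <= key (a i)) /\
                   ((j < je)%N -> key (b k.-1) <= key (a j))].

Lemma merging0 w a b : merging w 0 a b 0 0 0 0.
Proof. by exists 0%N; split=> //; rewrite ?dvdn0 ?orbT. Qed.

(** With both runs exhausted, everything before [j] has been output, so [k = j]; as [k < n], this is
    a multiple of [2 * w], where the next pair of runs begins. *)
Lemma merging_refill w k a b i j : (0 < w)%N ->
  run_sorted w a -> (k < n)%N -> merging w k a b i i j j ->
  merging w k a b k (minn (k + w) n) (minn (k + w) n)
    (minn (minn (k + w) n + w) n).
Proof.
move=> w0 wa kn [c [[ci _ ij /andP[_ jn]] [wc ke je] pe [_ _ sb] _]].
have kj : k = j by rewrite ke subnKC.
have wk : (2 * w %| k)%N.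
  by case/orP: je; rewrite -kj // => /eqP kn'; rewrite kn' ltnn in kn.
have ndvd t u : (w %| u)%N -> (u <= t)%N -> (t.+1 < u + w)%N -> ~~ (w %| t.+1)%N.
  move=> wu ut tu; rewrite -(subnKC (leqW ut)) dvdn_addr // gtnNdvd //.
    by rewrite subn_gt0 ltnS.
  by rewrite ltn_subLR // leqW.
have wk' : (w %| k)%N by apply: dvdn_trans wk; rewrite dvdn_mull.
exists k; split=> //.
- clear -kn; split; lia.
- split=> //; first by rewrite subnn addn0.
  have [h|h] := leqP n (k + w + w)%N; first by apply/orP; left; clear -h kn; lia.
  apply/orP; right; rewrite (_ : minn _ _ = k + 2 * w)%N; first by rewrite dvdn_addr.
  by clear -h; lia.
- rewrite subnn cats0 (perm_trans pe) // (_ : iota 0 k = iota 0 i ++ iota i (j - i)) //.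
  by rewrite -iotaD -ke.
- split=> // t h1 h2; apply: wa.
  + by clear -h2; lia.
  + by apply: (ndvd _ k) => //; clear -h2; lia.
  + by clear -h2; lia.
  + apply: (ndvd _ (k + w)%N); first by rewrite dvdn_addr.
      by clear -h1 h2; lia.
    by clear -h2; lia.
- by rewrite ltnn.
Qed.

Lemma perm_map_iota_rcons a b b' k (s s1 s2 : seq nat) x :
  (forall t, (t < k)%N -> b' t = b t) -> b' k = a x ->
  perm_eq (mkseq b k) (map a (s1 ++ s2)) ->
  perm_eq s (rcons (s1 ++ s2) x) ->
  perm_eq (mkseq b' k.+1) (map a s).
Proof.
move=> bb bk pe ps; rewrite mkseqS bk.
rewrite (_ : mkseq b' k = mkseq b k); last first.
  by apply/eq_in_map => t; rewrite mem_iota => /bb.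
rewrite perm_sym (perm_trans (perm_map a ps)) // map_rcons perm_rcons.
by rewrite perm_sym perm_rcons perm_cons.
Qed.

Lemma merging_left w k a b b' i ie j je :
  merging w k a b i ie j je -> (i < ie)%N ->
  ((j < je)%N -> key (a i) <= key (a j)) ->
  (forall t, (t < k)%N -> b' t = b t) -> b' k = a i ->
  merging w k.+1 a b' i.+1 ie j je.
Proof.
move=> [c [[ci iie iej jje] [wc ke je'] pe [sa1 sa2 sb] hd]] lti leij bb bk.
have ck : (c <= k)%N by rewrite ke; apply: leq_trans ci (leq_addr _ _).
exists c; split.
- by split=> //; apply: leqW.
- by split=> //; rewrite ke addSn.
- apply: perm_map_iota_rcons bb bk pe _.
  rewrite -addn1 iotaD add0n -catA perm_sym perm_rcons -cat1s.
  by rewrite perm_sym perm_catCA.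
- split=> // [t it te|t tk nd]; first by apply: sa1 => //; apply: ltnW.
  move: tk; rewrite ltnS leq_eqVlt => /orP[/eqP tk|tk]; last first.
    by rewrite !bb //; [apply: sb|apply: ltnW].
  rewrite tk bk bb -?tk //.
  have ck' : (c < k)%N.
    by rewrite ltn_neqAle ck andbT; apply: contraNneq nd => ck'; rewrite tk -ck'.
  by have [/(_ lti)] := hd ck'; rewrite -tk.
- by move=> _ /=; rewrite bk; split=> // h; apply: sa1.
Qed.

Lemma merging_right w k a b b' i ie j je :
  merging w k a b i ie j je -> (j < je)%N ->
  ((i < ie)%N -> key (a j) <= key (a i)) ->
  (forall t, (t < k)%N -> b' t = b t) -> b' k = a j ->
  merging w k.+1 a b' i ie j.+1 je.
Proof.
move=> [c [[ci iie iej jje] [wc ke je'] pe [sa1 sa2 sb] hd]] ltj leji bb bk.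
have ck : (c <= k)%N by rewrite ke; apply: leq_trans ci (leq_addr _ _).
exists c; split.
- split=> //; first exact: leqW.
  by case/andP: jje => _ ->; rewrite ltj.
- by split=> //; rewrite ke subSn // addnS.
- apply: perm_map_iota_rcons bb bk pe _.
  by rewrite subSn // -addn1 iotaD subnKC // catA cats1.
- split=> // [t jt te|t tk nd]; first by apply: sa2 => //; apply: ltnW.
  move: tk; rewrite ltnS leq_eqVlt => /orP[/eqP tk|tk]; last first.
    by rewrite !bb //; [apply: sb|apply: ltnW].
  rewrite tk bk bb -?tk //.
  have ck' : (c < k)%N.
    by rewrite ltn_neqAle ck andbT; apply: contraNneq nd => ck'; rewrite tk -ck'.
  by have [_ /(_ ltj)] := hd ck'; rewrite -tk.
- by move=> _ /=; rewrite bk; split=> // h; apply: sa2.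
Qed.

Lemma merging_end w a b i ie j je : merging w n a b i ie j je ->
  perm_eq (mkseq b n) (mkseq a n) /\ run_sorted (2 * w) b.
Proof.
move=> [c [[ci iie iej /andP[jje jen]] [wc ke je'] pe [sa1 sa2 sb] hd]]; split=> //.
have ei : i = ie by clear -iie iej jje jen ke; lia.
rewrite (perm_trans pe) // (_ : iota 0 i ++ _ = iota 0 n) //.
have -> : (j - ie = n - i)%N by clear -iie iej jje jen ke; lia.
by rewrite -ei -iotaD subnKC //; clear -iie iej jje jen; lia.
Qed.

End Merge.

(* Memory layout.  Integer registers: 0 input, finally output size; 1 number [n]
   of points; 2 loop counter; 3 [2 * n + 1], a bound on cell numbers; 5 run
   length; 6-7 and 8-9 unread parts of the runs being merged; 10 interval number;
   11 last cell number; 12-13 size of the current selection, with and without the current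
   cell.  Real registers: 0 left end of the current interval; 3, 4, 5 weight of
   the best selection, of the current one, and of its part in the current cell.
   Integer arrays: 0-1 sorted indices and merge buffer; 2-3 interval numbers;
   4-5 the same for the current shift; 6 cell numbers; 7 selected indices; from
   20 on, one array per slot, indexed by cells.  Real arrays: 0-4 input and
   output; 5-6 offsets in the intervals; 7-8 the same for the current shift;
   9 sorting keys; 10 scratch. *)
Definition TOr (b1 b2 : test) : test := TNot (TAnd (TNot b1) (TNot b2)).

Definition refill : cmd :=
  seqs [:: ISet 6 (IVar 2);
           ISet 7 (IAdd (IVar 2) (IVar 5));
           If (ILe (IVar 1) (IVar 7)) (ISet 7 (IVar 1)) Skip;
           ISet 8 (IVar 7);
           ISet 9 (IAdd (IVar 7) (IVar 5));
           If (ILe (IVar 1) (IVar 9)) (ISet 9 (IVar 1)) Skip].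

Definition take_left : cmd :=
  Seq (IPut 1 (IVar 2) (IGet 0 (IVar 6))) (ISet 6 (IAdd (IVar 6) (IConst 1))).

Definition take_right : cmd :=
  Seq (IPut 1 (IVar 2) (IGet 0 (IVar 8))) (ISet 8 (IAdd (IVar 8) (IConst 1))).

Definition prefer_left (ak : nat) : test :=
  TAnd (TNot (ILe (IVar 7) (IVar 6)))
    (TOr (ILe (IVar 9) (IVar 8))
         (RLe (RGet ak (IGet 0 (IVar 6))) (RGet ak (IGet 0 (IVar 8))))).

Definition merge_step (ak : nat) : cmd :=
  Seq (If (TAnd (ILe (IVar 7) (IVar 6)) (ILe (IVar 9) (IVar 8))) refill Skip)
      (If (prefer_left ak) take_left take_right).

(** The four zeros describe an exhausted pair of runs, so the first step refills. *)
Definition merge_pass (ak : nat) : cmd :=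
  seqs [:: ISet 6 (IConst 0); ISet 7 (IConst 0); ISet 8 (IConst 0);
           ISet 9 (IConst 0); For 2 1 (merge_step ak);
           For 2 1 (IPut 0 (IVar 2) (IGet 1 (IVar 2)));
           ISet 5 (IAdd (IVar 5) (IVar 5))].

Definition merge_sort (ak : nat) : cmd :=
  seqs [:: For 2 1 (IPut 0 (IVar 2) (IVar 2)); ISet 5 (IConst 1);
           While (TNot (ILe (IVar 1) (IVar 5))) (merge_pass ak)].

Section Sort.
Variables (R : realType) (n : nat).
Implicit Types (s : state R) (a b : nat -> nat).

Definition holds s (r : nat) a : Prop :=
  forall t, (t < n)%N -> iarr s (r, t%:Z) = (a t)%:Z.

Definition keys s (ak p : nat) : R := rarr s (ak, p%:Z).

Definition merge_inv ak w a s0 k s : Prop :=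
  exists b i ie j je,
    [/\ [/\ ireg s 6 = i%:Z, ireg s 7 = ie%:Z, ireg s 8 = j%:Z & ireg s 9 = je%:Z],
        forall t, (t < k)%N -> iarr s (1%N, t%:Z) = (b t)%:Z &
        merging (keys s0 ak) n w k a b i ie j je].

Lemma run_refill s k w : ireg s 1 = n%:Z -> ireg s 2 = k%:Z -> ireg s 5 = w%:Z ->
  [/\ ireg (run refill s) 6 = k%:Z,
      ireg (run refill s) 7 = (minn (k + w) n)%:Z,
      ireg (run refill s) 8 = (minn (k + w) n)%:Z,
      ireg (run refill s) 9 = (minn (minn (k + w) n + w) n)%:Z &
      [/\ ireg (run refill s) 1 = ireg s 1, ireg (run refill s) 2 = ireg s 2,
          ireg (run refill s) 5 = ireg s 5, rarr (run refill s) = rarr s &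
          iarr (run refill s) = iarr s]].
Proof.
move=> s1 s2 s5; rewrite /refill /= s1 s2 s5.
rewrite -!PoszD !lez_nat.
case: (leqP n (k + w)) => h /=.
  rewrite ?s1 ?s2 ?s5 -?PoszD ?lez_nat leq_addr /= ?s1 ?s2 ?s5.
  by rewrite (minn_idPr (leq_addr _ _)).
rewrite ?s1 ?s2 ?s5 -?PoszD ?lez_nat.
by case: (leqP n (k + w + w)) => h' /=; rewrite ?s1 ?s2 ?s5.
Qed.

Lemma merge_step_inv ak w a s0 k s : (0 < w)%N -> (k < n)%N ->
  run_sorted (keys s0 ak) n w a ->
  ireg s 1 = n%:Z -> ireg s 2 = k%:Z -> ireg s 5 = w%:Z -> holds s 0 a ->
  (forall i, rarr s (ak, i) = rarr s0 (ak, i)) ->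
  merge_inv ak w a s0 k s ->
  merge_inv ak w a s0 k.+1 (set_ireg (run (merge_step ak) s) 2 (k.+1)%:Z).
Proof.
move=> w0 kn sa s1 s2 s5 ha hk [b [i [ie [j [je [[s6 s7 s8 s9] hb mg]]]]]].
pose s' := if (ireg s 7 <= ireg s 6) && (ireg s 9 <= ireg s 8)
  then run refill s else s.
have -> : run (merge_step ak) s = if eval_t s' (prefer_left ak)
  then run take_left s' else run take_right s' by [].
have [_ [[_ iie _ /andP[jje _]] _ _ _ _]] := mg.
have [i' [ie' [j' [je' [[r6 r7 r8 r9] [r1 r2 r5 rr ri] mg' ne]]]]] :
  exists i' ie' j' je', [/\ [/\ ireg s' 6 = i'%:Z, ireg s' 7 = ie'%:Z,
      ireg s' 8 = j'%:Z & ireg s' 9 = je'%:Z],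
    [/\ ireg s' 1 = n%:Z, ireg s' 2 = k%:Z, ireg s' 5 = w%:Z, rarr s' = rarr s &
     iarr s' = iarr s], merging (keys s0 ak) n w k a b i' ie' j' je' &
     (i' < ie')%N || (j' < je')%N].
  rewrite {}/s' s6 s7 s8 s9 !lez_nat; case: ifP => [/andP[ei ej]|ne].
    have [q6 q7 q8 q9 [q1 q2 q5 q10 q11]] := run_refill s1 s2 s5.
    do 4!eexists; split.
    - by split; [exact: q6|exact: q7|exact: q8|exact: q9].
    - by rewrite q1 q2 q5.
    - apply: (@merging_refill _ _ _ _ _ _ _ i j) => //.
      have ie' : ie = i by apply/eqP; rewrite eqn_leq ei iie.
      have je' : je = j by apply/eqP; rewrite eqn_leq ej jje.
      by rewrite -{2}ie' -{2}je'.
    - by rewrite leq_min; clear -w0 kn; lia.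
  exists i, ie, j, je; split=> //.
  by move/negbT: ne; rewrite negb_and -!ltnNge.
have key_at t : (t < n)%N -> rarr s' (ak, iarr s' (0%N, t%:Z)) = keys s0 ak (a t).
  by move=> tn; rewrite rr ri ha // hk.
have [c [[_ h1 h2 /andP[h3 h4]] _ _ _ _]] := mg'.
have -> : eval_t s' (prefer_left ak) =
    (i' < ie')%N && ((je' <= j')%N || (keys s0 ak (a i') <= keys s0 ak (a j'))).
  rewrite /= r6 r7 r8 r9 !lez_nat -ltnNge negb_and !negbK.
  case: (ltnP i' ie') => //= hi.
  case: (leqP je' j') => //= hj.
  by rewrite !key_at //; clear -hi hj h1 h2 h3 h4; lia.
case: ifP => [/andP[hi hj]|hij].
  exists (fun t => if t == k then a i' else b t), i'.+1, ie', j', je'; split.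
  - by rewrite /= ?r6 r7 r8 r9 -(PoszD i' 1) addn1.
  - move=> t tk; rewrite /= xpair_eqE /= r2 r6 eqz_nat.
    case: eqP => [_|/eqP tk']; first by rewrite ri ha //; clear -hi h1 h2 h3 h4; lia.
    by rewrite ri hb //; rewrite ltn_neqAle tk' -ltnS.
  - apply: (merging_left mg') => //.
    + by move=> lj; move: hj; rewrite leqNgt lj.
    + by move=> t tk; rewrite ltn_eqF.
    + by rewrite eqxx.
have hj : (j' < je')%N.
  case/orP: ne => // hi; rewrite ltnNge; apply/negP => hj.
  by rewrite hi hj in hij.
exists (fun t => if t == k then a j' else b t), i', ie', j'.+1, je'; split.
- by rewrite /= r6 r7 ?r8 r9 -(PoszD j' 1) addn1.
- move=> t tk; rewrite /= xpair_eqE /= r2 r8 eqz_nat.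
  case: eqP => [_|/eqP tk']; first by rewrite ri ha //; clear -hj h1 h2 h3 h4; lia.
  by rewrite ri hb //; rewrite ltn_neqAle tk' -ltnS.
- apply: (merging_right mg') => //.
  + move=> hi; move: hij; rewrite hi (leqNgt je') hj /= => /negbT.
    by rewrite -ltNge => /ltW.
  + by move=> t tk; rewrite ltn_eqF.
  + by rewrite eqxx.
Qed.

Lemma merge_pass_rule ak w a s : (0 < w)%N ->
  ireg s 1 = n%:Z -> ireg s 5 = w%:Z -> holds s 0 a ->
  perm_eq (mkseq a n) (iota 0 n) -> run_sorted (keys s ak) n w a ->
  exists s' b, [/\ exec_within n.+1 (merge_pass ak) s s',
    ireg s' 5 = (2 * w)%:Z, holds s' 0 b, perm_eq (mkseq b n) (iota 0 n) &
    run_sorted (keys s ak) n (2 * w) b].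
Proof.
move=> w0 s1 s5 ha pa sa.
have mF : (n.+1 <= 2 * n.+1)%N by clear; lia.
pose s0 := run (seqs [:: ISet 6 (IConst 0); ISet 7 (IConst 0);
  ISet 8 (IConst 0); ISet 9 (IConst 0)]) s.
have [||s2 [w2 [f1 _ _ f4] I2]] := @for_rule R (merge_inv ak w a s) n.+1 n 2 1
  (merge_step ak) s0 mF isT isT isT isT s1.
- by exists a, 0%N, 0%N, 0%N, 0%N; split=> //; exact: merging0.
- move=> k s' kn s'k [g1 _ g3 g4] Is'.
  apply: merge_step_inv => //.
  + by rewrite g1.
  + by rewrite g1.
  + by move=> t tn; rewrite g3 // ha.
  + by move=> i; rewrite g4.
have [b [i [ie [j [je [_ hb mg]]]]]] := I2.
have [pb sb] := merging_end mg.
have [||s3 [w3 [e1 _ e3 e4] I3]] := @for_rule R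
  (fun k s => forall t, (t < k)%N -> iarr s (0%N, t%:Z) = (b t)%:Z) n.+1 n 2 1
  (IPut 0 (IVar 2) (IGet 1 (IVar 2))) s2 mF isT isT isT isT (etrans (f1 1%N isT) s1).
- by [].
- move=> k s' kn s'k [g1 _ g3 _] Is' t tk; rewrite /= xpair_eqE /= s'k eqz_nat.
  case: eqP => [->|/eqP tk']; first by rewrite g3 // hb.
  by rewrite Is' // ltn_neqAle tk' -ltnS.
exists (set_ireg s3 5 (2 * w)%:Z), b; split=> //; last first.
  by rewrite (perm_trans pb).
do 4!(apply: within_seq; first exact: run_within).
apply: within_seq w2 _; apply: within_seq w3 _.
apply: within_seq; last exact: run_within.
have := @run_within R n.+1 (ISet 5 (IAdd (IVar 5) (IVar 5))) s3 isT isT.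
by rewrite /= e1 // f1 // /= s5 -PoszD addnn mul2n.
Qed.

(** Runs double in each pass, so [up_log 2 n] passes of [n] steps leave a single run; the sums of
    [1] in the bound pay for the final loop tests. *)
Lemma sort_rule ak s : ireg s 1 = n%:Z ->
  exists s' a, [/\ exec_within (n.+1 * (up_log 2 n).+1) (merge_sort ak) s s',
    holds s' 0 a, perm_eq (mkseq a n) (iota 0 n) &
    forall t, (t.+1 < n)%N -> keys s ak (a t) <= keys s ak (a t.+1)].
Proof.
move=> s1; set lg := up_log 2 n; set F := (n.+1 * lg.+1)%N.
have mF : (n.+1 <= 2 * F)%N by rewrite (leq_trans (leq_pmulr _ (ltn0Sn lg))) // leq_pmull.
have [||s2 [w2 [f1 _ _ f4] I2]] := @for_rule R
  (fun k s => forall t, (t < k)%N -> iarr s (0%N, t%:Z) = t%:Z) F n 2 1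
  (IPut 0 (IVar 2) (IVar 2)) s mF isT isT isT isT s1.
- by [].
- move=> k s' kn s'k _ Is' t tk; rewrite /= xpair_eqE /= s'k eqz_nat.
  by case: eqP => [->//|/eqP tk']; rewrite Is' // ltn_neqAle tk' -ltnS.
pose s3 := set_ireg s2 5 1%:Z.
have [|||||s4 w4 I4] := @while_rule R (fun k s' => [/\ ireg s' 1 = n%:Z,
    ireg s' 5 = (2 ^ k)%:Z, forall i, rarr s' (ak, i) = rarr s (ak, i) &
    exists a, [/\ holds s' 0 a, perm_eq (mkseq a n) (iota 0 n) &
    run_sorted (keys s ak) n (2 ^ k) a]]) F n.+1 lg
    (TNot (ILe (IVar 1) (IVar 5))) (merge_pass ak) s3.
- by [].
- by rewrite /F; clear; nia.
- move=> k s' kl [g1 g5 _ _] /=; rewrite g1 g5 lez_nat -ltnNge.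
  have [kl'|kl'] := ltnP k lg; last first.
    by rewrite ltnNge (leq_trans (@up_logP 2 n isT)) // leq_pexp2l.
  by rewrite ltnNge; apply: contraL kl' => /(@up_log_min 2 _ _ isT); rewrite -leqNgt.
- move=> k s' kl [g1 g5 gr [a [ha pa sa]]].
  have ks : keys s' ak = keys s ak by apply: funext => p; apply: gr.
  rewrite -ks in sa.
  have w0 : (0 < 2 ^ k)%N by rewrite expn_gt0.
  have [s'' [b [w'' h5 hb pb sb]]] := merge_pass_rule w0 g1 g5 ha pa sa.
  have [e1 _ _ e4] := within_frame w''.
  exists s'' => //; split.
  + by rewrite e1.
  + by rewrite h5 expnS.
  + by move=> i; rewrite e4.
  + by exists b; split=> //; rewrite expnS -ks.
- split=> //=; first by rewrite f1.
  + by move=> i; rewrite f4.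
  + exists id; split=> //.
      by rewrite (_ : mkseq id n = iota 0 n) // /mkseq map_id.
    by move=> t _; rewrite dvd1n.
have [_ _ g4 [a [ha pa sa]]] := I4.
exists s4, a; split=> //.
- apply: within_seq w2 _; apply: within_seq; first exact: (@run_within _ F (ISet 5 (IConst 1))).
  apply: within_seq w4 _; exact: (@run_within _ F Skip).
- move=> t tn; apply: sa => //; rewrite gtnNdvd //.
  exact: leq_trans tn (@up_logP 2 n isT).
Qed.

End Sort.

(** * Grid cells *)

(** A key two lengths or more beyond the left end starts a new interval at itself and skips a
    number. Thus consecutive numbers always mean adjacent intervals, which makes adding 1 correct
    when the grid is moved, and numbers stay at most [2 * n]. *)
Definition scan_step (L ak ab ao : nat) : cmd :=
  seqs [:: RSet 1 (RGet ak (IGet 0 (IVar 2)));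
    If (RLe (RAdd (RVar 0) (RConst L)) (RVar 1))
       (If (RLe (RAdd (RAdd (RVar 0) (RConst L)) (RConst L)) (RVar 1))
           (Seq (RSet 0 (RVar 1)) (ISet 10 (IAdd (IVar 10) (IConst 2))))
           (Seq (RSet 0 (RAdd (RVar 0) (RConst L)))
                (ISet 10 (IAdd (IVar 10) (IConst 1)))))
       Skip;
    IPut ab (IGet 0 (IVar 2)) (IVar 10);
    RPut ao (IGet 0 (IVar 2)) (RSub (RVar 1) (RVar 0))].

Definition compress (L ak ab ao : nat) : cmd :=
  seqs [:: merge_sort ak; RSet 0 (RGet ak (IGet 0 (IConst 0)));
           ISet 10 (IConst 0); For 2 1 (scan_step L ak ab ao)].

Section Scan.
Variables (R : realType) (L n : nat).
Implicit Types (s : state R) (a : nat -> nat) (b : int) (o : R).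

(* Interval number [b2] with left end [o2] lies to the right of interval number
   [b1] with left end [o1].  All intervals have length [L]; consecutive numbers
   mean adjacent intervals. *)
Definition ahead b1 o1 b2 o2 : Prop :=
  [/\ b1 <= b2, o1 + L%:R * (b2 - b1)%:~R <= o2 &
      b2 <= b1 + 1 -> o2 = o1 + L%:R * (b2 - b1)%:~R].

Lemma ahead_refl b o : ahead b o b o.
Proof. by split=> //; rewrite subrr mulr0 addr0. Qed.

Lemma ahead_trans b1 o1 b2 o2 b3 o3 :
  ahead b1 o1 b2 o2 -> ahead b2 o2 b3 o3 -> ahead b1 o1 b3 o3.
Proof.
move=> [h1 h2 h3] [k1 k2 k3].
have E : (b3 - b1)%:~R = (b3 - b2)%:~R + (b2 - b1)%:~R :> R.
  by rewrite -intrD; congr (_%:~R); lia.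
split; first exact: le_trans k1.
- by rewrite E mulrDr; lra.
- move=> h; rewrite k3 ?h3 ?E ?mulrDr; first by ring.
    by clear -h k1; lia.
  by clear -h h1; lia.
Qed.

(* [z] is cut into intervals of length [L]; [z i] lies in interval number
   [B i], at offset [O i]. *)
Definition interval_cut (z : nat -> R) (B : nat -> int) (O : nat -> R) : Prop :=
  (forall i, (i < n)%N -> 0 <= O i < L%:R) /\
  (forall i j, (i < n)%N -> (j < n)%N ->
     ahead (B i) (z i - O i) (B j) (z j - O j) \/
     ahead (B j) (z j - O j) (B i) (z i - O i)).

Lemma scan_move b o (x : R) : (0 < L)%N -> o <= x ->
  exists b' o', [/\ ahead b o b' o', o' <= x < o' + L%:R, b' <= b + 2 &
    (b', o') = if o + L%:R <= x then
                 if o + L%:R + L%:R <= x then (b + 2, x) else (b + 1, o + L%:R)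
               else (b, o)].
Proof.
move=> L0 ox; have L0' : 0 < L%:R :> R by rewrite ltr0n.
case: leP => h1; [case: leP => h2|].
- exists (b + 2), x; split=> //; last by lra.
  split; [by lia| |by lia].
  by rewrite (_ : b + 2 - b = 2); [rewrite (_ : 2%:~R = 2) //; lra|lia].
- exists (b + 1), (o + L%:R); split=> //; [|lra|lia].
  have E : b + 1 - b = 1 by lia.
  by split; rewrite ?E ?mulr1 //; lia.
- exists b, o; split=> //; [exact: ahead_refl|lra|lia].
Qed.

Definition scan_inv ak ab ao a s0 (k : nat) s : Prop :=
  [/\ 0 <= ireg s 10 <= (2 * k)%:Z,
      (k < n)%N -> rreg s 0 <= keys s0 ak (a k),
      forall t, (t < k)%N ->
        [/\ 0 <= rarr s (ao, (a t)%:Z) < L%:R,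
            0 <= iarr s (ab, (a t)%:Z) <= (2 * k)%:Z &
            ahead (iarr s (ab, (a t)%:Z))
              (keys s0 ak (a t) - rarr s (ao, (a t)%:Z)) (ireg s 10) (rreg s 0)] &
      forall t u, (t <= u)%N -> (u < k)%N ->
        ahead (iarr s (ab, (a t)%:Z))
          (keys s0 ak (a t) - rarr s (ao, (a t)%:Z))
          (iarr s (ab, (a u)%:Z))
          (keys s0 ak (a u) - rarr s (ao, (a u)%:Z))].

Lemma scan_step_run ak ab ao s b' o' :
  let x := rarr s (ak, iarr s (0%N, ireg s 2)) in
  ak != ao -> ab != 0%N ->
  (b', o') = (if rreg s 0 + L%:R <= x then
               if rreg s 0 + L%:R + L%:R <= x then (ireg s 10 + 2, x)
               else (ireg s 10 + 1, rreg s 0 + L%:R)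
             else (ireg s 10, rreg s 0)) ->
  let s' := run (scan_step L ak ab ao) s in
  [/\ ireg s' 10 = b', rreg s' 0 = o',
      forall i, iarr s' (ab, i) =
        if i == iarr s (0%N, ireg s 2) then b' else iarr s (ab, i) &
      forall i, rarr s' (ao, i) =
        if i == iarr s (0%N, ireg s 2) then x - o' else rarr s (ao, i)].
Proof.
move=> x akao ab0 /=; rewrite -!pmulrn -/x.
have pE (p q : nat) (i j : int) : ((p, i) == (q, j)) = (p == q) && (i == j).
  exact: xpair_eqE.
case: ifP => h1; [case: ifP => h2|]; move=> [-> ->]; split=> // i;
  by rewrite /= ?pE ?eqxx ?(eq_sym 0%N) ?(negPf ab0).
Qed.

Lemma compress_rule ak ab ao s : (0 < L)%N -> ak != ao ->
  (1 < ab)%N -> ireg s 1 = n%:Z ->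
  exists s', [/\ exec_within (n.+1 * (up_log 2 n).+1) (compress L ak ab ao) s s',
    interval_cut (keys s ak) (fun i => iarr s' (ab, i%:Z)) (fun i => rarr s' (ao, i%:Z)) &
    forall i, (i < n)%N -> 0 <= iarr s' (ab, i%:Z) <= (2 * n)%:Z].
Proof.
move=> L0 akao ab1 s1.
have [s2 [a [w2 ha pa sa]]] := sort_rule ak s1.
set F := (_ * _)%N in w2 *.
have mF : (n.+1 <= 2 * F)%N.
  by rewrite /F (leq_trans (leq_pmulr _ (ltn0Sn (up_log 2 n)))) // leq_pmull.
have F0 : (0 < F)%N by clear -mF; lia.
pose s3 := run (seqs [:: RSet 0 (RGet ak (IGet 0 (IConst 0)));
           ISet 10 (IConst 0)]) s2.
have [e1 _ _ e4] := within_frame w2.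
have inj t u : (t < n)%N -> (u < n)%N -> a t = a u -> t = u.
  have /mkseq_uniqP inja : uniq (mkseq a n) by rewrite (perm_uniq pa) iota_uniq.
  by move=> tn un; apply: inja.
have ab0 : ab != 0%N by case: (ab) ab1.
have [|||s4 [w4 _ I4]] := @for_rule R (scan_inv ak ab ao a s) F n 2 1
  (scan_step L ak ab ao) s3 mF isT isT isT isT.
- by rewrite /= e1.
- split=> //= n0; rewrite e4 // (_ : 0 = 0%:Z) // ha //.
- move=> k s' kn s'k [_ _ f3 f4] [ib ik it itu].
  pose x := keys s ak (a k).
  have i0 : iarr s' (0%N, k%:Z) = (a k)%:Z.
    by rewrite f3 /= ?ha // inE eq_sym.
  have xE : rarr s' (ak, iarr s' (0%N, ireg s' 2)) = x.
    rewrite s'k i0 f4 /=; first by rewrite e4.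
    by rewrite inE.
  have [b' [z' [h1 h2 h3 h4]]] := scan_move (ireg s' 10) L0 (ik kn).
  rewrite -/x -xE in h4.
  have [r1 r2 r3 r4] := scan_step_run akao ab0 h4.
  rewrite xE s'k i0 in r3 r4.
  set s'' := run _ s' in r1 r2 r3 r4 *; clearbody s''.
  have h5 : 0 <= b' <= (2 * k.+1)%:Z by case: h1 => q1 _ _; clear -q1 ib h3; lia.
  have old t : (t < k)%N ->
      iarr s'' (ab, (a t)%:Z) = iarr s' (ab, (a t)%:Z) /\
      rarr s'' (ao, (a t)%:Z) = rarr s' (ao, (a t)%:Z).
    move=> tk; rewrite r3 r4 eqz_nat.
    suff /negPf -> : a t != a k by [].
    apply/eqP => /(inj _ _ (ltn_trans tk kn) kn) tk'.
    by rewrite tk' ltnn in tk.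
  have new : iarr s'' (ab, (a k)%:Z) = b' /\ rarr s'' (ao, (a k)%:Z) = x - z'.
    by rewrite r3 r4 eqxx.
  split=> /=.
  + by rewrite r1.
  + move=> k1; rewrite r2; have /andP[] := h2; move=> /le_trans + _; apply.
    exact: sa.
  + move=> t; rewrite ltnS leq_eqVlt => /orP[/eqP ->|tk].
      have [-> ->] := new; rewrite r1 r2; split=> //.
        by case/andP: h2 => h6 h7; rewrite subr_ge0 h6 ltrBlDl.
      by rewrite /= (_ : x - (x - z') = z'); [exact: ahead_refl|ring].
    have [-> ->] := old _ tk; have [q1 q2 q3] := it _ tk; rewrite r1 r2.
    split=> //; first by clear -q2; lia.
    exact: ahead_trans h1.
  + move=> t u tu; rewrite ltnS leq_eqVlt => /orP[/eqP uk|uk]; last first.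
      have [-> ->] := old _ (leq_ltn_trans tu uk); have [-> ->] := old _ uk.
      exact: itu.
    move: tu; rewrite uk leq_eqVlt => /orP[/eqP ->|tk]; first exact: ahead_refl.
    have [-> ->] := new; have [-> ->] := old _ tk.
    rewrite (_ : keys s ak (a k) - (x - z') = z'); last by rewrite /x; ring.
    by have [_ _ q3] := it _ tk; exact: ahead_trans h1.
have [_ _ it itu] := I4.
have ex i : (i < n)%N -> exists2 t, (t < n)%N & a t = i.
  move=> i_n; have : i \in mkseq a n by rewrite (perm_mem pa) mem_iota.
  by move=> /mapP[t]; rewrite mem_iota => tn ->; exists t.
exists s4; split.
- apply: within_seq w2 _; apply: within_seq; first exact: run_within.
  apply: within_seq; first exact: run_within.
  by apply: within_seq w4 _; apply: (@run_within _ _ Skip).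
- split=> [i /ex[t tn <-]|i j /ex[t tn <-] /ex[u un <-]].
    by have [] := it _ tn.
  by have [tu|/ltnW ut] := leqP t u; [left|right]; apply: itu.
- by move=> i /ex[t tn <-]; have [] := it _ tn.
Qed.

End Scan.

Definition floor_step (L ak ab ao : nat) : cmd :=
  seqs [:: ISet 4 (IFloor (RDiv (RGet ak (IVar 2)) (RConst L)));
           IPut ab (IVar 2) (IVar 4);
           RPut ao (IVar 2)
             (RSub (RGet ak (IVar 2)) (RMul (RConst L) (ROfInt (IVar 4))))].

Definition floor_cut (L ak ab ao : nat) : cmd := For 2 1 (floor_step L ak ab ao).

Definition shift_step (L a ab ao au ac : nat) : cmd :=
  let u := RAdd (RGet ao (IVar 2)) (RConst (2 * a)%N) in
  let b := IGet ab (IVar 2) in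
  If (RLe (RConst L) u)
    (Seq (RPut au (IVar 2) (RSub u (RConst L)))
         (IPut ac (IVar 2) (IAdd b (IConst 1))))
    (Seq (RPut au (IVar 2) u) (IPut ac (IVar 2) b)).

Definition shift_cut (L a ab ao au ac : nat) : cmd :=
  For 2 1 (shift_step L a ab ao au ac).

(** The table survives from one shift to the next; resetting only the keys about to be looked up
    takes linear time. *)
Definition hash_clear : cmd :=
  Insert 0 (IGet 4 (IVar 2)) (IGet 5 (IVar 2)) (IConst 0).

(** Cell numbers start at 1, since 0 stands for an absent key. *)
Definition hash_step : cmd :=
  let c1 := IGet 4 (IVar 2) in let c2 := IGet 5 (IVar 2) in
  seqs [:: ISet 4 (IFind 0 c1 c2);
           If (ILe (IVar 4) (IConst 0))
             (seqs [:: ISet 11 (IAdd (IVar 11) (IConst 1));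
                       Insert 0 c1 c2 (IVar 11);
                       ISet 4 (IVar 11)])
             Skip;
           IPut 6 (IVar 2) (IVar 4)].

Definition hash_ids : cmd :=
  seqs [:: For 2 1 hash_clear; ISet 11 (IConst 0); For 2 1 hash_step].

(** A pair is encoded in base [2 * n + 2], which exceeds every second component. The factor [L]
    keeps distinct codes at least one interval length apart, so [compress] puts two keys in one
    interval iff the pairs are equal, and its interval numbers serve as cell numbers. *)
Definition pair_key (L : nat) : cmd :=
  RPut 9 (IVar 2)
    (RMul (RConst L)
       (RAdd (RMul (ROfInt (IGet 4 (IVar 2)))
                   (ROfInt (IAdd (IVar 3) (IConst 1))))
             (ROfInt (IGet 5 (IVar 2))))).

Definition sort_ids (L : nat) : cmd :=
  Seq (For 2 1 (pair_key L)) (compress L 9 6 10).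

Section Cells.
Variables (R : realType) (L n : nat).
Implicit Types (s : state R).

Lemma floor_cut_rule F ak ab ao s : (0 < L)%N -> ak != ao -> (n.+1 <= 2 * F)%N ->
  ireg s 1 = n%:Z ->
  exists2 s', exec_within F (floor_cut L ak ab ao) s s' &
    interval_cut L n (keys s ak) (fun i => iarr s' (ab, i%:Z)) (fun i => rarr s' (ao, i%:Z)).
Proof.
move=> L0 akao mF s1; have L0' : 0 < L%:R :> R by rewrite ltr0n.
pose z i := keys s ak i; pose B i := Num.floor (z i / L%:R).
have [||s' [w' _ I']] := @for_rule R (fun k s' => forall t, (t < k)%N ->
    iarr s' (ab, t%:Z) = B t /\ rarr s' (ao, t%:Z) = z t - L%:R * (B t)%:~R)
  F n 2 1 (floor_step L ak ab ao) s mF isT isT isT isT s1.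
- by [].
- move=> k s' kn s'k [_ _ f3 f4] Is' t tk.
  rewrite /= s'k -!pmulrn !xpair_eqE !eqz_nat !eqxx /=.
  case: eqP => [->|/eqP tk']; last by apply: Is'; rewrite ltn_neqAle tk' -ltnS.
  by rewrite f4 ?inE.
exists s' => //; split=> [i i_n|].
  have [_ ->] := I' _ i_n; have := floor_itv (z i / L%:R).
  rewrite -/(B i) => /andP[]; rewrite ler_pdivlMr // ltr_pdivrMr // intrD mulrDl.
  by rewrite subr_ge0 mulrC => -> /=; lra.
have E i j : (i < n)%N -> (j < n)%N -> iarr s' (ab, i%:Z) <= iarr s' (ab, j%:Z) ->
  ahead L (iarr s' (ab, i%:Z)) (z i - rarr s' (ao, i%:Z))
    (iarr s' (ab, j%:Z)) (z j - rarr s' (ao, j%:Z)).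
  move=> i_n j_n; have [-> ->] := I' _ i_n; have [-> ->] := I' _ j_n => ij.
  have e : z j - (z j - L%:R * (B j)%:~R) =
    z i - (z i - L%:R * (B i)%:~R) + L%:R * (B j - B i)%:~R by rewrite intrD mulrNz; ring.
  by split; rewrite // e.
by move=> i j i_n j_n; case: (leP (iarr s' (ab, i%:Z)) (iarr s' (ab, j%:Z))) => [h|/ltW h];
  [left|right]; apply: E.
Qed.

(* The offset and the interval number after moving the grid left by [2 * a]. *)
Definition shifted (a : nat) (o : R) : R :=
  if L%:R <= o + (2 * a)%:R then o + (2 * a)%:R - L%:R else o + (2 * a)%:R.

Definition shifted_cell (a : nat) (b : int) (o : R) : int :=
  if L%:R <= o + (2 * a)%:R then b + 1 else b.

Lemma shift_cut_rule F a ab ao au ac s : ao != au -> ab != ac ->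
  (n.+1 <= 2 * F)%N -> ireg s 1 = n%:Z ->
  exists2 s', exec_within F (shift_cut L a ab ao au ac) s s' &
    forall i, (i < n)%N ->
      rarr s' (au, i%:Z) = shifted a (rarr s (ao, i%:Z)) /\
      iarr s' (ac, i%:Z) = shifted_cell a (iarr s (ab, i%:Z)) (rarr s (ao, i%:Z)).
Proof.
move=> h1 h2 mF s1.
have [||s' [w' _ I']] := @for_rule R (fun k s' => forall i, (i < k)%N ->
      rarr s' (au, i%:Z) = shifted a (rarr s (ao, i%:Z)) /\
      iarr s' (ac, i%:Z) = shifted_cell a (iarr s (ab, i%:Z)) (rarr s (ao, i%:Z)))
  F n 2 1 (shift_step L a ab ao au ac) s mF isT isT isT isT s1; last by exists s'.
  by [].
move=> k s' kn s'k [_ _ f3 f4] Is' t tk.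
have e3 : iarr s' (ab, k%:Z) = iarr s (ab, k%:Z).
  by apply: f3; rewrite /= !inE orbb.
have e4 : rarr s' (ao, k%:Z) = rarr s (ao, k%:Z).
  by apply: f4; rewrite /= !inE orbb.
have [->|tk'] := eqVneq t k.
  rewrite /= s'k -!pmulrn e4 /shifted /shifted_cell; case: ifP => _ /=.
    by rewrite ?s'k ?xpair_eqE !eqxx /= ?e3 ?e4.
  by rewrite ?s'k ?xpair_eqE !eqxx /= ?e3 ?e4.
have tk2 : (t < k)%N by rewrite ltn_neqAle tk' -ltnS.
have := Is' _ tk2; rewrite /= s'k; case: ifP => _ /=.
  by rewrite !xpair_eqE !eqz_nat (negPf tk') !andbF.
by rewrite !xpair_eqE !eqz_nat (negPf tk') !andbF.
Qed.

(** The shift is shorter than an interval, so interval numbers grow by at most one, and adjacency of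
    consecutive intervals makes the new left ends agree. Left ends of different cells are at least
    [L] apart; an offset at least 2 in the right one and below [L] in the left one then give a
    distance above 2. *)
Lemma cut_shifted a (z : nat -> R) B O : (2 * a < L)%N -> interval_cut L n z B O ->
  let U i := shifted a (O i) in let C i := shifted_cell a (B i) (O i) in
  forall i j, (i < n)%N -> (j < n)%N ->
  [/\ 0 <= U i < L%:R, C i = C j -> z i - U i = z j - U j &
      C i != C j -> 2 <= U i -> 2 <= U j -> 4 < (z i - z j) ^+ 2].
Proof.
move=> aL [cO cB] U C.
have aL' : (2 * a)%:R < L%:R :> R by rewrite ltr_nat.
have a0 : 0 <= (2 * a)%:R :> R by [].
have rng i : (i < n)%N -> 0 <= U i < L%:R.
  move=> /cO; rewrite /U /shifted => /andP[h1 h2].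
  by case: (leP L%:R (O i + _)) => h; apply/andP; split; lra.
suff key i j : (i < n)%N -> (j < n)%N ->
    ahead L (B i) (z i - O i) (B j) (z j - O j) ->
    (C i = C j -> z i - U i = z j - U j) /\
    (C i != C j -> z i - U i + L%:R <= z j - U j \/
                   z j - U j + L%:R <= z i - U i).
  move=> i j i_n j_n; have hi := rng _ i_n; have hj := rng _ j_n.
  split=> //; first by move=> e; case: (cB _ _ i_n j_n) => /key [] // ? _; [|symmetry]; auto.
  have far (x y u v : R) : 0 <= u < L%:R -> 2 <= v -> x - u + L%:R <= y - v ->
      4 < (y - x) ^+ 2.
    move=> /andP[u1 u2] v2 h; have : 2 < y - x by lra.
    by move=> h'; nra.
  move=> Cij Ui Uj.
  have [h|h] : z i - U i + L%:R <= z j - U j \/ z j - U j + L%:R <= z i - U i.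
  - case: (cB _ _ i_n j_n) => /key [] // _; first exact.
    by rewrite eq_sym => /(_ Cij) []; [right|left].
  - by rewrite -sqrrN opprB; apply: far hi Uj h.
  - exact: far hj Ui h.
move=> i_n j_n [h1 h2 h3].
have L0 : 0 <= L%:R :> R by [].
have /andP[oi1 oi2] := cO _ i_n; have /andP[p1 p2] := cO _ j_n.
have e0 : B j = B i -> z j - O j = z i - O i.
  by move=> e; rewrite h3 e ?subrr ?mulr0 ?addr0 // lerDl.
have e1 : B j = B i + 1 -> z j - O j = z i - O i + L%:R.
  by move=> e; rewrite h3 e ?lexx // [X in X%:~R](_ : _ = 1) ?mulr1 // addrAC subrr add0r.
have e2 : B i + 2 <= B j -> z i - O i + 2 * L%:R <= z j - O j.
  move=> e; apply: le_trans h2; rewrite lerD2l mulrC ler_wpM2l //.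
  by rewrite (_ : 2 = 2%:~R) // ler_int lerBrDl.
have : [\/ B j = B i, B j = B i + 1 | B i + 2 <= B j].
  have [|] := ltP (B j) (B i + 2) => h.
    have [/eqP ->|] := boolP (B j == B i); first by constructor 1.
    by move=> e; constructor 2; clear -e h h1; lia.
  by constructor 3.
rewrite /C /U /shifted /shifted_cell.
case=> e; [have E := e0 e|have E := e1 e|have E := e2 e];
  (case: (leP L%:R (O i + _)) => hi; case: (leP L%:R (O j + _)) => hj);
  rewrite ?e; split=> q; try (by rewrite eqxx in q);
  try (by exfalso; move: q e; clear; lia);
  try (by first [lra | left; lra | right; lra]).
Qed.

(* Shifts are two apart, so a point lies in the forbidden margin of width two
   for at most one of them. *)
Lemma margin_unique (a a' : nat) (o : R) : 0 <= o < L%:R ->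
  (2 * a < L)%N -> (2 * a' < L)%N -> ~~ odd L ->
  shifted a o < 2 -> shifted a' o < 2 -> a = a'.
Proof.
move=> /andP[oge0 oltL]; wlog aa : a a' / (a <= a')%N.
  by move=> h ? ? ? ? ?; have [/h|/ltnW/h] := leqP a a' => h'; [|symmetry]; apply: h'.
move=> aL aL' Lev h1 h2; apply/eqP; rewrite eqn_leq aa /= leqNgt; apply/negP => lt.
have e : (2 * a')%:R = (2 * a)%:R + (2 * (a' - a))%:R :> R.
  by rewrite -natrD; congr (_%:R); lia.
have d2 : 2 <= (2 * (a' - a))%:R :> R by rewrite (ler_nat R 2); lia.
have [K LE] : exists K, L = (2 * K)%N.
  by exists (L./2); rewrite mul2n -[LHS]odd_double_half (negPf Lev).
(* As [L] is even, the two shifts are also two apart modulo [L], which handles offsets that wrap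
   around. *)
have dL : (2 * (a' - a))%:R <= L%:R - 2 :> R.
  by rewrite lerBrDr -natrD ler_nat; lia.
have a0 : 0 <= (2 * a)%:R :> R by [].
move: h1 h2; rewrite /shifted e.
by case: (leP L%:R (o + (2 * a)%:R)) => q1;
  case: (leP L%:R (o + (_ + _))) => q2; lra.
Qed.

Definition cell_ids (C1 C2 : nat -> int) (ID : nat -> int) : Prop :=
  (forall i, (i < n)%N -> 0 <= ID i < (2 * n).+1%:Z) /\
  (forall i j, (i < n)%N -> (j < n)%N ->
     (ID i == ID j) = (C1 i == C1 j) && (C2 i == C2 j)).

Lemma hash_ids_rule F s : (n.+1 <= 2 * F)%N -> ireg s 1 = n%:Z ->
  exists2 s', exec_within F hash_ids s s' &
    cell_ids (fun i => iarr s (4%N, i%:Z)) (fun i => iarr s (5%N, i%:Z))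
             (fun i => iarr s' (6%N, i%:Z)).
Proof.
move=> mF s1; have F0 : (0 < F)%N by clear -mF; lia.
pose c1 i := iarr s (4%N, i%:Z); pose c2 i := iarr s (5%N, i%:Z).
pose h s' i := hash s' (0%N, c1 i, c2 i).
have [||s2 [w2 [f1 _ f3 _] I2]] := @for_rule R (fun k s' => forall t, (t < k)%N ->
    h s' t = 0) F n 2 1 hash_clear s mF isT isT isT isT s1.
- by [].
- move=> k s' kn s'k [_ _ f3 _] Is' t tk.
  rewrite /h /= s'k !f3 //; case: eqP => // /eqP ne.
  apply: Is'; rewrite ltn_neqAle -ltnS tk andbT.
  by apply: contraNneq ne => ->.
pose s3 := set_ireg s2 11 0.
have e1 : ireg s3 1 = n%:Z by rewrite /= f1.
(* The clauses on [h] range over all [n] points, since a point not yet reached may share its key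
   with an earlier one. *)
have [||s4 [w4 _ I4]] := @for_rule R (fun k s' =>
    [/\ 0 <= ireg s' 11 <= k%:Z,
        forall t, (t < n)%N -> 0 <= h s' t <= ireg s' 11,
        forall t u, (t < n)%N -> (u < n)%N -> h s' t != 0 -> h s' t = h s' u ->
          c1 t = c1 u /\ c2 t = c2 u &
        forall t, (t < k)%N -> iarr s' (6%N, t%:Z) = h s' t /\ h s' t != 0])
  F n 2 1 hash_step s3 mF isT isT isT isT e1.
- have h0 t : (t < n)%N -> h (set_ireg s3 2 0) t = 0 by exact: I2.
  by split=> // [t t_n|t u t_n _]; rewrite h0 ?eqxx.
- move=> k s' kn s'k [_ _ g3 _] [i1 i2 i3 i4].
  have h4 : iarr s' (4%N, k%:Z) = c1 k by rewrite g3 //= f3.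
  have h5 : iarr s' (5%N, k%:Z) = c2 k by rewrite g3 //= f3.
  have hE s'' i v : h (set_hash s'' (0%N, c1 k, c2 k) v) i =
      if (c1 i == c1 k) && (c2 i == c2 k) then v else h s'' i.
    by rewrite /h /= !xpair_eqE eqxx.
  have /andP[G0 Gk] := i1; have /andP[hk0 hkG] := i2 _ kn.
  have [hk|hk] := lerP (h s' k) 0.
    have hk' : h s' k = 0 by apply/eqP; rewrite eq_le hk hk0.
    set v := ireg s' 11 + 1.
    pose s1' := set_hash s' (0%N, c1 k, c2 k) v.
    have -> : run hash_step s' =
        set_iarr (set_ireg (set_hash (set_ireg (set_ireg s' 4 (h s' k)) 11 v)
          (0%N, c1 k, c2 k) v) 4 v) (6%N, k%:Z) v.
      by rewrite /hash_step /= s'k h4 h5 -/(h s' k) hk /= ?s'k ?h4 ?h5.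
    have hE' i : h (set_ireg (set_iarr (set_ireg (set_hash (set_ireg (set_ireg s' 4
        (h s' k)) 11 v) (0%N, c1 k, c2 k) v) 4 v) (6%N, k%:Z) v) 2 (k.+1)%:Z) i =
        if (c1 i == c1 k) && (c2 i == c2 k) then v else h s' i.
      by rewrite -(hE s'); rewrite /h.
    split.
    + by rewrite /= /v; clear -G0 Gk; lia.
    + move=> t t_n; rewrite hE' /=; case: ifP => _; rewrite /v.
        by clear -G0; lia.
      by have := i2 _ t_n; clear; lia.
    + move=> t u t_n u_n; rewrite !hE'.
      have := i2 _ t_n; have := i2 _ u_n.
      case: ifP => [/andP[/eqP -> /eqP ->]|_];
        case: ifP => [/andP[/eqP -> /eqP ->]|_] //.
      * by rewrite /v => q1 q2 _ q3; exfalso; clear -q1 q3; lia.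
      * by rewrite /v => q1 q2 _ q3; exfalso; clear -q2 q3; lia.
      * by move=> _ _; apply: i3.
    + move=> t; rewrite ltnS leq_eqVlt hE' /= xpair_eqE /= eqz_nat.
      have v0 : v != 0 by rewrite /v; clear -G0; lia.
      case/orP => [/eqP ->|tk]; first by rewrite !eqxx.
      rewrite ltn_eqF //; have [-> ht] := i4 _ tk; case: ifP => // /andP[/eqP a1 /eqP a2].
      by exfalso; move: ht; rewrite /h a1 a2 -/(h s' k) hk' eqxx.
  have -> : run hash_step s' = set_iarr (set_ireg s' 4 (h s' k)) (6%N, k%:Z) (h s' k).
    by rewrite /hash_step /= s'k h4 h5 -/(h s' k) leNgt hk /= ?s'k.
  split=> //=.
  + by clear -G0 Gk; lia.
  + move=> t; rewrite ltnS leq_eqVlt => /orP[/eqP ->|tk].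
      by rewrite eqxx; split=> //; rewrite gt_eqF.
    by rewrite xpair_eqE eqz_nat (ltn_eqF tk) andbF /=; apply: i4.
have [i1 i2 i3 i4] := I4.
exists s4.
  apply: within_seq w2 _; apply: within_seq; first exact: (@run_within _ F (ISet 11 (IConst 0))).
  by apply: within_seq w4 _; apply: (@run_within _ _ Skip).
split=> [t t_n|t u t_n u_n].
  have [-> ht] := i4 _ t_n; have := i2 _ t_n; clear -i1; lia.
have [-> ht] := i4 _ t_n; have [-> hu] := i4 _ u_n; apply/eqP/andP.
  by move=> /(i3 _ _ t_n u_n ht) [a1 a2]; split; apply/eqP.
by case=> /eqP a1 /eqP a2; rewrite /h /c1 /c2 a1 a2.
Qed.

Lemma sort_ids_rule s : (0 < L)%N -> ireg s 1 = n%:Z ->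
  ireg s 3 = (2 * n).+1%:Z ->
  (forall i, (i < n)%N -> 0 <= iarr s (5%N, i%:Z) <= (2 * n).+1%:Z) ->
  exists2 s', exec_within (n.+1 * (up_log 2 n).+1) (sort_ids L) s s' &
    cell_ids (fun i => iarr s (4%N, i%:Z)) (fun i => iarr s (5%N, i%:Z))
             (fun i => iarr s' (6%N, i%:Z)).
Proof.
move=> L0 s1 s3 c2P; set F := (_ * _)%N; have L0' : 0 < L%:R :> R by rewrite ltr0n.
have mF : (n.+1 <= 2 * F)%N.
  by rewrite /F (leq_trans (leq_pmulr _ (ltn0Sn (up_log 2 n)))) // leq_pmull.
pose c1 i := iarr s (4%N, i%:Z); pose c2 i := iarr s (5%N, i%:Z).
pose N i : int := c1 i * ((2 * n).+1%:Z + 1) + c2 i.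
have [||s2 [w2 [f1 _ f3 _] I2]] := @for_rule R (fun k s' => forall t, (t < k)%N ->
    rarr s' (9%N, t%:Z) = L%:R * (N t)%:~R) F n 2 1 (pair_key L) s mF isT isT isT isT s1.
- by [].
- move=> k s' kn s'k [g1 _ g3 _] Is' t tk.
  rewrite /= s'k xpair_eqE /= eqz_nat -pmulrn g1 // s3 !g3 //.
  case: eqP => [->|/eqP tk']; first by rewrite /N [in RHS]intrD [in RHS]intrM.
  by apply: Is'; rewrite ltn_neqAle tk'.
have e1 : ireg s2 1 = n%:Z by rewrite f1.
have [s' [w' [cO cB] rng]] := @compress_rule R L n 9 6 10 s2 L0 isT isT e1.
exists s'; first exact: within_seq w2 w'.
split=> [i /rng|i j i_n j_n]; first by clear; lia.
have kE p : (p < n)%N -> keys s2 9 p = L%:R * (N p)%:~R by exact: I2.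
have NE : (N i == N j) = (c1 i == c1 j) && (c2 i == c2 j).
  have := c2P _ i_n; have := c2P _ j_n; rewrite -/(c2 i) -/(c2 j) /N.
  clear; move: (c1 i) (c1 j) (c2 i) (c2 j) => a b c d h1 h2.
  apply/eqP/andP => [e|[/eqP -> /eqP ->]] //.
  have : a = b by nia.
  by move=> ab; rewrite ab in e *; split; apply/eqP => //; lia.
rewrite -NE.
wlog h : i j i_n j_n {NE} / ahead L (iarr s' (6%N, i%:Z)) (keys s2 9 i - rarr s' (10%N, i%:Z))
    (iarr s' (6%N, j%:Z)) (keys s2 9 j - rarr s' (10%N, j%:Z)).
  move=> W; have [h|h] := cB _ _ i_n j_n; first exact: W.
  by rewrite eq_sym [RHS]eq_sym; apply: W.
have /andP[oi1 oi2] := cO _ i_n; have /andP[oj1 oj2] := cO _ j_n.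
have [h1 h2 h3] := h; rewrite !kE // in h2 h3; apply/eqP/eqP => [e|e].
  have h4 : L%:R * (N j)%:~R - rarr s' (10%N, j%:Z) =
            L%:R * (N i)%:~R - rarr s' (10%N, i%:Z).
    by rewrite h3 e ?subrr ?mulr0 ?addr0 // lerDl.
  have lt1 p q (o o' : R) : L%:R * (N p)%:~R - o = L%:R * (N q)%:~R - o' ->
      0 <= o' -> o < L%:R -> N p <= N q.
    move=> pq o1' o2'; rewrite -ltzD1 -(ltr_int R) intrD -(ltr_pM2l L0').
    by rewrite mulrDr mulr1; lra.
  by apply/eqP; rewrite eq_le (lt1 _ _ _ _ h4) // (lt1 _ _ _ _ (esym h4)).
apply/eqP; rewrite eq_le h1 /= leNgt; apply/negP => lt.
have : L%:R <= L%:R * (iarr s' (6%N, j%:Z) - iarr s' (6%N, i%:Z))%:~R :> R.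
  by rewrite ler_peMr // (ler_int R 1); clear -lt; lia.
by move: h2; rewrite e; lra.
Qed.

End Cells.

(** * Optimal sets of representatives *)

(** The written names of an unrolled program of symbolic length cannot be computed, so they are
    bounded by predicates. *)
Definition confined (pi pr pa pb : pred nat) (c : cmd) : bool :=
  [&& all pi (wireg c), all pr (wrreg c), all pa (wiarr c) & all pb (wrarr c)].

Lemma confined_seq pi pr pa pb c1 c2 : confined pi pr pa pb (Seq c1 c2) =
  confined pi pr pa pb c1 && confined pi pr pa pb c2.
Proof.
rewrite /confined /= !all_cat.
by do ?case: (all _ _).
Qed.

Lemma confined_seqs (T : Type) pi pr pa pb (f : T -> cmd) (l : seq T) :
  (forall a, confined pi pr pa pb (f a)) -> confined pi pr pa pb (seqs (map f l)).
Proof. by move=> h; elim: l => //= a l IH; rewrite confined_seq h IH. Qed.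

Lemma confined_for (pi pr pa pb : pred nat) k lim body : pi k ->
  confined pi pr pa pb body -> confined pi pr pa pb (For k lim body).
Proof.
by move=> pk; rewrite /confined /= !all_cat /= ?andbT pk ?cats0 => /and4P[-> -> -> ->].
Qed.

Lemma confined_weaken (pi pr pa pb qi qr qa qb : pred nat) c :
  subpred pi qi -> subpred pr qr -> subpred pa qa -> subpred pb qb ->
  confined pi pr pa pb c -> confined qi qr qa qb c.
Proof.
by move=> h1 h2 h3 h4 /and4P[*]; apply/and4P; split;
  [apply: (sub_all h1)|apply: (sub_all h2)|apply: (sub_all h3)|apply: (sub_all h4)].
Qed.

Lemma loopfree_seqs (T : Type) (f : T -> cmd) (l : seq T) :
  (forall a, loopfree (f a)) -> loopfree (seqs (map f l)).
Proof. by move=> h; elim: l => //= a l ->; rewrite h. Qed.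

Definition same_off (R : realType) (pi pr pa pb : pred nat) (s s' : state R) :=
  [/\ forall x, ~~ pi x -> ireg s' x = ireg s x,
      forall x, ~~ pr x -> rreg s' x = rreg s x,
      forall a, ~~ pa a -> forall i, iarr s' (a, i) = iarr s (a, i) &
      forall a, ~~ pb a -> forall i, rarr s' (a, i) = rarr s (a, i)].

Lemma frame_confined (R : realType) pi pr pa pb c (s s' : state R) :
  confined pi pr pa pb c -> frame c s s' -> same_off pi pr pa pb s s'.
Proof.
move=> /and4P[/allP h1 /allP h2 /allP h3 /allP h4] [f1 f2 f3 f4].
split=> x hx.
- by apply: f1; apply: contra hx => /h1.
- by apply: f2; apply: contra hx => /h2.
- by apply: f3; apply: contra hx => /h3.
- by apply: f4; apply: contra hx => /h4.
Qed.

Lemma same_off_trans (R : realType) pi pr pa pb (s1 s2 s3 : state R) :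
  same_off pi pr pa pb s1 s2 -> same_off pi pr pa pb s2 s3 ->
  same_off pi pr pa pb s1 s3.
Proof.
move=> [a1 a2 a3 a4] [b1 b2 b3 b4]; split=> x hx.
- by rewrite b1 ?a1.
- by rewrite b2 ?a2.
- by move=> i; rewrite b3 ?a3.
- by move=> i; rewrite b4 ?a4.
Qed.

Definition slot_array (a : slot) : nat := (20 + choice.pickle a)%N.

Definition clear_slot (a : slot) : cmd :=
  For 2 3 (IPut (slot_array a) (IVar 2) (IConst (-1))).

Definition RLt (e1 e2 : rexp) : test := TNot (RLe e2 e1).

Definition fill_test (M : nat) (a : slot) : test :=
  let u := RGet 7 (IVar 2) in let v := RGet 8 (IVar 2) in
  let r := IGet (slot_array a) (IGet 6 (IVar 2)) in
  TAnd (TAnd (RLe (RConst 2) u) (RLe (RConst 2) v))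
    (TAnd (TAnd (TAnd (RLe (RConst a.1) (RMul (RConst M) u))
                      (RLt (RMul (RConst M) u) (RConst a.1.+1)))
                (TAnd (RLe (RConst a.2) (RMul (RConst M) v))
                      (RLt (RMul (RConst M) v) (RConst a.2.+1))))
          (TOr (TNot (ILe (IConst 0) r)) (RLe (RGet 2 r) (RGet 2 (IVar 2))))).

Definition fill_step (M : nat) (a : slot) : cmd :=
  If (fill_test M a) (IPut (slot_array a) (IGet 6 (IVar 2)) (IVar 2)) Skip.

Definition fill_slot (M : nat) (a : slot) : cmd :=
  Seq (clear_slot a) (For 2 1 (fill_step M a)).

Definition fill_slots (L M : nat) : cmd := seqs (map (fill_slot M) (slots L M)).

Section Fill.
Variables (R : realType) (n : nat).
Implicit Types (s : state R) (a : slot).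

Definition cellid s (i : nat) : int := iarr s (6%N, i%:Z).
Definition offx s (i : nat) : R := rarr s (7%N, i%:Z).
Definition offy s (i : nat) : R := rarr s (8%N, i%:Z).
Definition wt s (i : nat) : R := rarr s (2%N, i%:Z).
Definition kept s (i : nat) : bool := (2 <= offx s i) && (2 <= offy s i).
Definition rep s (g : nat) a : int := iarr s (slot_array a, g%:Z).

Definition candidate M s (g : nat) a (i : nat) : bool :=
  [&& cellid s i == g%:Z, kept s i & in_slot M (offx s i) (offy s i) a].

Definition represents M s (k : nat) a : Prop := forall g, (g < (2 * n).+1)%N ->
  (0 <= rep s g a -> (`|rep s g a| < n)%N && candidate M s g a `|rep s g a|) /\
  (forall i, (i < k)%N -> candidate M s g a i ->
     0 <= rep s g a /\ wt s i <= wt s `|rep s g a|).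

Lemma eval_fill_test M a s i g : ireg s 2 = i%:Z -> cellid s i = g%:Z ->
  eval_t s (fill_test M a) =
  candidate M s g a i && ((rep s g a < 0) || (rarr s (2%N, rep s g a) <= wt s i)).
Proof.
move=> s2 ig; rewrite /candidate ig eqxx /kept /in_slot /= s2.
rewrite -/(cellid s i) ig -/(rep s g a) -/(wt s i) -/(offx s i) -/(offy s i).
rewrite -!pmulrn -!ltNge -!natr1 negb_and !negbK.
by rewrite -leNgt !andbA.
Qed.

Lemma fill_slot_rule F M a s : (n.+1 <= F)%N ->
  ireg s 1 = n%:Z -> ireg s 3 = (2 * n).+1%:Z ->
  (forall i, (i < n)%N -> 0 <= cellid s i < (2 * n).+1%:Z) ->
  exists2 s', exec_within F (fill_slot M a) s s' & represents M s' n a.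
Proof.
move=> nF s1 s3 idP.
have mF1 : ((2 * n).+1.+1 <= 2 * F)%N by clear -nF; lia.
have mF2 : (n.+1 <= 2 * F)%N by clear -nF; lia.
have [||s2 [w2 [f1 _ f3 f4] I2]] := @for_rule R (fun k s' => forall g, (g < k)%N ->
    rep s' g a = -1) F (2 * n).+1 2 3 (IPut (slot_array a) (IVar 2) (IConst (-1)))
    s mF1 isT isT isT isT s3.
- by [].
- move=> k s' kn s'k _ Is' g gk; rewrite /rep /= s'k xpair_eqE eqxx /= eqz_nat.
  case: eqP => // /eqP ne; apply: Is'.
  by rewrite ltn_neqAle ne.
have e1 : ireg s2 1 = n%:Z by rewrite f1.
have g6 i : cellid s2 i = cellid s i by apply: f3.
have [||s4 [w4 _ I4]] := @for_rule R (fun k s' => same_off (pred1 2%N) pred0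
      (pred1 (slot_array a)) pred0 s2 s' /\ represents M s' k a)
    F n 2 1 (fill_step M a) s2 mF2 isT isT isT isT e1.
- split; first by split=> // x /= /negPf ->.
  by move=> g gn; have -> : rep (set_ireg s2 2 0) g a = -1 by exact: I2.
- move=> k s' kn s'k _ [sm Rs'].
  have [c1 _ c3 c4] := sm.
  have idk : 0 <= cellid s' k < (2 * n).+1%:Z.
    by rewrite (_ : cellid s' k = cellid s k) ?idP // -g6; apply: c3.
  have [g0 kg gn] : exists2 g0 : nat, cellid s' k = g0%:Z & (g0 < (2 * n).+1)%N.
    by exists `|cellid s' k|%N; move: idk; clear; lia.
  pose s'' := set_ireg (run (fill_step M a) s') 2 (k.+1)%:Z.
  have same : same_off (pred1 2%N) pred0 (pred1 (slot_array a)) pred0 s' s''.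
    apply: (@frame_confined _ _ _ _ _ (Seq (fill_step M a) (ISet 2 (IConst (k.+1)%:Z)))).
      by rewrite /confined /= !eqxx.
    exact: (run_frame s' (c := Seq (fill_step M a) (ISet 2 (IConst (k.+1)%:Z)))).
  split; first exact: same_off_trans sm same.
  have [_ _ d3 d4] := same.
  have cE g i : candidate M s'' g a i = candidate M s' g a i.
    by rewrite /candidate /kept /offx /offy /cellid d3 // !d4.
  have wE i : wt s'' i = wt s' i by exact: d4.
  have test := eval_fill_test M a s'k kg.
  set b := _ && _ in test.
  have rE g : rep s'' g a = if b && (g == g0) then k%:Z else rep s' g a.
    have -> : rep s'' g a = rep (if b then set_iarr s'
        (slot_array a, iarr s' (6%N, ireg s' 2)) (ireg s' 2) else s') g a.
      by rewrite -test.
    case: (b) => //=.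
    rewrite /rep /= s'k -/(cellid s' k) kg xpair_eqE eqxx eqz_nat /=.
    by case: eqP.
  rewrite -/s''; clearbody s''.
  move=> g gn'; have [r1 r2] := Rs' g gn'; rewrite rE.
  case: ifP => [/andP[bT /eqP ->]|bF].
    move: bT; rewrite /b => /andP[ck better]; split=> [_|i].
      by rewrite /= kn cE ck.
    rewrite ltnS leq_eqVlt cE => /orP[/eqP -> _|ik ci]; first by rewrite !wE.
    split=> //; rewrite !wE /=; have [_ r2'] := Rs' g0 gn.
    have [rep0 wi] := r2' _ ik ci; apply: le_trans wi _.
    by move: better; rewrite ltNge rep0 /= /wt gez0_abs.
  split=> [/r1 []|i]; first by rewrite cE.
  rewrite ltnS leq_eqVlt cE => /orP[/eqP -> ck|ik ci]; last by rewrite !wE; apply: r2.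
  have gg : g = g0.
    by move: ck => /and3P[/eqP + _ _]; rewrite kg => -[].
  move: bF; rewrite gg eqxx andbT /b -gg ck /= => /negbT.
  rewrite negb_or -leNgt -ltNge !wE => /andP[rep0 /ltW wk]; split=> //.
  by rewrite /wt gez0_abs.
have [_ rp] := I4.
by exists s4 => //; apply: within_seq w2 w4.
Qed.

Definition slot_frame := @same_off R (pred1 2%N) pred0 (leq 20) pred0.

Lemma fill_slot_frame F M a s s' :
  exec_within F (fill_slot M a) s s' -> slot_frame s s'.
Proof. by move=> /within_frame; apply: frame_confined. Qed.

Lemma fill_slots_rule F L M s : (n.+1 <= F)%N ->
  ireg s 1 = n%:Z -> ireg s 3 = (2 * n).+1%:Z ->
  (forall i, (i < n)%N -> 0 <= cellid s i < (2 * n).+1%:Z) ->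
  exists s', [/\ exec_within F (fill_slots L M) s s', slot_frame s s' &
    forall a, a \in slots L M -> represents M s' n a].
Proof.
move=> nF s1 s3 idP.
have F0 : (0 < F)%N by apply: leq_trans nF.
have [||s' w' [f' r']] := @within_seqs R _ (fun l s' => slot_frame s s' /\
   forall a, a \in l -> represents M s' n a) F (fill_slot M) (slots L M) s F0.
- move=> l1 a l2 s1' le [f r]; have [f1 _ f3 f4] := f.
  have [|||s2 w2 r2] := @fill_slot_rule F M a s1' nF.
  + by rewrite f1.
  + by rewrite f1.
  + by move=> i i_n; rewrite /cellid f3 // idP.
  have f2 := fill_slot_frame w2.
  exists s2 => //; split; first exact: same_off_trans f2.
  move=> b; rewrite mem_rcons inE => /orP[/eqP -> //|bl].
  have ab : slot_array b != slot_array a.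
    rewrite /slot_array eqn_add2l; apply/eqP => /(pcan_inj (@choice.pickleK _)) ab.
    by have := slots_uniq L M; rewrite le cat_uniq -ab => /and3P[_ /hasPn/(_ b)];
      rewrite mem_head bl => /(_ isT).
  have [_ _ g3 g4] : same_off (pred1 2%N) pred0 (pred1 (slot_array a)) pred0 s1' s2.
    apply: frame_confined (within_frame w2).
    by rewrite /confined /= !eqxx.
  have cE g i : candidate M s2 g b i = candidate M s1' g b i.
    by rewrite /candidate /kept /offx /offy /cellid g3 // !g4.
  move=> g gn; have [r1' r2'] := r b bl g gn.
  rewrite /rep g3 //; split=> [/r1'|i i_n]; rewrite cE //.
  by rewrite /wt !g4 //; apply: r2'.
- by [].
- by exists s'.
Qed.

End Fill.

Definition rep_exp (a : slot) : iexp := IGet (slot_array a) (IVar 2).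

Definition dist_exp (ab : slot * slot) : rexp :=
  let d ak := RSub (RGet ak (rep_exp ab.1)) (RGet ak (rep_exp ab.2)) in
  RAdd (RMul (d 0%N) (d 0%N)) (RMul (d 1%N) (d 1%N)).

Definition TAll (bs : seq test) : test :=
  foldr TAnd (ILe (IConst 0) (IConst 0)) bs.

Definition valid_test (c : seq slot) : test :=
  TAnd (TAll [seq ILe (IConst 0) (rep_exp a) | a <- c])
       (TAll [seq RLt (RConst 4) (dist_exp ab) | ab <- pairs_of c]).

Definition value_exp (c : seq slot) : rexp :=
  foldr RAdd (RConst 0) [seq RGet 2 (rep_exp a) | a <- c].

Definition emit_rep (a : slot) : cmd :=
  Seq (IPut 7 (IVar 12) (rep_exp a)) (ISet 12 (IAdd (IVar 12) (IConst 1))).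

Definition emit (c : seq slot) : cmd := seqs (map emit_rep c).

(** Register 13 is the output size before the current cell; returning to it lets a better candidate
    overwrite the previous choice for that cell. *)
Definition try (c : seq slot) : cmd :=
  If (TAnd (valid_test c) (RLt (RVar 5) (value_exp c)))
     (Seq (RSet 5 (value_exp c)) (Seq (ISet 12 (IVar 13)) (emit c)))
     Skip.

(** The initial 0 in real register 5 is the value of the empty candidate. *)
Definition solve_step (cs : seq (seq slot)) : cmd :=
  seqs [:: RSet 5 (RConst 0); ISet 13 (IVar 12); seqs (map try cs);
           RSet 4 (RAdd (RVar 4) (RVar 5))].

Definition solve (cs : seq (seq slot)) : cmd :=
  seqs [:: RSet 4 (RConst 0); ISet 12 (IConst 0); For 2 3 (solve_step cs)].

Section Solve.
Variables (R : realType) (n : nat).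
Implicit Types (s : state R) (c : seq slot).

Lemma eval_TAll s bs : eval_t s (TAll bs) = all (eval_t s) bs.
Proof. by elim: bs => //= b bs ->. Qed.

Lemma eval_valid_test s g c : ireg s 2 = g%:Z ->
  eval_t s (valid_test c) = valid (keys s 0) (keys s 1) (rep s g) c.
Proof.
move=> s2; rewrite /= !eval_TAll !all_map /valid.
have -> : all (preim (fun a => ILe (IConst 0) (rep_exp a)) (eval_t s)) c =
    all (fun a => 0 <= rep s g a) c by apply: eq_all => a; rewrite /= s2.
case: (boolP (all _ c)) => //= /allP pos; apply: eq_in_all => -[a b].
rewrite mem_filter => /andP[_ /allpairsP[[a' b'] /= [/pos ha /pos hb [-> ->]]]].
rewrite -ltNge s2 -/(rep s g a') -/(rep s g b') -expr2 -expr2.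
by rewrite /dist2 /keys /= !gez0_abs.
Qed.

Lemma eval_value_exp s g c : ireg s 2 = g%:Z -> all (fun a => 0 <= rep s g a) c ->
  eval_r s (value_exp c) = value (keys s 2) (rep s g) c.
Proof.
move=> s2; rewrite /value /value_exp; elim: c => [|a c IH] /=; first by rewrite big_nil.
by move=> /andP[ha /IH ->]; rewrite big_cons s2 -/(rep s g a) /keys gez0_abs.
Qed.

Definition emits (m : nat) (f : slot -> int) c s s' : Prop :=
  [/\ ireg s' 12 = (m + size c)%:Z,
      forall t, (t < m)%N -> iarr s' (7%N, t%:Z) = iarr s (7%N, t%:Z) &
      forall t, (t < size c)%N ->
        iarr s' (7%N, (m + t)%:Z) = f (nth (0%N, 0%N) c t)].

Lemma run_emit s g c m : ireg s 2 = g%:Z -> ireg s 12 = m%:Z ->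
  emits m (rep s g) c s (run (emit c) s).
Proof.
elim: c s m => [|a c IH] s m s2 s12; first by split=> //; rewrite addn0.
rewrite /emit /= s12 s2 -(PoszD m 1) addn1 -/(emit c).
set s' := set_ireg _ _ _.
have [||e1 e2 e3] := IH s' m.+1; [exact: s2|by []|].
have keep b t : (b != 7)%N || (t != m%:Z) -> iarr s' (b, t) = iarr s (b, t).
  by rewrite /s' /= xpair_eqE -negb_and => /negPf ->.
split; first by rewrite e1 addSnnS.
- by move=> t tm; rewrite e2 ?(leq_trans tm) // keep // eqz_nat (ltn_eqF tm).
- case=> [_|t tc].
    by rewrite addn0 e2 // /s' /= eqxx.
  rewrite addnS -addSn e3 //= /rep keep //.
Qed.

Definition solve_frame := @same_off R (mem [:: 12; 13]%N) (pred1 5%N)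
  (pred1 7%N) pred0.

Lemma confined_emit c : confined (pred1 12%N) pred0 (pred1 7%N) pred0 (emit c).
Proof. exact: confined_seqs. Qed.

Lemma confined_try c :
  confined (mem [:: 12; 13]%N) (pred1 5%N) (pred1 7%N) pred0 (try c).
Proof.
rewrite /try /confined /= !cats0 -/(confined _ _ _ _ (emit c)).
apply: confined_weaken (confined_emit c) => // x /eqP -> //.
Qed.

Lemma loopfree_emit c : loopfree (emit c).
Proof. exact: loopfree_seqs. Qed.

Lemma loopfree_try c : loopfree (try c).
Proof. by rewrite /= loopfree_emit. Qed.

Lemma loopfree_solve_step cs : loopfree (solve_step cs).
Proof. by rewrite /= loopfree_seqs // => c; rewrite loopfree_try. Qed.

Lemma confined_solve_step cs :
  confined (mem [:: 12; 13]%N) (mem [:: 4; 5]%N) (pred1 7%N) pred0 (solve_step cs).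
Proof.
rewrite /solve_step !confined_seq confined_seqs // => c.
by apply: confined_weaken (confined_try c) => // x /eqP ->.
Qed.

(* The candidate [c] is the current choice for cell [g]; its representatives
   have been appended to the output of length [m] of state [s0]. *)
Definition chosen s0 (g m : nat) c s : Prop :=
  [/\ solve_frame s0 s, ireg s 13 = m%:Z,
      valid (keys s0 0) (keys s0 1) (rep s0 g) c,
      rreg s 5 = value (keys s0 2) (rep s0 g) c &
      emits m (rep s0 g) c s0 s].

Lemma run_try s0 g m c c' s : ireg s0 2 = g%:Z -> chosen s0 g m c s ->
  exists c2, [/\ c2 \in [:: c; c'], chosen s0 g m c2 (run (try c') s),
    value (keys s0 2) (rep s0 g) c <= value (keys s0 2) (rep s0 g) c2 &
    valid (keys s0 0) (keys s0 1) (rep s0 g) c' ->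
      value (keys s0 2) (rep s0 g) c' <= value (keys s0 2) (rep s0 g) c2].
Proof.
move=> s02 ch; have [fr s13 vc s5 em] := ch; have [f1 f2 f3 f4] := fr.
have s2 : ireg s 2 = g%:Z by rewrite f1.
have kE k : keys s k = keys s0 k by apply: funext => p; apply: f4.
have rE : rep s g = rep s0 g by apply: funext => a; apply: f3.
have test : eval_t s (TAnd (valid_test c') (RLt (RVar 5) (value_exp c'))) =
    valid (keys s0 0) (keys s0 1) (rep s0 g) c' &&
    (value (keys s0 2) (rep s0 g) c < value (keys s0 2) (rep s0 g) c').
  rewrite (_ : eval_t s (TAnd _ _) = eval_t s (valid_test c') &&
    ~~ (eval_r s (value_exp c') <= rreg s 5)) // (eval_valid_test _ s2) !kE rE.
  case: (boolP (valid _ _ _ _)) => //= /andP[pos _].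
  by rewrite -ltNge s5 (eval_value_exp s2) ?kE rE.
have runE : run (try c') s = if eval_t s (TAnd (valid_test c')
    (RLt (RVar 5) (value_exp c'))) then run (emit c') (set_ireg
      (set_rreg s 5 (eval_r s (value_exp c'))) 12 (ireg s 13)) else s by [].
set b := _ && _ in test; have [bT|nlt] := boolP b; last first.
  exists c; split; rewrite ?mem_head // ?runE ?test ?(negPf nlt) //.
  by move=> v'; move: nlt; rewrite /b v' -leNgt.
have /andP[v' lt] := bT.
exists c'; split; rewrite ?inE ?eqxx ?orbT //; last exact: ltW.
have fr' : solve_frame s (run (try c') s).
  by apply: frame_confined (confined_try c') _; apply: run_frame (loopfree_try c').
have pos : all (fun a => 0 <= rep s g a) c' by move: v' => /andP[]; rewrite rE.
move: fr'; rewrite runE test bT (eval_value_exp s2 pos) kE rE s13.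
set s' := set_ireg _ _ _ => fr'.
have [g1 g2 g3 g4] :=
  frame_confined (confined_emit c') (run_frame s' (loopfree_emit c')).
have [|e1 e2 e3] := @run_emit s' g c' m _ erefl; first exact: s2.
have r'E : rep s' g = rep s0 g by exact: rE.
split=> //; first exact: same_off_trans fr fr'.
- by rewrite g1.
- by rewrite g2 //= eqxx.
- split=> // [t tm|t tc]; last by rewrite e3 // r'E.
  rewrite e2 //; have [_ + _] := em; apply; exact: tm.
Qed.

Lemma run_tries s0 g m c cs s : ireg s0 2 = g%:Z -> chosen s0 g m c s ->
  exists c2, [/\ c2 \in c :: cs, chosen s0 g m c2 (run (seqs (map try cs)) s),
    value (keys s0 2) (rep s0 g) c <= value (keys s0 2) (rep s0 g) c2 &
    forall c', c' \in cs -> valid (keys s0 0) (keys s0 1) (rep s0 g) c' ->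
      value (keys s0 2) (rep s0 g) c' <= value (keys s0 2) (rep s0 g) c2].
Proof.
move=> s02; elim: cs c s => [|c' cs IH] c s ch.
  by exists c; split=> //; rewrite mem_head.
have [c1 [c1in ch1 le1 le1']] := run_try c' s02 ch.
have [c2 [c2in ch2 le2 le2']] := IH _ _ ch1.
exists c2; split=> //; last 1 first.
- move=> b; rewrite inE => /orP[/eqP -> /le1' h|/le2' //].
  exact: le_trans le2.
- move: c2in; rewrite inE => /orP[/eqP ->|]; last by rewrite !inE => ->; rewrite !orbT.
  by move: c1in; rewrite !inE => /orP[] ->; rewrite ?orbT.
- exact: le_trans le2.
Qed.

(* State [s] holds the list [S] of the indices of an independent set of points
   of the cells below [k]; its weight is at least that of any choice of one
   candidate of [cs] per cell. *)
Definition solution (cs : seq (seq slot)) s0 (k : nat) (S : seq nat) s : Prop :=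
  [/\ ireg s 12 = (size S)%:Z /\
        (forall t, (t < size S)%N -> iarr s (7%N, t%:Z) = (nth 0%N S t)%:Z),
      uniq S /\ (forall i, i \in S -> [/\ (i < n)%N, kept s0 i & cellid s0 i < k%:Z]),
      {in S &, forall i j, i != j ->
        4 < dist2 (pt (keys s0 0) (keys s0 1) i) (pt (keys s0 0) (keys s0 1) j)},
      rreg s 4 = \sum_(i <- S) wt s0 i &
      forall f : nat -> seq slot,
        (forall g, (g < k)%N -> f g \in cs /\
           valid (keys s0 0) (keys s0 1) (rep s0 g) (f g)) ->
        \sum_(0 <= g < k) value (keys s0 2) (rep s0 g) (f g) <= rreg s 4].

(** Representatives of one cell are far apart by [valid], those of different cells by the hypothesis
    on [kept] points, so cells can be optimized one at a time. *)
Lemma solution_step L M (cs : seq (seq slot)) s0 s k S :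
  (forall c, c \in cs -> uniq c /\ {subset c <= slots L M}) -> [::] \in cs ->
  (forall a, a \in slots L M -> represents n M s0 n a) ->
  {in gtn n &, forall i j, kept s0 i -> kept s0 j -> cellid s0 i != cellid s0 j ->
    4 < dist2 (pt (keys s0 0) (keys s0 1) i) (pt (keys s0 0) (keys s0 1) j)} ->
  (k < (2 * n).+1)%N -> ireg s 2 = k%:Z ->
  same_off (mem [:: 2; 12; 13]%N) (mem [:: 4; 5]%N) (pred1 7%N) pred0 s0 s ->
  solution cs s0 k S s ->
  exists S', solution cs s0 k.+1 S' (run (solve_step cs) s).
Proof.
move=> csP cs0 reps far kn s2 [f1 f2 f3 f4] [[s12 s7] [uS SP] Sfar s4 opt].
pose s1 := set_ireg (set_rreg s 5 0) 13 (ireg s 12).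
have ch1 : chosen s1 k (size S) [::] s1.
  by split=> //; [rewrite /value big_nil|split=> //=; rewrite addn0].
have kE b : keys s1 b = keys s0 b by apply: funext => p; apply: f4.
have rE : rep s1 k = rep s0 k by apply: funext => a; apply: f3.
have [c [cin ch _ cmax]] := @run_tries s1 k (size S) [::] cs s1 s2 ch1.
have -> : run (solve_step cs) s = set_rreg (run (seqs (map try cs)) s1) 4
    (rreg (run (seqs (map try cs)) s1) 4 + rreg (run (seqs (map try cs)) s1) 5) by [].
have ccs : c \in cs by move: cin; rewrite inE => /orP[/eqP ->|].
have [uc cslots] := csP _ ccs.
set s3 := run _ s1 in ch *; clearbody s3.
have [[_ g2 _ _] _ vc s35 [e1 e2 e3]] := ch; rewrite !kE rE in vc s35 cmax.
have s34 : rreg s3 4 = rreg s 4 by rewrite g2.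
have pos a : a \in c -> 0 <= rep s0 k a by case/andP: vc => /allP + _; apply.
pose r a := `|rep s0 k a|%N.
have rP a : a \in c -> [/\ (r a < n)%N, kept s0 (r a) & cellid s0 (r a) = k%:Z].
  move=> ac; have [/(_ (pos _ ac)) /andP[h1 /and3P[/eqP h2 h3 _]] _] :=
    reps a (cslots _ ac) k kn.
  by split.
have cfar a b : a \in c -> b \in c -> a != b ->
    4 < dist2 (pt (keys s0 0) (keys s0 1) (r a)) (pt (keys s0 0) (keys s0 1) (r b)).
  move=> ac bc ab; case/andP: vc => _ /allP /(_ (a, b)); apply.
  by rewrite mem_filter ab; apply/allpairsP; exists (a, b).
have dC p q : dist2 p q = dist2 q p :> R by rewrite /dist2; ring.
exists (S ++ map r c); split.
- split; first by rewrite /= e1 size_cat size_map.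
  move=> t; rewrite size_cat size_map nth_cat => tS; rewrite [LHS]/=.
  have [tS'|St] := ltnP t (size S); first by rewrite e2 //; exact: s7.
  rewrite -{1}(subnKC St); have tc : (t - size S < size c)%N.
    by rewrite ltn_subLR.
  rewrite e3 // (nth_map (0%N, 0%N)) // rE /r gez0_abs // pos //.
  exact: mem_nth.
- split.
    rewrite cat_uniq uS /=; apply/andP; split.
      apply/hasPn => _ /mapP[a ac ->]; apply/negP => /SP[_ _].
      by have [_ _ ->] := rP _ ac; rewrite ltxx.
    rewrite map_inj_in_uniq // => a b ac bc rab; apply/eqP/negP => /negP ab.
    have := cfar _ _ ac bc ab; rewrite rab /dist2 !subrr expr0n /= addr0.
    by rewrite ltNge ler0n.
  move=> i; rewrite mem_cat => /orP[/SP[h1 h2 h3]|/mapP[a ac ->]].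
    by split=> //; apply: lt_trans h3 _; rewrite ltz_nat.
  by have [h1 h2 ->] := rP _ ac; split=> //; rewrite ltz_nat.
- have mixed i j : i \in S -> j \in map r c ->
      4 < dist2 (pt (keys s0 0) (keys s0 1) i) (pt (keys s0 0) (keys s0 1) j).
    move=> /SP[h1 h2 h3] /mapP[a ac ->]; have [g1 g2' g3] := rP _ ac.
    by apply: far => //; rewrite g3 lt_eqF.
  move=> i j; rewrite !mem_cat => /orP[iS|ic] /orP[jS|jc] ij.
  + exact: Sfar.
  + exact: mixed.
  + by rewrite dC; apply: mixed.
  + move/mapP: ic ij => [a ac ->]; move/mapP: jc => [b bc ->] ab.
    by apply: cfar => //; apply: contraNneq ab => ->.
- by rewrite /= s34 s4 s35 big_cat big_map.
- move=> f fP; rewrite big_nat_recr //= s34 s35; apply: lerD.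
    by apply: opt => g gk; apply: fP; apply: ltnW.
  by have [h1 h2] := fP k (ltnSn k); apply: cmax.
Qed.

Lemma solve_rule F L M s :
  (n.+1 <= F)%N -> ireg s 3 = (2 * n).+1%:Z ->
  (forall a, a \in slots L M -> represents n M s n a) ->
  {in gtn n &, forall i j, kept s i -> kept s j -> cellid s i != cellid s j ->
    4 < dist2 (pt (keys s 0) (keys s 1) i) (pt (keys s 0) (keys s 1) j)} ->
  let cs := sublists (slots L M) in
  exists s' S, [/\ exec_within F (solve cs) s s',
    same_off (mem [:: 2; 12; 13]%N) (mem [:: 4; 5]%N) (pred1 7%N) pred0 s s' &
    solution cs s (2 * n).+1 S s'].
Proof.
move=> nF s3 reps far cs.
have csP c : c \in cs -> uniq c /\ {subset c <= slots L M}.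
  move=> /sublists_subseq h; split; last exact: mem_subseq.
  by apply: subseq_uniq h _; apply: slots_uniq.
have cs0 : [::] \in cs.
  by have [l' E] := sublists_nil (slots L M); rewrite /cs E mem_head.
have mF : ((2 * n).+1.+1 <= 2 * F)%N by clear -nF; lia.
have cf := confined_for 3 (isT : mem [:: 2; 12; 13]%N 2%N)
  (confined_weaken (qi := mem [:: 2; 12; 13]%N) _ _ _ _ (confined_solve_step cs)).
pose init := Seq (RSet 4 (RConst 0)) (ISet 12 (IConst 0)).
pose s1 := run init s.
have sm1 : same_off (mem [:: 2; 12; 13]%N) (mem [:: 4; 5]%N) (pred1 7%N) pred0 s s1.
  by apply: (@frame_confined _ _ _ _ _ init) => //; apply: run_frame.
have wri x : x \in [:: 2; 3]%N -> x \notin wireg (solve_step cs).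
  move=> x23; apply/negP => xw; have /and4P[/allP /(_ _ xw) + _ _ _] :=
    confined_solve_step cs.
  by move: x23; rewrite !inE => /orP[] /eqP ->.
have [||s' [w f [S' sol]]] := @for_rule R (fun k s' =>
   exists S, solution cs s k S s') F (2 * n).+1 2 3
  (solve_step cs) s1 mF (loopfree_solve_step cs) isT (wri 2%N isT) (wri 3%N isT) s3.
- exists [::]; split=> //; first by rewrite big_nil.
  by move=> f _; rewrite big_geq.
- move=> k s' kn s'k f [S sol].
  have sm : same_off (mem [:: 2; 12; 13]%N) (mem [:: 4; 5]%N) (pred1 7%N) pred0 s s'.
    apply: same_off_trans sm1 _; apply: frame_confined f; apply: cf => // x.
    by rewrite !inE orbC => ->; rewrite orbT.
  have [S' [[h1 h2] h3 h4 h5 h6]] := solution_step csP cs0 reps far kn s'k sm sol.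
  by exists S'.
have F0 : (0 < F)%N by apply: leq_trans nF.
exists s', S'; split=> //.
  do 2!(apply: within_seq; first exact: run_within).
  by apply: within_seq w _; apply: (@run_within _ F Skip).
apply: same_off_trans sm1 _; apply: frame_confined f; apply: cf => // x.
by rewrite !inE orbC => ->; rewrite orbT.
Qed.

End Solve.

(** * The algorithm *)

Lemma predCN (A : seq nat) x : x \in A -> ~~ predC (mem A) x.
Proof. by move=> xA; rewrite /= xA. Qed.

Definition copy_step : cmd :=
  Seq (RPut 3 (IVar 2) (RGet 0 (IGet 7 (IVar 2))))
      (RPut 4 (IVar 2) (RGet 1 (IGet 7 (IVar 2)))).

Definition update : cmd :=
  If (RLt (RVar 3) (RVar 4))
     (seqs [:: RSet 3 (RVar 4); ISet 0 (IVar 12); For 2 12 copy_step])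
     Skip.

Definition shift_choice (grouper : cmd) (L M a : nat) : cmd :=
  seqs [:: shift_cut L a 2 5 7 4; shift_cut L a 3 6 8 5; grouper;
           fill_slots L M; solve (sublists (slots L M))].

Definition shift_prog (grouper : cmd) (L M a : nat) : cmd :=
  Seq (shift_choice grouper L M a) update.

Definition setup (cutter : nat -> nat -> nat -> cmd) : cmd :=
  seqs [:: ISet 1 (IVar 0);
           ISet 3 (IAdd (IAdd (IVar 0) (IVar 0)) (IConst 1));
           ISet 0 (IConst 0);
           cutter 0%N 2%N 5%N; cutter 1%N 3%N 6%N].

Definition algorithm (cutter : nat -> nat -> nat -> cmd) (grouper : cmd)
    (K M : nat) : cmd :=
  Seq (setup cutter) (seqs (map (shift_prog grouper (2 * K) M) (iota 0 K))).

(** * Approximation guarantee of one shift and average over the shifts *)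

Section CellSum.
Variables (R : realType) (n L M : nat) (m : R).
Hypothesis sectors : forall p : R * R, norm2 p <= 2 * L%:R ^+ 2 ->
  exists c : R * R -> 'I_3, forall q q',
    norm2 q <= norm2 p -> norm2 q' <= norm2 p ->
    m <= dist2 p q <= 4 -> m <= dist2 p q' <= 4 ->
    c q = c q' -> dist2 q q' < m.
Hypotheses (m_ge2 : 2 <= m) (M_gt0 : (0 < M)%N)
  (M_large : 8 * L%:R <= (4 - m) * M%:R).
Implicit Types (s : state R).

Definition spt s (i : nat) : R * R := pt (keys s 0) (keys s 1) i.

Definition indep s (O : seq nat) : Prop :=
  [/\ uniq O, forall i, i \in O -> (i < n)%N &
      {in O &, forall i j, i != j -> 4 < dist2 (spt s i) (spt s j)}].

(** A [solution] beats every simultaneous choice of one valid candidate per cell, so [cell_approx]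
    can be applied in each cell separately and the bounds summed. *)
Lemma solution_approx s s' S (O : seq nat) :
  (forall i, (i < n)%N -> [/\ 0 <= offx s i < L%:R, 0 <= offy s i < L%:R &
     0 <= cellid s i < (2 * n).+1%:Z]) ->
  (forall i j, (i < n)%N -> (j < n)%N -> cellid s i = cellid s j ->
     keys s 0 i - offx s i = keys s 0 j - offx s j /\
     keys s 1 i - offy s i = keys s 1 j - offy s j) ->
  (forall a, a \in slots L M -> represents n M s n a) ->
  solution n (sublists (slots L M)) s (2 * n).+1 S s' ->
  indep s O -> (forall i, i \in O -> kept s i) ->
  \sum_(i <- O) wt s i <= 4 * rreg s' 4.
Proof.
move=> rng orig reps [_ _ _ _ opt] [uO On Ofar] Ok.
have cell g : (g < (2 * n).+1)%N -> exists c,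
   [/\ c \in sublists (slots L M), valid (keys s 0) (keys s 1) (rep s g) c &
    \sum_(i <- O | cellid s i == g%:Z) wt s i <= 4 * value (keys s 2) (rep s g) c].
  move=> gn; pose Og := [seq i <- O | cellid s i == g%:Z].
  have OgP i : i \in Og -> i \in O /\ cellid s i = g%:Z.
    by rewrite mem_filter => /andP[/eqP -> ->].
  have repP a : a \in slots L M -> 0 <= rep s g a ->
      (`|rep s g a| < n)%N /\ candidate M s g a `|rep s g a|.
    by move=> /reps /(_ g gn) [h _] /h /andP[].
  (* The points of a cell share its lower left corner; for an empty cell any values do. *)
  have [cx [cy cxy]] : exists cx cy, forall i, (i < n)%N -> cellid s i = g%:Z ->
      keys s 0 i = cx + offx s i /\ keys s 1 i = cy + offy s i.
    have [[i0 [i0n i0g]]|none] := pselect (exists i, (i < n)%N /\ cellid s i = g%:Z).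
      exists (keys s 0 i0 - offx s i0), (keys s 1 i0 - offy s i0) => i i_n ig.
      have [|e1 e2] := orig _ _ i_n i0n; first by rewrite ig i0g.
      by rewrite -e1 -e2 !subrK.
    by exists 0, 0 => i i_n ig; case: none; exists i.
  have := @cell_approx R (keys s 0) (keys s 1) (keys s 2) m L M cx cy
    (offx s) (offy s) (rep s g) Og sectors m_ge2 M_gt0 M_large.
  case.
  - by rewrite filter_uniq.
  - move=> i /OgP[iO ig]; have [-> ->] := cxy _ (On _ iO) ig.
    by have [h1 h2 _] := rng _ (On _ iO).
  - by move=> i j /OgP[iO _] /OgP[jO _]; apply: Ofar.
  - move=> a asl /(repP _ asl)[rn /and3P[/eqP rg _ rs]].
    have [e1 e2] := cxy _ rn rg; have [h1 h2 _] := rng _ rn.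
    by split.
  - move=> i a /OgP[iO ig] asl ia; have [_ r2] := reps a asl g gn.
    by apply: r2; rewrite ?On //; apply/and3P; split; rewrite ?ig ?Ok.
  - by move=> c [c1 c2 c3]; exists c; split=> //; rewrite -big_filter.
have /choice[f fP] : forall g : nat, exists c, (g < (2 * n).+1)%N ->
   [/\ c \in sublists (slots L M), valid (keys s 0) (keys s 1) (rep s g) c &
    \sum_(i <- O | cellid s i == g%:Z) wt s i <= 4 * value (keys s 2) (rep s g) c].
  move=> g; have [/cell[c ?]|_] := boolP (g < (2 * n).+1)%N; first by exists c.
  by exists [::].
have opt' : \sum_(0 <= g < (2 * n).+1) value (keys s 2) (rep s g) (f g) <= rreg s' 4.
  by apply: opt => g /fP[].
apply: le_trans (_ : \sum_(0 <= g < (2 * n).+1)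
    \sum_(i <- O | cellid s i == g%:Z) wt s i <= _).
  rewrite (exchange_big_dep xpredT) //= big_seq [leRHS]big_seq.
  apply: ler_sum => i iO; have [_ _ /andP[c0 cn]] := rng _ (On _ iO).
  have [g gE] : exists g : nat, cellid s i = g%:Z.
    by exists `|cellid s i|%N; rewrite gez0_abs.
  rewrite gE ltz_nat in cn; rewrite -big_filter gE.
  rewrite (_ : [seq j <- _ | _] = [:: g]) ?big_seq1 //.
  under eq_filter => j do rewrite eqz_nat eq_sym.
  by rewrite filter_pred1_uniq ?iota_uniq // mem_index_iota.
apply: le_trans (_ : 4 * (\sum_(0 <= g < (2 * n).+1)
    value (keys s 2) (rep s g) (f g)) <= _); last by rewrite ler_pM2l.
rewrite mulr_sumr !big_nat; apply: ler_sum => g /andP[_ gn].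
by have [] := fP _ gn.
Qed.

End CellSum.

Section Shifts.
Variables (R : realType) (K M : nat) (m : R).
Local Notation L := (2 * K)%N.
Hypothesis sectors : forall p : R * R, norm2 p <= 2 * L%:R ^+ 2 ->
  exists c : R * R -> 'I_3, forall q q',
    norm2 q <= norm2 p -> norm2 q' <= norm2 p ->
    m <= dist2 p q <= 4 -> m <= dist2 p q' <= 4 ->
    c q = c q' -> dist2 q q' < m.
Hypotheses (m_ge2 : 2 <= m) (M_gt0 : (0 < M)%N)
  (M_large : 8 * L%:R <= (4 - m) * M%:R).

(* [bounded] tells whether the cell numbers of [cutter] are required to be
   small by [grouper]; this is so for sorting but not for hashing. *)
Variables (cutter : nat -> nat -> nat -> cmd) (grouper : cmd) (bounded : bool)
  (F : nat -> nat).
Hypothesis F_ge : forall n, (n.+1 <= F n)%N.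
Hypothesis cutter_confined : forall ak ab ao,
  confined (predC (mem [:: 0; 1; 3]%N)) (predC1 3%N) (mem [:: 0; 1; ab]%N)
    (pred1 ao) (cutter ak ab ao).
Hypothesis cutter_rule : forall n ak ab ao (s : state R), ak != ao -> (1 < ab)%N ->
  ireg s 1 = n%:Z ->
  exists s', [/\ exec_within (F n) (cutter ak ab ao) s s',
    interval_cut L n (keys s ak) (fun i => iarr s' (ab, i%:Z))
      (fun i => rarr s' (ao, i%:Z)) &
    bounded -> forall i, (i < n)%N -> 0 <= iarr s' (ab, i%:Z) <= (2 * n)%:Z].
Hypothesis grouper_confined :
  confined (predC (mem [:: 0; 1; 3]%N)) (predC1 3%N) (predC (mem [:: 2; 3]%N))
    (predC (mem (iota 0 9))) grouper.
Hypothesis grouper_rule : forall n (s : state R), ireg s 1 = n%:Z ->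
  ireg s 3 = (2 * n).+1%:Z ->
  (bounded -> forall i, (i < n)%N -> 0 <= iarr s (5%N, i%:Z) <= (2 * n).+1%:Z) ->
  exists2 s', exec_within (F n) grouper s s' &
    cell_ids n (fun i => iarr s (4%N, i%:Z)) (fun i => iarr s (5%N, i%:Z))
             (fun i => iarr s' (6%N, i%:Z)).

(** What choosing a set for one shift leaves intact: the input, the best result so far and the
    unshifted cuts, from which every shift starts. *)
Definition in_place := @same_off R (predC (mem [:: 0; 1; 3]%N)) (predC1 3%N)
  (predC (mem [:: 2; 3]%N)) (predC (mem (iota 0 7))).

Definition kept_by (s : state R) (a i : nat) : bool :=
  (2 <= shifted L a (rarr s (5%N, i%:Z))) && (2 <= shifted L a (rarr s (6%N, i%:Z))).

Definition ready n (s : state R) : Prop :=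
  [/\ ireg s 1 = n%:Z, ireg s 3 = (2 * n).+1%:Z,
      interval_cut L n (keys s 0) (fun i => iarr s (2%N, i%:Z))
        (fun i => rarr s (5%N, i%:Z)),
      interval_cut L n (keys s 1) (fun i => iarr s (3%N, i%:Z))
        (fun i => rarr s (6%N, i%:Z)) &
      bounded -> forall i, (i < n)%N -> 0 <= iarr s (3%N, i%:Z) <= (2 * n)%:Z].

(** [s0] is the state after [setup]. The frame is weaker than [in_place], as [update] overwrites the
    result. The guarantee is kept for each shift in [l], because a good shift is only known to exist
    by averaging. *)
Definition record n (s0 : state R) (l : seq nat) (s : state R) : Prop :=
  [/\ same_off (predC (mem [:: 1; 3]%N)) predT
        (predC (mem [:: 2; 3]%N)) (predC (mem [:: 0; 1; 2; 5; 6]%N)) s0 s,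
      exists S, [/\ ireg s 0 = (size S)%:Z,
        forall t, (t < size S)%N ->
          (rarr s (3%N, t%:Z), rarr s (4%N, t%:Z)) = spt s0 (nth 0%N S t),
        indep n s0 S & rreg s 3 = \sum_(i <- S) wt s0 i] &
      forall a O, a \in l -> indep n s0 O -> (forall i, i \in O -> kept_by s0 a i) ->
        \sum_(i <- O) wt s0 i <= 4 * rreg s 3].

Lemma in_placeW pi pr pa pb s s' :
  subpred pi (predC (mem [:: 0; 1; 3]%N)) -> subpred pr (predC1 3%N) ->
  subpred pa (predC (mem [:: 2; 3]%N)) -> subpred pb (predC (mem (iota 0 7))) ->
  same_off pi pr pa pb s s' -> in_place s s'.
Proof.
move=> h1 h2 h3 h4 [g1 g2 g3 g4]; split=> x hx.
- by apply: g1; apply: contra hx => /h1.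
- by apply: g2; apply: contra hx => /h2.
- by apply: g3; apply: contra hx => /h3.
- by apply: g4; apply: contra hx => /h4.
Qed.

Lemma shift_choice_rule n s a : (a < K)%N -> ready n s ->
  exists s' S, [/\ exec_within (F n) (shift_choice grouper L M a) s s',
    in_place s s',
    ireg s' 12 = (size S)%:Z /\
      (forall t, (t < size S)%N -> iarr s' (7%N, t%:Z) = (nth 0%N S t)%:Z),
    indep n s S /\ rreg s' 4 = \sum_(i <- S) wt s i &
    forall O, indep n s O -> (forall i, i \in O -> kept_by s a i) ->
      \sum_(i <- O) wt s i <= 4 * rreg s' 4].
Proof.
move=> aK [s1 s3 cx cy bd].
have nF := F_ge n; have mF : (n.+1 <= 2 * F n)%N by clear -nF; lia.
have F0 : (0 < F n)%N by clear -nF; lia.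
have aL : (2 * a < L)%N by rewrite ltn_mul2l.
have [sA wA rA] := @shift_cut_rule R L n (F n) a 2 5 7 4 s isT isT mF s1.
have kA : same_off (pred1 2%N) pred0 (pred1 4%N) (pred1 7%N) s sA.
  by apply: frame_confined (within_frame wA).
have [iA _ aA bA] := kA.
have [|sB wB rB] := @shift_cut_rule R L n (F n) a 3 6 8 5 sA isT isT mF.
  by rewrite iA.
have kB : same_off (pred1 2%N) pred0 (pred1 5%N) (pred1 8%N) sA sB.
  by apply: frame_confined (within_frame wB).
have [iB _ aB bB] := kB.
have B5 i : (i < n)%N -> iarr sB (5%N, i%:Z) =
    shifted_cell L a (iarr s (3%N, i%:Z)) (rarr s (6%N, i%:Z)).
  by move=> i_n; have [_ ->] := rB _ i_n; rewrite aA // bA.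
have [|||sC wC [idr idE]] := @grouper_rule n sB.
- by rewrite iB // iA.
- by rewrite iB // iA.
- move=> /bd h i i_n; rewrite B5 //; have := h _ i_n; rewrite /shifted_cell.
  by case: ifP => _; clear; lia.
have kC := frame_confined grouper_confined (within_frame wC).
have [iC _ aC bC] := kC.
have [|||sD [wD kD reps]] := @fill_slots_rule R n (F n) L M sC nF.
- by rewrite iC // iB // iA.
- by rewrite iC // iB // iA.
- exact: idr.
have [iD _ aD bD] := kD.
have D0 (b : nat) p : b \in iota 0 7 -> rarr sD (b, p) = rarr s (b, p).
  move=> hb; rewrite bD // bC; last first.
    by apply: predCN; move: hb; rewrite !mem_iota => /andP[_ /leq_trans ->].
  rewrite bB /=; last by apply: contraTN hb => /eqP ->.
  by rewrite bA //=; apply: contraTN hb => /eqP ->.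
have D7 i : (i < n)%N -> offx sD i = shifted L a (rarr s (5%N, i%:Z)).
  by move=> i_n; rewrite /offx bD // bC // bB //; have [-> _] := rA _ i_n.
have D8 i : (i < n)%N -> offy sD i = shifted L a (rarr s (6%N, i%:Z)).
  by move=> i_n; rewrite /offy bD // bC //; have [-> _] := rB _ i_n; rewrite bA.
have D6 i : cellid sD i = iarr sC (6%N, i%:Z) by exact: aD.
have kE b : (b < 7)%N -> keys sD b = keys s b.
  by move=> b7; apply: funext => p; apply: D0; rewrite mem_iota.
have idD i j : (i < n)%N -> (j < n)%N -> (cellid sD i == cellid sD j) =
    (shifted_cell L a (iarr s (2%N, i%:Z)) (rarr s (5%N, i%:Z)) ==
     shifted_cell L a (iarr s (2%N, j%:Z)) (rarr s (5%N, j%:Z))) &&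
    (shifted_cell L a (iarr s (3%N, i%:Z)) (rarr s (6%N, i%:Z)) ==
     shifted_cell L a (iarr s (3%N, j%:Z)) (rarr s (6%N, j%:Z))).
  move=> i_n j_n; rewrite !D6 idE // !B5 // !aB //.
  by have [_ ->] := rA _ i_n; have [_ ->] := rA _ j_n.
have SX := cut_shifted aL cx; have SY := cut_shifted aL cy.
have kept_pos i : (i < n)%N -> kept sD i = kept_by s a i.
  by move=> i_n; rewrite /kept D7 // D8.
have far : {in gtn n &, forall i j, kept sD i -> kept sD j ->
    cellid sD i != cellid sD j -> 4 < dist2 (spt sD i) (spt sD j)}.
  move=> i j i_n j_n; rewrite !kept_pos // => /andP[xi yi] /andP[xj yj].
  rewrite idD // negb_and /dist2 /spt /= !kE // => /orP[ne|ne].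
    have [_ _ /(_ ne xi xj) h] := SX _ _ i_n j_n.
    by apply: lt_le_trans h _; rewrite lerDl sqr_ge0.
  have [_ _ /(_ ne yi yj) h] := SY _ _ i_n j_n.
  by apply: lt_le_trans h _; rewrite lerDr sqr_ge0.
have [|sE [S [wE kE' sol]]] := @solve_rule R n (F n) L M sD nF _ reps far.
  by rewrite iD // iC // iB // iA.
have rng i : (i < n)%N -> [/\ 0 <= offx sD i < L%:R, 0 <= offy sD i < L%:R &
     0 <= cellid sD i < (2 * n).+1%:Z].
  move=> i_n; rewrite D7 // D8 // D6; split; last exact: idr.
    by have [] := SX _ _ i_n i_n.
  by have [] := SY _ _ i_n i_n.
have orig i j : (i < n)%N -> (j < n)%N -> cellid sD i = cellid sD j ->
     keys sD 0 i - offx sD i = keys sD 0 j - offx sD j /\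
     keys sD 1 i - offy sD i = keys sD 1 j - offy sD j.
  move=> i_n j_n /eqP; rewrite idD // => /andP[/eqP ex /eqP ey].
  rewrite !kE // !D7 // !D8 //.
  have [_ /(_ ex) h _] := SX _ _ i_n j_n; have [_ /(_ ey) h' _] := SY _ _ i_n j_n.
  by split.
have approx := solution_approx sectors m_ge2 M_gt0 M_large rng orig reps sol.
have iE O : indep n s O -> indep n sD O.
  by case=> uO On Of; split=> // i j iO jO ij; rewrite /spt !kE //; apply: Of.
have wE' i : wt sD i = wt s i by apply: D0.
have [s12 [uS SP] Sfar sS _] := sol.
exists sE, S; split.
- by do 5!(apply: within_seq; first eassumption); apply: (@run_within _ _ Skip).
- apply: same_off_trans (in_placeW _ _ _ _ kA) _ => [x /eqP ->|//|x /eqP ->|x /eqP ->|] //.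
  apply: same_off_trans (in_placeW _ _ _ _ kB) _ => [x /eqP ->|//|x /eqP ->|x /eqP ->|] //.
  apply: same_off_trans (in_placeW _ _ _ _ kC) _ => // [x|].
    by do 7!(case: x => [|x] //).
  apply: same_off_trans (in_placeW _ _ _ _ kD) (in_placeW _ _ _ _ kE') => // x.
  + by move=> /eqP ->.
  + by rewrite /= !inE; case: x => [|[|[|[|x]]]].
  + by rewrite /= !inE => /or3P[] /eqP ->.
  + by rewrite /= !inE => /orP[] /eqP ->.
  + by move=> /eqP ->.
- exact: s12.
- split; last by rewrite sS; apply: eq_bigr => i _; apply: wE'.
  split=> // [i /SP[]//|i j iS jS ij].
  by have := Sfar _ _ iS jS ij; rewrite /spt !kE.
- move=> O iO kO; rewrite (eq_bigr _ (fun i _ => esym (wE' i))).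
  apply: approx; first exact: iE.
  by move=> i iO'; rewrite kept_pos; [apply: kO|case: iO => _ + _; apply].
Qed.

Lemma shift_prog_rule n s0 l a s : (a < K)%N -> ready n s0 -> record n s0 l s ->
  exists2 s', exec_within (F n) (shift_prog grouper L M a) s s' &
    record n s0 (rcons l a) s'.
Proof.
move=> aK [h1 h3 cx cy bd] [[f1 f2 f3 f4] [S [S0 Sout Sind Sw]] best].
have nF := F_ge n; have mF : (n.+1 <= 2 * F n)%N by clear -nF; lia.
have F0 : (0 < F n)%N by clear -nF; lia.
have kE b : b \in [:: 0; 1; 2; 5; 6]%N -> keys s b = keys s0 b.
  by move=> hb; apply: funext => p; apply: f4; rewrite /= hb.
have aE b i : b \in [:: 2; 3]%N -> iarr s (b, i) = iarr s0 (b, i).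
  by move=> hb; apply: f3; apply: predCN.
have bE b i : b \in [:: 0; 1; 2; 5; 6]%N -> rarr s (b, i) = rarr s0 (b, i).
  by move=> hb; apply: f4; apply: predCN.
have E2 : (fun i : nat => iarr s (2%N, i%:Z)) = fun i : nat => iarr s0 (2%N, i%:Z).
  by apply: funext => i; apply: aE.
have E3 : (fun i : nat => iarr s (3%N, i%:Z)) = fun i : nat => iarr s0 (3%N, i%:Z).
  by apply: funext => i; apply: aE.
have E5 : (fun i : nat => rarr s (5%N, i%:Z)) = fun i : nat => rarr s0 (5%N, i%:Z).
  by apply: funext => i; apply: bE.
have E6 : (fun i : nat => rarr s (6%N, i%:Z)) = fun i : nat => rarr s0 (6%N, i%:Z).
  by apply: funext => i; apply: bE.
have rd : ready n s.
  split; rewrite ?f1 ?E2 ?E3 ?E5 ?E6 ?kE //.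
  by move=> b i i_n; rewrite aE //; apply: bd.
have [s1 [S' [w1 kp [S12 S7] [S'ind S'w] S'best]]] := shift_choice_rule aK rd.
have [g1 g2 g3 g4] := kp.
have sptE i : spt s i = spt s0 i by rewrite /spt !kE.
have wtE i : wt s i = wt s0 i by apply: bE.
have indE O : indep n s0 O <-> indep n s O.
  by split=> -[uO On Of]; split=> // i j iO jO ij; have := Of _ _ iO jO ij;
    rewrite !sptE.
have S'best' O : indep n s0 O -> (forall i, i \in O -> kept_by s0 a i) ->
    \sum_(i <- O) wt s0 i <= 4 * rreg s1 4.
  move=> /indE iO kO; rewrite -(eq_bigr _ (fun i _ => wtE i)); apply: S'best => // i iO'.
  by rewrite /kept_by !bE //; apply: kO.
have s13 : rreg s1 3 = rreg s 3 by rewrite g2 //= eqxx.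
have kp0 : same_off (predC (mem [:: 1; 3]%N)) predT
        (predC (mem [:: 2; 3]%N)) (predC (mem [:: 0; 1; 2; 5; 6]%N)) s0 s1.
  apply: same_off_trans (And4 f1 f2 f3 f4) _; split=> //= x.
  - by rewrite negbK !inE => hx; apply: g1; rewrite /= negbK !inE hx orbT.
  - rewrite negbK !inE => hx; apply: g4; rewrite /= negbK !inE.
    by move: hx; clear; lia.
have [lt|ge] := ltP (rreg s1 3) (rreg s1 4); last first.
  exists s1.
    apply: within_seq w1 _; apply: within_if => //.
    by rewrite /= -ltNge ltNge ge; apply: (@run_within _ _ Skip).
  split=> //.
  - exists S; split=> //; first by rewrite g1.
    + by move=> t tS; rewrite !g4 //; apply: Sout.
    + by rewrite s13.
  - move=> b O; rewrite mem_rcons inE => /orP[/eqP ->|bl] iO kO.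
      by apply: le_trans (S'best' _ iO kO) _; rewrite ler_pM2l.
    by rewrite s13; apply: best kO.
pose init := Seq (RSet 3 (RVar 4)) (ISet 0 (IVar 12)).
pose s2 := run init s1.
(* This bounds the length of the copying loop. *)
have szS' : (size S' <= n)%N.
  have [uS' S'n _] := S'ind; rewrite -[leqRHS](size_iota 0); apply: uniq_leq_size => //.
  by move=> i /S'n; rewrite mem_iota.
have mF' : ((size S').+1 <= 2 * F n)%N by clear -mF szS'; lia.
have [||s3 [w3 k3 I3]] := @for_rule R (fun k s' => forall t, (t < k)%N ->
    (rarr s' (3%N, t%:Z), rarr s' (4%N, t%:Z)) = spt s0 (nth 0%N S' t))
  (F n) (size S') 2 12 copy_step s2 mF' isT isT isT isT S12.
- by [].
- move=> k s' kS s'k [c1 c2 c3 c4] Is' t tk.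
  have [->|tk'] := eqVneq t k; last first.
    have {}tk : (t < k)%N by rewrite ltn_neqAle tk' -ltnS.
    by rewrite -Is' // /= !xpair_eqE s'k !eqz_nat (negPf tk').
  rewrite /= !xpair_eqE s'k !eqxx /= !c3 //= S7 // !c4 //= !g4 // !bE //.
have [d1 d2 d3 d4] := k3.
exists s3.
  apply: within_seq w1 _; apply: within_if => //.
  rewrite (_ : eval_t s1 _ = true) /=; last by rewrite -ltNge.
  do 2!(apply: within_seq; first exact: run_within).
  by apply: within_seq w3 _; apply: (@run_within _ _ Skip).
split.
- apply: same_off_trans kp0 _; split=> //= x.
  + rewrite negbK !inE => hx; rewrite d1 /=.
      by case/orP: hx => /eqP ->.
    by case/orP: hx => /eqP ->.
  + by move=> hx i; rewrite d3.
  + rewrite negbK !inE => hx i; rewrite d4 //.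
    by move: hx; rewrite !inE; clear; lia.
- exists S'; split=> //.
  + by rewrite d1.
  + exact/indE.
  + by rewrite d2 //= S'w; apply: eq_bigr => i _; apply: wtE.
- have s33 : rreg s3 3 = rreg s1 4 by rewrite d2.
  move=> b O; rewrite mem_rcons inE s33 => /orP[/eqP ->|bl] iO kO.
    exact: S'best'.
  apply: le_trans (best _ _ bl iO kO) _; rewrite ler_pM2l // -s13; exact: ltW.
Qed.

Lemma setup_rule n s : ireg s 0 = n%:Z -> rreg s 3 = 0 ->
  exists s', [/\ exec_within (F n) (setup cutter) s s',
    ready n s', record n s' [::] s' &
    forall b i, (b < 3)%N -> rarr s' (b, i) = rarr s (b, i)].
Proof.
move=> s0 r3; have nF := F_ge n; have F0 : (0 < F n)%N by apply: leq_trans nF.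
pose init := seqs [:: ISet 1 (IVar 0);
  ISet 3 (IAdd (IAdd (IVar 0) (IVar 0)) (IConst 1)); ISet 0 (IConst 0)].
pose sA := run init s.
have A1 : ireg sA 1 = n%:Z by rewrite /= s0.
have A3 : ireg sA 3 = (2 * n).+1%:Z by rewrite /= s0; clear; lia.
have [sB [wB cB bB]] := @cutter_rule n 0 2 5 sA isT isT A1.
have [iB pB aB rB] := frame_confined (cutter_confined 0 2 5) (within_frame wB).
have [|sC [wC cC bC]] := @cutter_rule n 1 3 6 sB isT isT; first by rewrite iB.
have [iC pC aC rC] := frame_confined (cutter_confined 1 3 6) (within_frame wC).
have kC b : (b < 3)%N -> keys sC b = keys sB b.
  by move=> b3; apply: funext => p; apply: rC => /=; apply: contraTN b3 => /eqP ->.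
have kB b : (b < 3)%N -> keys sB b = keys sA b.
  by move=> b3; apply: funext => p; apply: rB => /=; apply: contraTN b3 => /eqP ->.
exists sC; split.
- do 3!(apply: within_seq; first exact: run_within).
  apply: within_seq wB _; apply: within_seq wC _; exact: (@run_within _ _ Skip).
- split.
  + by rewrite iC // iB.
  + by rewrite iC // iB.
  + rewrite kC // kB // (_ : (fun i => rarr sC _) = fun i : nat => rarr sB (5%N, i%:Z)).
      rewrite (_ : (fun i => iarr sC _) = fun i : nat => iarr sB (2%N, i%:Z)) //.
      by apply: funext => i; apply: aC.
    by apply: funext => i; apply: rC.
  + by rewrite kC.
  + by move=> /bC.
- split=> //; exists [::]; split=> //; first by rewrite iC // iB.
  by rewrite pC //= ?eqxx // pB //= ?eqxx // big_nil.
- move=> b i b3; rewrite rC; last by apply: contraTN b3 => /eqP ->.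
  by rewrite rB //; apply: contraTN b3 => /eqP ->.
Qed.

Lemma count_le1 (T : eqType) (p : pred T) (s : seq T) : uniq s ->
  {in s &, forall x y, p x -> p y -> x = y} -> (count p s <= 1)%N.
Proof.
elim: s => //= x s IH /andP[xs us] h.
have {}IH : (count p s <= 1)%N.
  by apply: IH us _ => y z ys zs; apply: h; rewrite inE ?ys ?zs orbT.
have [px|npx] := boolP (p x); last by rewrite add0n.
rewrite (eq_in_count (a2 := pred0)) ?count_pred0 // => y ys /=.
apply/negP => py; have := h x y; rewrite !inE eqxx ys orbT => /(_ isT isT px py) xy.
by rewrite xy ys in xs.
Qed.

(* Each point is dropped by at most two of the [K] shifts, once for each
   coordinate, so the shifts retain a fraction [(K - 2) / K] on average. *)
Lemma shifts_average n s (O : seq nat) : (2 < K)%N -> ready n s ->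
  (forall i, i \in O -> (i < n)%N /\ 0 <= wt s i) ->
  (K%:R - 2) * \sum_(i <- O) wt s i <=
  \sum_(a <- iota 0 K) \sum_(i <- O | kept_by s a i) wt s i.
Proof.
move=> K2 [_ _ [cx _] [cy _] _] OP.
rewrite (exchange_big_dep xpredT) //= mulr_sumr big_seq [leRHS]big_seq.
apply: ler_sum => i /OP[i_n w0].
rewrite big_const_seq iter_addr_0.
have one (o : R) : 0 <= o < L%:R ->
    (count (fun a => shifted L a o < 2)%R (iota 0 K) <= 1)%N.
  move=> oL; apply: count_le1; first exact: iota_uniq.
  move=> a b; rewrite !mem_iota => /andP[_ aK] /andP[_ bK].
  by apply: margin_unique oL _ _ _; rewrite ?ltn_mul2l // mul2n odd_double.
have : (K - 2 <= count (kept_by s ^~ i) (iota 0 K))%N.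
  rewrite leq_subLR -{1}(size_iota 0 K) -(count_predC (kept_by s ^~ i)) addnC.
  rewrite leq_add2r -addn1.
  (* A shift that drops the point does so in one of the two coordinates: a union bound on counts. *)
  apply: leq_trans (leq_add (one _ (cx _ i_n)) (one _ (cy _ i_n))).
  rewrite -count_predUI; apply: leq_trans (leq_addr _ _).
  by apply: sub_count => a /=; rewrite /kept_by negb_and -!ltNge.
move=> cK; apply: le_trans (ler_wpMn2l w0 cK).
by rewrite -[leRHS]mulr_natl natrB // ltnW.
Qed.

Lemma dist_gt2 (p q : Defs.point R) : (2 < Defs.dist p q) = (4 < dist2 p q).
Proof.
have d0 : 0 <= dist2 p q by rewrite addr_ge0 // sqr_ge0.
rewrite -(ltr_sqr (x := 2)) ?nnegrE ?sqrtr_ge0 // sqr_sqrtr //.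
by rewrite -natrX.
Qed.

Lemma weight_fset_seq (w : Defs.point R -> R) (qs : seq (Defs.point R)) : uniq qs ->
  weight w [fset q in qs]%fset = \sum_(q <- qs) w q.
Proof.
move=> uqs; rewrite /weight; apply: perm_big; apply: uniq_perm => // q.
by rewrite inE.
Qed.

Lemma algorithm_approx (eps : R) : 0 < eps -> 2 + 8 / eps <= K%:R ->
  approximates_mwis (4 + eps) (algorithm cutter grouper K M)
    (fun n => work (algorithm cutter grouper K M) * F n)%N.
Proof.
move=> e0 Keps ps w ups; set n := size ps.
(* Equivalent to [4 * K <= (4 + eps) * (K - 2)]: it absorbs both the factor 4 and the fraction lost
   by the shifts. *)
have Ke : 8 <= (K%:R - 2) * eps by rewrite -ler_pdivrMr //; lra.
have K2' : 2 < K%:R :> R by have e8 : 0 < 8 / eps; [rewrite divr_gt0|lra].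
have K2 : (2 < K)%N by rewrite -(ltr_nat R).
have F0 : (0 < F n)%N by apply: leq_trans (F_ge n).
have [sC [wC rd rec inp]] := @setup_rule n (input ps w) erefl erefl.
have [||sD wD [_ [S [D0 Dout [uS Sn Sfar] Dw]] best]] :=
  @within_seqs R _ (fun l s' => record n sC l s') (F n)
  (shift_prog grouper L M) (iota 0 K) sC F0.
- move=> l1 a l2 s' E; apply: shift_prog_rule rd.
  have : a \in iota 0 K by rewrite E mem_cat mem_head orbT.
  by rewrite mem_iota.
- exact: rec.
pose P i := nth (0, 0) ps i.
have inpE i : (i < n)%N -> spt sC i = P i /\ wt sC i = w (P i).
  move=> i_n; rewrite /spt /wt /pt /keys !inp //= i_n -/(P i).
  by case: (P i).
have sptE i : (i < n)%N -> spt sC i = P i by case/inpE.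
have Pinj : {in gtn n &, injective P}.
  by move=> i j i_n j_n /eqP; rewrite nth_uniq // => /eqP.
pose qs := map P S.
have uqs : uniq qs.
  by rewrite map_inj_in_uniq // => i j /Sn i_n /Sn j_n; apply: Pinj.
have wS : rreg sD 3 = weight w [fset q in qs]%fset.
  rewrite weight_fset_seq // big_map Dw !big_seq; apply: eq_bigr => i /Sn i_n.
  by have [_ ->] := inpE _ i_n.
have [t tT ex] := within_seq wC wD.
exists t, sD, qs; split=> //.
- split; first by rewrite D0 size_map.
  by move=> i; rewrite size_map => iS; rewrite Dout // (nth_map 0%N) // sptE // Sn // mem_nth.
split.
- apply/fsubsetP => q; rewrite !inE => /mapP[i /Sn i_n ->]; exact: mem_nth.
- move=> p q; rewrite !inE => /mapP[i iS ->] /mapP[j jS ->] ij.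
  rewrite dist_gt2 -!sptE ?Sn //; apply: Sfar => //.
  by apply: contraNneq ij => ->.
move=> OPT [OPTps OPTind _].
(* Weights may be negative, whereas averaging needs nonnegative ones; leaving out the other points
   does not decrease the weight. *)
pose O := [seq i <- iota 0 n | (P i \in OPT) && (0 < w (P i))].
have OP i : i \in O -> [/\ (i < n)%N, P i \in OPT & 0 < w (P i)].
  by rewrite mem_filter mem_iota => /andP[/andP[? ?] ?].
have uO : uniq O by rewrite filter_uniq ?iota_uniq.
have Oind : indep n sC O.
  split=> // [i /OP[]//|i j iO jO ij].
  have [i_n iP _] := OP _ iO; have [j_n jP _] := OP _ jO.
  rewrite !sptE // -dist_gt2; apply: OPTind => //.
  by apply: contraNneq ij => /Pinj -> //.
have le1 : weight w OPT <= \sum_(i <- O) wt sC i.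
  apply: le_trans (_ : \sum_(p <- OPT | 0 < w p) w p <= _).
    rewrite /weight [leLHS](bigID (fun p => 0 < w p)) /= gerDl.
    by apply: sumr_le0 => p; rewrite -leNgt.
  rewrite -big_filter (perm_big (map P O)) ?big_map /=.
    rewrite big_seq [leRHS]big_seq le_eqVlt; apply/orP; left; apply/eqP.
    by apply: eq_bigr => i /OP[i_n _ _]; have [_ ->] := inpE _ i_n.
  apply: uniq_perm; first by rewrite filter_uniq ?fset_uniq.
    rewrite map_inj_in_uniq // => i j /OP[i_n _ _] /OP[j_n _ _]; exact: Pinj.
  move=> p; rewrite mem_filter; apply/andP/mapP => [[wp pO]|[i /OP[i_n iP iw] ->]//].
  have pps : p \in ps by move: (fsubsetP OPTps _ pO); rewrite inE.
  exists (index p ps); last by rewrite /P nth_index.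
  by rewrite mem_filter mem_iota /P nth_index // pO wp /= index_mem.
have avg := @shifts_average n sC O K2 rd.
have le2 : \sum_(a <- iota 0 K) \sum_(i <- O | kept_by sC a i) wt sC i <=
    K%:R * (4 * rreg sD 3).
  apply: le_trans (_ : \sum_(a <- iota 0 K) 4 * rreg sD 3 <= _).
    rewrite !big_seq; apply: ler_sum => a aK; rewrite -big_filter.
    apply: best aK _ _; last by move=> i; rewrite mem_filter => /andP[].
    case: Oind => _ On Of; split; first exact: filter_uniq.
      by move=> i; rewrite mem_filter => /andP[_ /On].
    move=> i j; rewrite mem_filter => /andP[_ iO]; rewrite mem_filter => /andP[_ jO].
    exact: Of.
  by rewrite big_const_seq count_predT size_iota iter_addr_0 -[leLHS]mulr_natl.
rewrite -wS; set W := rreg sD 3 in le2 *; set X := \sum_(i <- O) _ in le1 avg.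
apply: le_trans le1 _.
have avg' : (K%:R - 2) * X <= K%:R * (4 * W).
  apply: le_trans le2; apply: avg => i iO; have [i_n _ /ltW wi] := OP _ iO.
  by split=> //; have [_ ->] := inpE _ i_n.
have X0 : 0 <= X.
  rewrite /X big_seq; apply: sumr_ge0 => i /OP[i_n _ /ltW wi].
  by have [_ ->] := inpE _ i_n.
have W0 : 0 <= W.
  have : 0 <= K%:R * (4 * W) by apply: le_trans avg'; rewrite mulr_ge0 // subr_ge0 ltW.
  by rewrite mulrA pmulr_rge0 // mulr_gt0 //; lra.
rewrite -(ler_pM2l (_ : 0 < K%:R - 2)); last by lra.
apply: le_trans avg' _; have := ler_wpM2r W0 Ke; lra.
Qed.

End Shifts.

(** * Plain programs and asymptotic running times *)

Lemma plain_seqs (T : Type) (f : T -> cmd) (l : seq T) :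
  (forall a, plain (f a)) -> plain (seqs (map f l)).
Proof. by move=> h; elim: l => //= a l ->; rewrite h. Qed.

Lemma plain_try c : plain (try c).
Proof.
have v : plain_r (value_exp c) by elim: c => //= a c ->.
have t bs : all plain_t bs -> plain_t (TAll bs).
  by elim: bs => //= b bs IH /andP[-> /IH].
have vt : plain_t (valid_test c).
  by apply/andP; split; apply: t; rewrite all_map; apply/allP.
have -> : plain (try c) = [&& plain_t (valid_test c) && (plain_r (value_exp c) && true),
  plain_r (value_exp c) && plain (emit c) & true] by [].
by rewrite vt v plain_seqs.
Qed.

Lemma plain_algorithm cutter grouper K M :
  (forall ak ab ao, plain (cutter ak ab ao)) -> plain grouper ->
  plain (algorithm cutter grouper K M).
Proof.
move=> pc pg; have -> : plain (algorithm cutter grouper K M) =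
  (plain (cutter 0 2 5) && (plain (cutter 1 3 6) && true)) &&
  plain (seqs (map (shift_prog grouper (2 * K) M) (iota 0 K))) by [].
rewrite !pc /=; apply: plain_seqs => a; set cs := sublists (slots (2 * K) M).
have -> : plain (shift_prog grouper (2 * K) M a) =
  [&& plain grouper, plain (fill_slots (2 * K) M), plain (solve cs) & true] && true.
  by [].
rewrite pg plain_seqs //= -/(plain (seqs (map try cs))) plain_seqs // => c.
exact: plain_try.
Qed.

Section BigO.
Variable R : realType.

Lemma bigO_linear (C : nat) :
  bigO_time (fun n => C * n.+1)%N (fun n => n%:R : R).
Proof.
apply/eqO_exP; exists (C.*2.+1)%:R; first by rewrite ltr0n.
near=> n; rewrite !normr_nat -natrM ler_nat.
have n1 : (1 <= n)%N by near: n; exact: nbhs_infty_ge.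
rewrite -muln2; nia.
Unshelve. all: by end_near. Qed.

(** With [l = trunc_log 2 n >= 1], rounding up and the extra unit give at most [l + 2 <= 3 * l]. *)
Lemma up_log_ln (n : nat) : (1 < n)%N ->
  (up_log 2 n).+1%:R * ln 2 <= 3 * ln n%:R :> R.
Proof.
move=> n1; have n0 : (0 < n)%N by apply: ltnW.
have ln2 : 0 < ln 2 :> R by apply: ln_gt0; rewrite ltr1n.
have h1 : (up_log 2 n <= (trunc_log 2 n).+1)%N.
  by rewrite up_log_trunc_log // ltnS leq_trunc_log // leq_pred.
have h2 : (1 <= trunc_log 2 n)%N by rewrite trunc_log_gt0 //= ltn_predRL.
have h3 : (trunc_log 2 n)%:R * ln 2 <= ln n%:R :> R.
  rewrite mulr_natl -lnXn // ler_ln ?posrE ?exprn_gt0 ?ltr0n //.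
  by rewrite -natrX ler_nat trunc_logP.
have h4 : ((up_log 2 n).+1 <= 3 * trunc_log 2 n)%N by clear -h1 h2; lia.
apply: le_trans (_ : (3 * trunc_log 2 n)%:R * ln 2 <= _).
  by rewrite ler_pM2r // ler_nat.
by rewrite natrM -mulrA ler_pM2l.
Qed.

Lemma bigO_linearithmic (C : nat) :
  bigO_time (fun n => C * (n.+1 * (up_log 2 n).+1))%N
    (fun n => n%:R * ln n%:R : R).
Proof.
have ln2 : 0 < ln 2 :> R by apply: ln_gt0; rewrite ltr1n.
(* 6 is 2 from [n.+1 <= 2 * n] times 3 from [up_log_ln]; the successor keeps the constant positive
   for [C = 0]. *)
apply/eqO_exP; exists ((6 * C).+1%:R / ln 2); first by rewrite divr_gt0 // ltr0n.
near=> n.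
have n1 : (1 < n)%N by near: n; exact: nbhs_infty_ge.
have lnn : 0 <= ln n%:R :> R by apply: ln_ge0; rewrite ler1n ltnW.
rewrite normr_nat normrM normr_nat (ger0_norm lnn).
rewrite mulrAC ler_pdivlMr //.
have h : (n.+1%:R : R) <= 2 * n%:R by rewrite -natrM ler_nat; lia.
have u := up_log_ln n1.
rewrite !natrM.
have h' : (n.+1)%:R * ((up_log 2 n).+1%:R * ln 2) <= (2 * n%:R) * (3 * ln n%:R) :> R.
  by apply: ler_pM => //; rewrite mulr_ge0 // ltW.
apply: le_trans (_ : C%:R * ((2 * n%:R) * (3 * ln n%:R)) <= _).
  by rewrite -!mulrA ler_wpM2l // !mulrA; rewrite !mulrA in h'.
have nn : 0 <= n%:R * ln n%:R :> R by rewrite mulr_ge0.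
have -> : (6 * C).+1%:R = 6 * C%:R + 1 :> R by rewrite -[(6 * C).+1]addn1 natrD natrM.
nra.
Unshelve. all: by end_near. Qed.

End BigO.

Theorem theorem2 (R : realType) (eps : R) (eps_gt0 : 0 < eps) :
  (exists (c : cmd) (T : nat -> nat),
     approximates_mwis (4 + eps) c T /\ bigO_time T (fun n => n%:R : R)) /\
  (exists (c : cmd) (T : nat -> nat),
     [/\ plain c, approximates_mwis (4 + eps) c T &
         bigO_time T (fun n => n%:R * ln n%:R : R)]).
Proof.
pose K := (Num.bound (2 + 8 / eps)).+1.
have Keps : 2 + 8 / eps <= K%:R.
  rewrite ltW // (lt_trans (archi_boundP _)) ?ltr_nat //.
  by rewrite addr_ge0 // divr_ge0 // ltW.
pose L := (2 * K)%N.
have L0 : (0 < L)%N by [].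
have D0 : 0 <= 2 * L%:R ^+ 2 :> R by rewrite mulr_ge0 // sqr_ge0.
have [m [m2 m4 sectors]] := three_sectors D0.
pose M := (Num.bound (8 * L%:R / (4 - m))).+1.
have m40 : 0 < 4 - m by rewrite subr_gt0.
have ML : 8 * L%:R <= (4 - m) * M%:R.
  rewrite -ler_pdivrMl // mulrC.
  rewrite ltW // (lt_trans (archi_boundP _)) ?ltr_nat //.
  by rewrite divr_ge0 // ?mulr_ge0 // ltW.
split.
- pose c := algorithm (floor_cut L) hash_ids K M.
  exists c, (fun n => work c * n.+1)%N; split; last exact: bigO_linear.
  apply: (@algorithm_approx R K M m sectors m2 isT ML (floor_cut L) hash_ids
    false succn) => //.
  + move=> ak ab ao; rewrite /confined /= !inE /= !eqxx ?orbT //.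
  + move=> n ak ab ao s akao ab1 s1.
    have mF : (n.+1 <= 2 * n.+1)%N by rewrite leq_pmull.
    by have [s' w h] := floor_cut_rule ab L0 akao mF s1; exists s'.
  + move=> n s s1 s3 _; apply: hash_ids_rule => //.
    by rewrite leq_pmull.
- pose c := algorithm (compress L) (sort_ids L) K M.
  pose F n := (n.+1 * (up_log 2 n).+1)%N.
  exists c, (fun n => work c * F n)%N; split.
  + by apply: plain_algorithm.
  + apply: (@algorithm_approx R K M m sectors m2 isT ML (compress L)
      (sort_ids L) true F) => //.
    * by move=> n; rewrite leq_pmulr.
    * by move=> ak ab ao; rewrite /confined /= !inE /= !eqxx ?orbT.
    * move=> n ak ab ao s akao ab1 s1.
      by have [s' [w h1 h2]] := compress_rule L0 akao ab1 s1; exists s'.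
    * move=> n s s1 s3 h; exact: (@sort_ids_rule R L n s L0 s1 s3 (h isT)).
  + exact: bigO_linearithmic.
Qed.
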